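(* Let $\mathbb{F}$ be a finite field, let $D\ge 1$, and let $T\in\mathbb{F}^{n_0\times\dots\times n_{D-1}}$ be a concise tensor. Let $R\ge 0$ be an integer. There is an algorithm that either returns a rank-$R$ CPD of $T$ (i.e. factor matrices $A_d\in\mathbb{F}^{n_d\times R}$, $0\le d<D$, with $T=[\![A_0,\dots,A_{D-1}]\!]$) or correctly determines that none exists, running in time \[O^*\left(|\mathbb{F}|^{(R-n_0)\left(\sum_{d\ge 1} n_d\right) + \min\left(R,\ \sum_{d\ge 2} n_d\right)}\right)\] and using $O^*(1)$ space.
   Context: A rank-$R$ canonical polyadic decomposition (CPD) of a tensor $T$ over a ring is a list of matrices $A_d\in\mathbb{F}^{n_d\times R}$ with $T=[\![A_0,\dots,A_{D-1}]\!]$, where $[\![A_0,\dots,A_{D-1}]\!]$ is the tensor whose $(i_0,\dots,i_{D-1})$ entry is $\sum_{0\le r<R}\prod_{0\le d<D}(A_d)_{i_d,r}$. (Columns may be zero, so a rank-$R$ CPD exists iff the tensor rank, the minimal such $R$, is at most $R$.) A tensor $T\in\mathbb{F}^{n_0\times\dots\times n_{D-1}}$ is concise if for every axis $d$ the unfolding matrix $T_{(d)}$, whose $i_d$-th row is the vectorization of the slice of $T$ with $d$-th index fixed to $i_d$, has rank $n_d$ (full row rank). The notation $O^*(\cdot)$ suppresses factors polynomial in the input size (the entries of $T$, the $n_d$, $D$, $R$, and $\log|\mathbb{F}|$).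
   Formalization: The time bound is read as O^*(max(1, |F|^E)) with E the stated exponent: for R < n_0, E can be negative and the literal bound falls below one step (e.g. the n×n identity matrix over F_2 with R = 0); for R ≥ n_0 nothing changes. *)

(* Defs.v *)
From HB Require Import structures.
From mathcomp Require Import all_boot all_order all_algebra.

Set Implicit Arguments.
Unset Strict Implicit.
Unset Printing Implicit Defensive.

Import Order.TTheory GRing.Theory Num.Theory.
Local Open Scope ring_scope.

(** * Tensors, polyadic decompositions, conciseness *)

Definition midx (D : nat) (n : 'I_D -> nat) := {dffun forall d : 'I_D, 'I_(n d)}.

Definition tensor (F : Type) (D : nat) (n : 'I_D -> nat) := {ffun midx n -> F}.

Definition factors (F : Type) (D : nat) (n : 'I_D -> nat) (R : nat) :=
  forall d : 'I_D, 'M[F]_(n d, R).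

Definition cpd_tensor (F : fieldType) (D : nat) (n : 'I_D -> nat) (R : nat)
    (A : factors F n R) : tensor F n :=
  [ffun i : midx n => \sum_(r < R) \prod_(d < D) A d (i d) r].

Definition is_cpd (F : fieldType) (D : nat) (n : 'I_D -> nat) (R : nat)
    (T : tensor F n) (A : factors F n R) : Prop :=
  T = cpd_tensor A.

(* Indices of the slices along axis d: one coordinate for each axis e != d. *)
Definition slice_idx (D : nat) (n : 'I_D -> nat) (d : 'I_D) :=
  {dffun forall e : {e : 'I_D | e != d}, 'I_(n (val e))}.

Definition insert_coord (D : nat) (n : 'I_D -> nat) (d : 'I_D)
    (i : 'I_(n d)) (j : slice_idx n d) : midx n :=
  [ffun e : 'I_D =>
     match altP (@eqP _ e d) with
     | AltTrue eq_ed => ecast x 'I_(n x) (esym eq_ed) i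
     | AltFalse ne_ed => j (exist _ e ne_ed)
     end].

Lemma insert_coord_axis (D : nat) (n : 'I_D -> nat) (d : 'I_D)
    (i : 'I_(n d)) (j : slice_idx n d) : insert_coord i j d = i.
Proof.
rewrite ffunE; move: (altP _) => p; destruct p as [eq_dd|ne_dd].
  by rewrite (eq_axiomK (esym eq_dd)).
by exfalso; rewrite eqxx in ne_dd.
Qed.

Lemma insert_coord_off (D : nat) (n : 'I_D -> nat) (d : 'I_D)
    (i : 'I_(n d)) (j : slice_idx n d) (e : {e : 'I_D | e != d}) :
  insert_coord i j (val e) = j e.
Proof.
case: e => e ne /=; rewrite ffunE; move: (altP _) => p; destruct p as [eq_ed|ne'].
  by case/eqP: (ne).
by congr (j (exist _ e _)); apply: bool_irrelevance.
Qed.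

(* The columns are ordered by the library enumeration of slice_idx n d;
   the rank does not depend on this order. *)
Definition unfolding (F : Type) (D : nat) (n : 'I_D -> nat) (T : tensor F n)
    (d : 'I_D) : 'M[F]_(n d, #|{: slice_idx n d}|) :=
  \matrix_(i, c) T (insert_coord i (enum_val c)).

Definition concise (F : fieldType) (D : nat) (n : 'I_D -> nat)
    (T : tensor F n) : Prop :=
  forall d : 'I_D, \rank (unfolding T d) = n d.

(** * Machine model

   A random access machine in structured form.  It has finitely many
   (statically named) arrays of natural numbers and arrays of elements of a
   finite field F.  Programs do not depend on F: the field is available only
   through its operations, equality tests, and access to the i-th element of F
   in an arbitrary fixed order (that of the finType structure).

   Costs are logarithmic: each node of an evaluated expression is charged
   one plus the bit length of its value, a field element having the bit length
   of #|F|.  Space is the number of bits stored in memory (an array occupies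
   all the cells up to the highest one ever written), plus the bits used to
   evaluate the expressions of the current instruction.  On the usual
   representations of F these costs agree with bit costs up to factors
   polynomial in log #|F| and in the bit lengths of the numbers involved. *)

Inductive nexp : Type :=
| NConst of nat
| NRead of nat & nexp            (* NRead a e: cell e of array a *)
| NAdd of nexp & nexp
| NSub of nexp & nexp            (* truncated *)
| NMul of nexp & nexp
| NDiv of nexp & nexp
| NMod of nexp & nexp.

Inductive fexp : Type :=
| FZero
| FOne
| FElt of nexp                   (* FElt e: the e-th element of F, 0 if e >= #|F| *)
| FRead of nat & nexp
| FAdd of fexp & fexp
| FOpp of fexp
| FMul of fexp & fexp
| FInv of fexp.

Inductive bexp : Type :=
| BLe of nexp & nexp
| BEq of fexp & fexp
| BNot of bexp
| BAnd of bexp & bexp.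

Inductive cmd : Type :=
| Skip
| NWrite of nat & nexp & nexp    (* NWrite a e v: cell e of array a := v *)
| FWrite of nat & nexp & fexp
| Seq of cmd & cmd
| If of bexp & cmd & cmd
| While of bexp & cmd.

Record state (F : Type) := State { nmem : seq (seq nat); fmem : seq (seq F) }.

Definition bitlen (m : nat) : nat := (trunc_log 2 m).+1.

Section Semantics.
Variable F : finFieldType.

Definition nread (s : state F) (a i : nat) : nat := nth 0%N (nth [::] (nmem s) a) i.
Definition fread (s : state F) (a i : nat) : F := nth 0 (nth [::] (fmem s) a) i.

Definition write (X : Type) (x0 : X) (m : seq (seq X)) (a i : nat) (x : X) :=
  set_nth [::] m a (set_nth x0 (nth [::] m a) i x).

Definition nupd (s : state F) (a i x : nat) : state F :=
  State (write 0%N (nmem s) a i x) (fmem s).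
Definition fupd (s : state F) (a i : nat) (x : F) : state F :=
  State (nmem s) (write 0 (fmem s) a i x).

Definition state_size (s : state F) : nat :=
  (\sum_(l <- nmem s) (1 + \sum_(x <- l) bitlen x) +
   \sum_(l <- fmem s) (1 + size l * bitlen #|F|))%N.

Fixpoint neval (s : state F) (e : nexp) : nat :=
  match e with
  | NConst m => m
  | NRead a e1 => nread s a (neval s e1)
  | NAdd e1 e2 => neval s e1 + neval s e2
  | NSub e1 e2 => neval s e1 - neval s e2
  | NMul e1 e2 => neval s e1 * neval s e2
  | NDiv e1 e2 => neval s e1 %/ neval s e2
  | NMod e1 e2 => neval s e1 %% neval s e2
  end%N.

Fixpoint ncost (s : state F) (e : nexp) : nat :=
  (1 + bitlen (neval s e) +
   match e with
   | NConst _ => 0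
   | NRead _ e1 => ncost s e1
   | NAdd e1 e2 | NSub e1 e2 | NMul e1 e2 | NDiv e1 e2 | NMod e1 e2 =>
       ncost s e1 + ncost s e2
   end)%N.

Fixpoint feval (s : state F) (f : fexp) : F :=
  match f with
  | FZero => 0
  | FOne => 1
  | FElt e => nth 0 (enum F) (neval s e)
  | FRead a e => fread s a (neval s e)
  | FAdd f1 f2 => feval s f1 + feval s f2
  | FOpp f1 => - feval s f1
  | FMul f1 f2 => feval s f1 * feval s f2
  | FInv f1 => (feval s f1)^-1
  end.

Fixpoint fcost (s : state F) (f : fexp) : nat :=
  (1 + bitlen #|F| +
   match f with
   | FZero | FOne => 0
   | FElt e | FRead _ e => ncost s e
   | FOpp f1 | FInv f1 => fcost s f1
   | FAdd f1 f2 | FMul f1 f2 => fcost s f1 + fcost s f2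
   end)%N.

Fixpoint beval (s : state F) (b : bexp) : bool :=
  match b with
  | BLe e1 e2 => (neval s e1 <= neval s e2)%N
  | BEq f1 f2 => feval s f1 == feval s f2
  | BNot b1 => ~~ beval s b1
  | BAnd b1 b2 => beval s b1 && beval s b2
  end.

Fixpoint bcost (s : state F) (b : bexp) : nat :=
  (1 + match b with
       | BLe e1 e2 => ncost s e1 + ncost s e2
       | BEq f1 f2 => fcost s f1 + fcost s f2
       | BNot b1 => bcost s b1
       | BAnd b1 b2 => bcost s b1 + bcost s b2
       end)%N.

(* exec c s s' t m: started in s, the program c halts in s', after time t and
   using space m (the maximum over the whole run, including s and s'). *)
Inductive exec : cmd -> state F -> state F -> nat -> nat -> Prop :=
| ExSkip s : exec Skip s s 1 (state_size s)
| ExNWrite a e v s :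
    let s' := nupd s a (neval s e) (neval s v) in
    let t := (1 + ncost s e + ncost s v)%N in
    exec (NWrite a e v) s s' t (maxn (state_size s + t) (state_size s'))
| ExFWrite a e f s :
    let s' := fupd s a (neval s e) (feval s f) in
    let t := (1 + ncost s e + fcost s f)%N in
    exec (FWrite a e f) s s' t (maxn (state_size s + t) (state_size s'))
| ExSeq c1 c2 s s1 s2 t1 t2 m1 m2 :
    exec c1 s s1 t1 m1 -> exec c2 s1 s2 t2 m2 ->
    exec (Seq c1 c2) s s2 (t1 + t2) (maxn m1 m2)
| ExIf b c1 c2 s s' t m :
    exec (if beval s b then c1 else c2) s s' t m ->
    exec (If b c1 c2) s s' (bcost s b + t) (maxn (state_size s + bcost s b) m)
| ExWhileDone b c s :
    ~~ beval s b ->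
    exec (While b c) s s (bcost s b) (state_size s + bcost s b)
| ExWhileLoop b c s s1 s2 t1 t2 m1 m2 :
    beval s b -> exec c s s1 t1 m1 -> exec (While b c) s1 s2 t2 m2 ->
    exec (While b c) s s2 (bcost s b + t1 + t2)
      (maxn (state_size s + bcost s b) (maxn m1 m2)).

Lemma exec_det c s s1 s2 t1 t2 m1 m2 :
  exec c s s1 t1 m1 -> exec c s s2 t2 m2 -> [/\ s1 = s2, t1 = t2 & m1 = m2].
Proof.
have aux c' s' s3 t3 m3 : exec c' s' s3 t3 m3 ->
    forall s4 t4 m4, exec c' s' s4 t4 m4 -> (s3, t3, m3) = (s4, t4, m4).
  elim=> {c' s' s3 t3 m3}.
  - by move=> s' s4 t4 m4 H; inversion H.
  - by move=> a e v s' s3 t s4 t4 m4 H; inversion H.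
  - by move=> a e f s' s3 t s4 t4 m4 H; inversion H.
  - move=> c1 c2 s' s3 s4 t3 t4 m3 m4 _ IH1 _ IH2 s5 t5 m5 H; inversion H; subst.
    by do 2!match goal with
    | I : forall _ _ _, exec _ ?s _ _ _ -> _, E : exec _ ?s _ _ _ |- _ =>
        case: (I _ _ _ E) => ? ? ?; subst; clear I
    end.
  - move=> b c1 c2 s' s3 t m _ IH s5 t5 m5 H; inversion H; subst.
    by match goal with
    | E : exec (if _ then _ else _) _ _ _ _ |- _ =>
        case: (IH _ _ _ E) => ? ? ?; subst
    end.
  - move=> b c1 s' nb s5 t5 m5 H; inversion H; subst => //.
    by match goal with E : is_true (beval _ _) |- _ => rewrite E in nb end.
  - move=> b c1 s' s3 s4 t3 t4 m3 m4 bt _ IH1 _ IH2 s5 t5 m5 H.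
    inversion H; subst.
      by match goal with E : is_true (~~ beval _ _) |- _ => rewrite bt in E end.
    by do 2!match goal with
    | I : forall _ _ _, exec _ ?s _ _ _ -> _, E : exec _ ?s _ _ _ |- _ =>
        case: (I _ _ _ E) => ? ? ?; subst; clear I
    end.
by move=> H1 H2; case: (aux _ _ _ _ _ H1 _ _ _ H2).
Qed.

End Semantics.

(** * Input and output conventions *)

Lemma lin_mixed (N X Y : nat -> nat) m :
  (forall d, d < m -> X d < N d)%N -> (forall d, d < m -> Y d < N d)%N ->
  let L X := (\sum_(0 <= d < m) X d * \prod_(d.+1 <= e < m) N e)%N in
  (L X < \prod_(0 <= e < m) N e)%N /\
  (L X = L Y -> forall d, (d < m)%N -> X d = Y d).
Proof.
elim: m => [|m IH] hX hY /=; first by rewrite !big_geq.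
have rec Z : (\sum_(0 <= d < m.+1) Z d * \prod_(d.+1 <= e < m.+1) N e =
    (\sum_(0 <= d < m) Z d * \prod_(d.+1 <= e < m) N e) * N m + Z m)%N.
  rewrite big_nat_recr //= (big_geq (leqnn m.+1)) muln1 big_distrl /=.
  congr (_ + _)%N; rewrite big_nat [RHS]big_nat; apply: eq_bigr => d /andP[_ dm].
  by rewrite big_nat_recr //= mulnA.
have [lt_L inj_L] := IH (fun d h => hX d (ltnW h)) (fun d h => hY d (ltnW h)).
have [hXm hYm] := (hX m (leqnn _), hY m (leqnn _)).
rewrite !rec big_nat_recr //=; split.
  by apply: leq_trans (leq_mul lt_L (leqnn (N m))); rewrite mulSn addnC ltn_add2r.
move=> eq_L; have := congr1 (edivn^~ (N m)) eq_L; rewrite !edivn_eq // => -[e1 e2] d.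
by rewrite ltnS leq_eqVlt => /predU1P[->//|]; apply: inj_L e1 d.
Qed.

Section InputOutput.
Variables (F : finFieldType) (D : nat) (n : 'I_D -> nat).

(* Row-major position of the entry with multi-index i. *)
Definition lin (i : midx n) : nat :=
  (\sum_(d < D) i d * \prod_(e < D | d < e) n e)%N.

Lemma lin_bound_inj :
  (forall i : midx n, (lin i < \prod_(d < D) n d)%N) /\ injective lin.
Proof.
pose N k := if insub k is Some d then n d else 1%N.
pose X (i : midx n) k := if insub k is Some d then nat_of_ord (i d) else 0%N.
have NE (d : 'I_D) : N d = n d by rewrite /N valK.
have XE i (d : 'I_D) : X i d = i d by rewrite /X valK.
have hX i d : (d < D)%N -> (X i d < N d)%N.
  by move=> h; rewrite (XE i (Ordinal h)) (NE (Ordinal h)).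
have linE i : lin i = (\sum_(0 <= d < D) X i d * \prod_(d.+1 <= e < D) N e)%N.
  rewrite big_mkord; apply: eq_bigr => d _; rewrite XE; congr (_ * _)%N.
  rewrite (big_nat_widenl _ 0%N) // big_mkord.
  by apply: eq_big => [//|e _]; rewrite NE.
have prodE : (\prod_(d < D) n d = \prod_(0 <= e < D) N e)%N.
  by rewrite big_mkord; apply: eq_bigr => d _; rewrite NE.
split=> [i|i j]; rewrite !linE ?prodE; first by case: (lin_mixed (hX i) (hX i)).
case: (lin_mixed (hX i) (hX j)) => _ inj /inj eq_ij.
by apply/ffunP => d; apply/val_inj; rewrite /= -!XE; apply: eq_ij.
Qed.

Definition tensor_seq (T : tensor F n) : seq F :=
  mkseq (fun k => if [pick i : midx n | lin i == k] is Some i then T i else 0)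
        (\prod_(d < D) n d).

Lemma tensor_seqE (T : tensor F n) (i : midx n) :
  nth 0 (tensor_seq T) (lin i) = T i.
Proof.
have [lt_lin inj_lin] := lin_bound_inj.
rewrite nth_mkseq //; case: pickP => [j /eqP/inj_lin-> //|/(_ i)].
by rewrite eqxx.
Qed.

Definition input_state (T : tensor F n) (R : nat) : state F :=
  State [:: [:: D, R, #|F| & [seq n d | d <- enum 'I_D]]] [:: tensor_seq T].

(* The factor matrices are read from field array 1, as the row-major
   (\sum_d n d) x R matrix obtained by stacking A_0, A_1, ... vertically. *)
Definition output_factors (R : nat) (s : state F) : factors F n R :=
  fun d => \matrix_(i, r) fread s 1 ((\sum_(e < D | e < d) n e + i) * R + r)%N.

(* Cell 0 of array 1 tells whether a CPD is returned (1) or none exists (0). *)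
Definition correct_output (T : tensor F n) (R : nat) (s : state F) : Prop :=
  (nread s 1 0 = 1%N /\ is_cpd T (output_factors R s)) \/
  (nread s 1 0 = 0%N /\ ~ (exists A : factors F n R, is_cpd T A)).

Definition input_size (R : nat) : nat :=
  (\prod_(d < D) n d + \sum_(d < D) n d + D + R + bitlen #|F|)%N.

End InputOutput.

Arguments input_size F {D} n R.

(* An integer, negative only if R < n_0 (then no rank-R CPD of a concise tensor
   exists); since any running time is at least 1, a bound O^*(#|F| ^ E) is to be
   read with max(1, #|F| ^ E). *)
Definition exponent (D : nat) (n : 'I_D -> nat) (hD : (0 < D)%N) (R : nat) : int :=
  (R%:Z - (n (Ordinal hD))%:Z) * (\sum_(d < D | (1 <= d)%N) n d)%N%:Z
  + (minn R (\sum_(d < D | (2 <= d)%N) n d)%N)%:Z.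

(* Main.v *)
(* Write T_(0) = A_0 M, where row r of M is the flattened outer product of the
   r-th columns of A_1, ..., A_(D-1).  Conciseness gives A_0 rank n_0, so n_0
   columns of A_0 form a basis; let M' consist of the R - n_0 rows of M indexed by
   the other columns.  Then every row of M lies in the space V spanned by the rows
   of T_(0) and of M'.  Guess M' (the factor |F|^((R-n_0) sum_(d>=1) n_d)), then
   enlarge M' greedily by rank one tensors of V that are not yet in its span: since
   dim V <= rank M' + n_0, at most n_0 of them are added, and if M' was guessed
   right they all together span V, hence T_(0), so that A_0 is found by solving
   linear systems.
   It suffices to try the tails b = a_2 x ... x a_(D-1) of the rank one tensors of
   V, because {a_1 | a_1 x b in V} is a linear space, of which a basis is computed.
   The tails are enumerated directly (|F|^(sum_(d>=2) n_d)) or, if R is smaller, as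
   slices through a nonzero entry of all the combinations of the R generators of V
   (|F|^R).
   One elimination routine, computing left kernels, does all the linear algebra. *)

Require Import Defs.
From HB Require Import structures.
From mathcomp Require Import all_boot all_order all_algebra.
From mathcomp Require Import zify.

Set Implicit Arguments.
Unset Strict Implicit.
Unset Printing Implicit Defensive.

Import Order.TTheory GRing.Theory Num.Theory.

(** * Program logic for the machine *)

Section Syntax.
Local Open Scope nat_scope.

(** Soundness needs no theory: whatever was guessed, once all rows of T_(0) lie in the span of the R
    rank one tensors held in array X, the coefficients that witness this are the rows of A_0. Only
    completeness and the resource bounds take work. Although X grows, V stays fixed by the guess M':
    the appended tensors lie in V, so T_(0) and the current X together always span V. The dimension
    bound holds for wrong guesses too, so X never overflows. The space of all a_1 with a_1 x b in V
    is read off a left kernel: stack X, T_(0) and the tensors e_l x b, and keep the last n_1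
    coordinates of the kernel vectors. As a_1 is computed, b matters only up to a scalar; this is
    why slices of a combination can stand for b. Exactly two loops, those over the guesses, are not
    polynomial. Every other loop runs at most [L] times for a polynomial [L], so its time is bounded
    by a weight computed from the syntax; an explicit time budget is carried only around the two
    guessing loops. *)

Fixpoint nreads (e : nexp) : seq nat :=
  match e with
  | NConst _ => [::]
  | NRead a e1 => a :: nreads e1
  | NAdd e1 e2 | NSub e1 e2 | NMul e1 e2 | NDiv e1 e2 | NMod e1 e2 =>
      nreads e1 ++ nreads e2
  end.

Fixpoint nmods (c : cmd) : seq nat :=
  match c with
  | Skip | FWrite _ _ _ => [::]
  | NWrite a _ _ => [:: a]
  | Seq c1 c2 | If _ c1 c2 => nmods c1 ++ nmods c2
  | While _ c1 => nmods c1
  end.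

Fixpoint fmods (c : cmd) : seq nat :=
  match c with
  | Skip | NWrite _ _ _ => [::]
  | FWrite a _ _ => [:: a]
  | Seq c1 c2 | If _ c1 c2 => fmods c1 ++ fmods c2
  | While _ c1 => fmods c1
  end.

(* Widths and weights are counted in units of a common bound B on the bit
   length of every stored number and of #|F|. *)
Fixpoint nwidth (e : nexp) : nat :=
  match e with
  | NConst m => m.+1
  | NRead _ _ => 1
  | NAdd e1 e2 | NMul e1 e2 => nwidth e1 + nwidth e2
  | NSub e1 _ | NDiv e1 _ | NMod e1 _ => nwidth e1
  end.

Fixpoint nweight (e : nexp) : nat :=
  1 + nwidth e +
  match e with
  | NConst _ => 0
  | NRead _ e1 => nweight e1
  | NAdd e1 e2 | NSub e1 e2 | NMul e1 e2 | NDiv e1 e2 | NMod e1 e2 =>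
      nweight e1 + nweight e2
  end.

Fixpoint fweight (f : fexp) : nat :=
  2 + match f with
      | FZero | FOne => 0
      | FElt e | FRead _ e => nweight e
      | FOpp f1 | FInv f1 => fweight f1
      | FAdd f1 f2 | FMul f1 f2 => fweight f1 + fweight f2
      end.

Fixpoint bweight (b : bexp) : nat :=
  1 + match b with
      | BLe e1 e2 => nweight e1 + nweight e2
      | BEq f1 f2 => fweight f1 + fweight f2
      | BNot b1 => bweight b1
      | BAnd b1 b2 => bweight b1 + bweight b2
      end.

Fixpoint iweight (c : cmd) : nat :=
  match c with
  | Skip => 1
  | NWrite _ e v => 1 + nweight e + nweight v
  | FWrite _ e f => 1 + nweight e + fweight f
  | Seq c1 c2 => maxn (iweight c1) (iweight c2)
  | If b c1 c2 => maxn (bweight b) (maxn (iweight c1) (iweight c2))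
  | While b c1 => maxn (bweight b) (iweight c1)
  end.

(* Assumes that every loop makes at most L iterations. *)
Fixpoint tweight (L : nat) (c : cmd) : nat :=
  match c with
  | Skip => 1
  | NWrite _ e v => 1 + nweight e + nweight v
  | FWrite _ e f => 1 + nweight e + fweight f
  | Seq c1 c2 => tweight L c1 + tweight L c2
  | If b c1 c2 => bweight b + (tweight L c1 + tweight L c2)
  | While b c1 => L.+1 * (bweight b + tweight L c1)
  end.

(** The command does not depend on the input, so its loop nesting is bounded once and for all, and
    each loop adds one to the degree. Sequences add the degrees of their parts, which is crude but
    sufficient. *)
Lemma tweight_poly c : exists C k, forall L, 0 < L -> tweight L c <= C * L ^ k.
Proof.
elim: c => [|a e v|a e v|c1 [C1 [k1 h1]] c2 [C2 [k2 h2]]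
           |b c1 [C1 [k1 h1]] c2 [C2 [k2 h2]]|b c1 [C1 [k1 h1]]] /=.
- by exists 1, 0.
- by exists (1 + nweight e + nweight v), 0 => L _; rewrite expn0 muln1.
- by exists (1 + nweight e + fweight v), 0 => L _; rewrite expn0 muln1.
- exists (C1 + C2), (k1 + k2) => L L0; rewrite mulnDl leq_add //.
    by apply: leq_trans (h1 L L0) _; rewrite leq_mul2l leq_pexp2l ?leq_addr ?orbT.
  by apply: leq_trans (h2 L L0) _; rewrite leq_mul2l leq_pexp2l ?leq_addl ?orbT.
- exists (bweight b + (C1 + C2)), (k1 + k2) => L L0; rewrite !mulnDl !leq_add //.
  + by rewrite leq_pmulr // expn_gt0 L0.
  + by apply: leq_trans (h1 L L0) _; rewrite leq_mul2l leq_pexp2l ?leq_addr ?orbT.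
  + by apply: leq_trans (h2 L L0) _; rewrite leq_mul2l leq_pexp2l ?leq_addl ?orbT.
exists (2 * (bweight b + C1)), k1.+1 => L L0.
rewrite expnS mulnACA leq_mul //; first by lia.
by rewrite mulnDl leq_add ?h1 // leq_pmulr // expn_gt0 L0.
Qed.

Definition V (a : nat) : nexp := NRead a (NConst 0).
Definition Set_ (a : nat) (e : nexp) : cmd := NWrite a (NConst 0) e.
Definition FV (a : nat) : fexp := FRead a (NConst 0).
Definition FSet (a : nat) (f : fexp) : cmd := FWrite a (NConst 0) f.
Definition For (i : nat) (e : nexp) (body : cmd) : cmd :=
  Seq (Set_ i (NConst 0))
      (While (BLe (NAdd (V i) (NConst 1)) e)
             (Seq body (Set_ i (NAdd (V i) (NConst 1))))).

(** Expressions contain no loops, so a sum or a product needed by [v] must be accumulated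
    beforehand: [pre] leaves such values in scratch cells that [v] reads. *)
Definition Fill (i : nat) (e : nexp) (a : nat) (base : nexp) (pre : cmd) (v : fexp) :=
  For i e (Seq pre (FWrite a (NAdd base (V i)) v)).
Definition Acc (i : nat) (e : nexp) (a : nat) (op : fexp -> fexp -> fexp)
    (init : fexp) (pre : cmd) (v : fexp) :=
  Seq (FSet a init) (For i e (Seq pre (FSet a (op (FV a) v)))).
(** If all entries vanish, [p] stays 0 and points to a zero entry. The callers test that entry or
    tolerate it, so no separate flag is kept. *)
Definition Search (p i : nat) (e : nexp) (v : fexp) :=
  Seq (Set_ p (NConst 0))
      (For i e (If (BNot (BEq v FZero)) (Set_ p (V i)) Skip)).

End Syntax.

Section Logic.
Local Open Scope nat_scope.
Variables (F : finFieldType) (NA L B : nat).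
Hypothesis (L_gt0 : 0 < L) (LB : L < 2 ^ B) (qB : bitlen #|F| <= B).
Implicit Types (s : state F) (Q : state F -> Prop).

(** * Frame conditions, memory bounds and costs of instructions *)

Definition agree (nm fm : seq nat) s s' :=
  (forall a i, a \notin nm -> nread s' a i = nread s a i) /\
  (forall a i, a \notin fm -> fread s' a i = fread s a i).

Definition safe s :=
  [/\ size (nmem s) <= NA, size (fmem s) <= NA,
      forall a, size (nth [::] (nmem s) a) <= L,
      forall a, size (nth [::] (fmem s) a) <= L &
      forall a i, nread s a i < 2 ^ B].

Lemma agree_refl nm fm s : agree nm fm s s. Proof. by []. Qed.

Lemma agree_sub nm fm nm' fm' s s' : {subset nm <= nm'} -> {subset fm <= fm'} ->
  agree nm fm s s' -> agree nm' fm' s s'.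
Proof.
move=> hn hf [h1 h2]; split=> a i ha; first by apply: h1; apply: contra ha; apply: hn.
by apply: h2; apply: contra ha; apply: hf.
Qed.

Lemma agree_trans nm fm s1 s2 s3 :
  agree nm fm s1 s2 -> agree nm fm s2 s3 -> agree nm fm s1 s3.
Proof.
by move=> [h1 h2] [h3 h4]; split=> a i ha; rewrite ?h3 ?h1 ?h4 ?h2.
Qed.

Lemma nread_nupd s a i x b j :
  nread (nupd s a i x) b j = if (b == a) && (j == i) then x else nread s b j.
Proof.
rewrite /nread /nupd /write /= nth_set_nth /=; case: eqP => [->|//] /=.
by rewrite nth_set_nth.
Qed.

Lemma fread_nupd s a i x b j : fread (nupd s a i x) b j = fread s b j.
Proof. by []. Qed.

Lemma fread_fupd s a i x b j :
  fread (fupd s a i x) b j = if (b == a) && (j == i) then x else fread s b j.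
Proof.
rewrite /fread /fupd /write /= nth_set_nth /=; case: eqP => [->|//] /=.
by rewrite nth_set_nth.
Qed.

Lemma agree_nupd s a i x : agree [:: a] [::] s (nupd s a i x).
Proof. by split=> // b j; rewrite inE nread_nupd => /negPf->. Qed.

Lemma agree_fupd s a i x : agree [::] [:: a] s (fupd s a i x).
Proof. by split=> // b j; rewrite inE fread_fupd => /negPf->. Qed.

Lemma exec_agree c s s' t m : exec c s s' t m -> agree (nmods c) (fmods c) s s'.
Proof.
elim=> {c s s' t m} /=.
- by move=> s; apply: agree_refl.
- by move=> a e v s; apply: agree_nupd.
- by move=> a e v s; apply: agree_fupd.
- move=> c1 c2 s s1 s2 _ _ _ _ _ h1 _ h2; apply: (@agree_trans _ _ _ s1).
    by apply: agree_sub h1 => x hx; rewrite mem_cat hx.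
  by apply: agree_sub h2 => x hx; rewrite mem_cat hx orbT.
- move=> b c1 c2 s s' _ _ _; case: ifP => _ h; apply: agree_sub h => x hx;
    by rewrite mem_cat hx ?orbT.
- by move=> *; apply: agree_refl.
by move=> b c s s1 s2 _ _ _ _ _ _ h1 _; apply: agree_trans.
Qed.

Lemma neval_agree nm fm s s' e : agree nm fm s s' ->
  all (fun a => a \notin nm) (nreads e) -> neval s' e = neval s e.
Proof.
move=> [h _]; elim: e => //= [a e IH /andP[ha he]|||||];
  do ?by move=> e1 IH1 e2 IH2; rewrite all_cat => /andP[/IH1-> /IH2->].
by rewrite h // IH.
Qed.

Lemma bitlen_leP m b : 0 < b -> (bitlen m <= b) = (m < 2 ^ b).
Proof.
move=> b0; rewrite /bitlen; case: m => [|m].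
  by rewrite trunc_log0 b0 expn_gt0.
apply/idP/idP => h; first by apply: leq_trans (trunc_log_ltn m.+1 (isT : 1 < 2)) _; rewrite leq_exp2l.
by rewrite -(@ltn_exp2l 2) //; apply: leq_ltn_trans h; apply: trunc_logP.
Qed.

Lemma B_gt0 : 0 < B. Proof. by apply: leq_trans qB. Qed.

Lemma nwidth_gt0 e : 0 < nwidth e.
Proof. by elim: e => //= e1 h1 e2 h2; rewrite addn_gt0 h1. Qed.

Lemma neval_width s e : safe s -> neval s e < 2 ^ (nwidth e * B).
Proof.
case=> _ _ _ _ hs; have B0 := B_gt0.
elim: e => //=.
- move=> m; apply: leq_trans (ltnW (ltn_expl m.+1 (isT : 1 < 2))) _.
  by rewrite leq_exp2l // leq_pmulr.
- by move=> a e _; rewrite mul1n hs.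
- move=> e1 h1 e2 h2; rewrite mulnDl expnD.
  have p1 : 1 < 2 ^ (nwidth e1 * B) by rewrite -[1](expn0 2) ltn_exp2l // muln_gt0 nwidth_gt0.
  have p2 : 1 < 2 ^ (nwidth e2 * B) by rewrite -[1](expn0 2) ltn_exp2l // muln_gt0 nwidth_gt0.
  nia.
- by move=> e1 h1 e2 h2; apply: leq_ltn_trans h1; apply: leq_subr.
- by move=> e1 h1 e2 h2; rewrite mulnDl expnD ltn_mul.
- by move=> e1 h1 e2 h2; apply: leq_ltn_trans h1; apply: leq_div.
by move=> e1 h1 e2 h2; apply: leq_ltn_trans h1; apply: leq_mod.
Qed.

Lemma ncost_weight s e : safe s -> ncost s e <= nweight e * B.
Proof.
move=> hs; have B0 := B_gt0.
have w e' : bitlen (neval s e') <= nwidth e' * B.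
  by rewrite bitlen_leP ?neval_width // muln_gt0 nwidth_gt0.
elim: e => [m|a e IH|e1 h1 e2 h2|e1 h1 e2 h2|e1 h1 e2 h2|e1 h1 e2 h2|e1 h1 e2 h2];
  rewrite /= !mulnDl ?addn0 !leq_add ?mul1n //.
- exact: (w (NConst m)).
- by have := w (NRead a e); rewrite /= mul1n.
- by have := w (NAdd e1 e2); rewrite /= mulnDl.
- exact: (w (NSub e1 e2)).
- by have := w (NMul e1 e2); rewrite /= mulnDl.
- exact: (w (NDiv e1 e2)).
- exact: (w (NMod e1 e2)).
Qed.

Lemma fcost_weight s f : safe s -> fcost s f <= fweight f * B.
Proof.
move=> hs; have B0 := B_gt0.
have h2 : 1 + bitlen #|F| <= 2 * B by rewrite mulSn mul1n leq_add.
elim: f => [||e|a e|f1 h1 f2 h3|f1 h1|f1 h1 f2 h3|f1 h1]; rewrite /= mulnDl leq_add //.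
- exact: ncost_weight.
- exact: ncost_weight.
- by rewrite mulnDl leq_add.
- by rewrite mulnDl leq_add.
Qed.

Lemma bcost_weight s b : safe s -> bcost s b <= bweight b * B.
Proof.
move=> hs; have B0 := B_gt0.
elim: b => [e1 e2|f1 f2|b1 h1|b1 h1 b2 h2] /=; rewrite mulnDl leq_add ?mul1n //.
- by rewrite mulnDl leq_add ?ncost_weight.
- by rewrite mulnDl leq_add ?fcost_weight.
- by rewrite mulnDl leq_add.
Qed.

(** The factor 2 stands for the two kinds of arrays, of numbers and of field elements; the 1 is the
    charge of [state_size] for each array. *)
Definition space_bound := 2 * (NA * (1 + L * B)).

Lemma sum_nth_bound (X : Type) (x0 : X) (f : X -> nat) b (l : seq X) :
  (forall i, i < size l -> f (nth x0 l i) <= b) -> \sum_(x <- l) f x <= size l * b.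
Proof.
elim: l => [|x l IH] h; first by rewrite big_nil.
rewrite big_cons mulSn leq_add //; first exact: (h 0).
by apply: IH => i hi; apply: (h i.+1).
Qed.

Lemma state_size_bound s : safe s -> state_size s <= space_bound.
Proof.
case=> hn hf hln hlf hv; rewrite /state_size /space_bound mul2n -addnn leq_add //.
  apply: leq_trans (leq_mul hn (leqnn _)); apply: (@sum_nth_bound _ [::]) => i _.
  rewrite leq_add2l; apply: leq_trans (leq_mul (hln i) (leqnn _)).
  apply: (@sum_nth_bound _ 0) => j _; rewrite bitlen_leP ?B_gt0 //.
  exact: (hv i j).
apply: leq_trans (leq_mul hf (leqnn _)); apply: (@sum_nth_bound _ [::]) => i _.
by rewrite leq_add2l leq_mul.
Qed.

Lemma size_write (X : Type) (x0 : X) (m : seq (seq X)) a i x b : i < L ->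
  (forall a, size (nth [::] m a) <= L) -> size (nth [::] (write x0 m a i x) b) <= L.
Proof.
move=> iL h; rewrite /write nth_set_nth /=; case: eqP => // _.
by rewrite size_set_nth geq_max iL h.
Qed.

Lemma safe_nupd s a i x : safe s -> a < NA -> i < L -> x < 2 ^ B ->
  safe (nupd s a i x).
Proof.
case=> hn hf hln hlf hv ha hi hx; split=> //=.
- by rewrite size_set_nth geq_max ha.
- by move=> b; apply: size_write.
- by move=> b j; rewrite nread_nupd; case: ifP.
Qed.

Lemma safe_fupd s a i x : safe s -> a < NA -> i < L -> safe (fupd s a i x).
Proof.
case=> hn hf hln hlf hv ha hi; split=> //=.
- by rewrite size_set_nth geq_max ha.
- by move=> b; apply: size_write.
Qed.

(** Total correctness with resource bounds. The time budget [N] is a parameter because the two loops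
    over the guesses may exceed [L] iterations and so escape [tweight L]; space needs no such
    exception, because memory is reused. *)
Definition wpN (N : nat) (c : cmd) Q s := exists s' t m,
  [/\ exec c s s' t m, t <= N * B, m <= space_bound + iweight c * B, safe s' & Q s'].
Definition wp c := wpN (tweight L c) c.

Lemma wpN_le N N' c Q s : N <= N' -> wpN N c Q s -> wpN N' c Q s.
Proof.
move=> hN [s' [t [m [h1 h2 h3 h4 h5]]]]; exists s', t, m; split=> //.
by apply: leq_trans h2 _; rewrite leq_mul2r hN orbT.
Qed.

Lemma wpN_call N c Q Q' s : wpN N c Q s ->
  (forall s', safe s' -> agree (nmods c) (fmods c) s s' -> Q s' -> Q' s') ->
  wpN N c Q' s.
Proof.
move=> [s' [t [m [h1 h2 h3 h4 h5]]]] h; exists s', t, m; split=> //.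
by apply: h => //; apply: exec_agree h1.
Qed.

Lemma wp_call c Q Q' s : wp c Q s ->
  (forall s', safe s' -> agree (nmods c) (fmods c) s s' -> Q s' -> Q' s') ->
  wp c Q' s.
Proof. exact: wpN_call. Qed.

Lemma wpN_seq N1 N2 c1 c2 Q1 Q s : wpN N1 c1 Q1 s ->
  (forall s', safe s' -> agree (nmods c1) (fmods c1) s s' -> Q1 s' -> wpN N2 c2 Q s') ->
  wpN (N1 + N2) (Seq c1 c2) Q s.
Proof.
move=> [s1 [t1 [m1 [h1 h2 h3 h4 h5]]]].
move=> /(_ _ h4 (exec_agree h1) h5) [s2 [t2 [m2 [g1 g2 g3 g4 g5]]]].
exists s2, (t1 + t2), (maxn m1 m2); split=> //; first exact: ExSeq h1 g1.
  by rewrite mulnDl leq_add.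
by rewrite geq_max (leq_trans h3) ?(leq_trans g3) //= leq_add2l leq_mul2r
  ?leq_maxl ?leq_maxr orbT.
Qed.

Lemma wp_seq c1 c2 Q1 Q s : wp c1 Q1 s ->
  (forall s', safe s' -> agree (nmods c1) (fmods c1) s s' -> Q1 s' -> wp c2 Q s') ->
  wp (Seq c1 c2) Q s.
Proof. exact: wpN_seq. Qed.

Lemma space_instr s k c : safe s -> k <= c * B ->
  state_size s + k <= space_bound + c * B.
Proof. by move=> hs hk; rewrite leq_add // state_size_bound. Qed.

Lemma wp_skip Q s : safe s -> Q s -> wp Skip Q s.
Proof.
move=> hs hq; exists s, 1, (state_size s); split=> //=; first exact: ExSkip.
  by rewrite mul1n B_gt0.
by rewrite -[X in X <= _]addn0 space_instr.
Qed.

Lemma wp_nwrite a e v Q s : safe s -> a < NA -> neval s e < L ->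
  neval s v < 2 ^ B -> Q (nupd s a (neval s e) (neval s v)) -> wp (NWrite a e v) Q s.
Proof.
move=> hs ha he hv hq; have hs' := safe_nupd hs ha he hv.
have ht : 1 + ncost s e + ncost s v <= (1 + nweight e + nweight v) * B.
  by rewrite !mulnDl !leq_add ?ncost_weight ?mul1n ?B_gt0.
do 3![eexists]; split; [exact: ExNWrite | exact: ht | | exact: hs' | exact: hq].
by rewrite geq_max space_instr // -[X in X <= _]addn0 space_instr.
Qed.

Lemma wp_fwrite a e f Q s : safe s -> a < NA -> neval s e < L ->
  Q (fupd s a (neval s e) (feval s f)) -> wp (FWrite a e f) Q s.
Proof.
move=> hs ha he hq; have hs' := safe_fupd (feval s f) hs ha he.
have ht : 1 + ncost s e + fcost s f <= (1 + nweight e + fweight f) * B.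
  by rewrite !mulnDl !leq_add ?ncost_weight ?fcost_weight ?mul1n ?B_gt0.
do 3![eexists]; split; [exact: ExFWrite | exact: ht | | exact: hs' | exact: hq].
by rewrite geq_max space_instr // -[X in X <= _]addn0 space_instr.
Qed.

Lemma wpN_if N b c1 c2 Q s : safe s -> wpN N (if beval s b then c1 else c2) Q s ->
  wpN (bweight b + N) (If b c1 c2) Q s.
Proof.
move=> hs [s1 [t1 [m1 [h1 h2 h3 h4 h5]]]].
exists s1, (bcost s b + t1), (maxn (state_size s + bcost s b) m1); split=> //.
- exact: ExIf.
- by rewrite mulnDl leq_add ?bcost_weight.
rewrite geq_max; apply/andP; split.
  by apply: (leq_trans (space_instr hs (bcost_weight b hs))); rewrite leq_add2l leq_mul2r leq_maxl orbT.
apply: leq_trans h3 _; rewrite leq_add2l leq_mul2r; apply/orP; right => /=.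
by case: (beval s b); lia.
Qed.

Lemma wp_if b c1 c2 Q s : safe s ->
  (beval s b -> wp c1 Q s) -> (~~ beval s b -> wp c2 Q s) -> wp (If b c1 c2) Q s.
Proof.
move=> hs h1 h2; rewrite /wp /=.
apply: wpN_if => //; case: (boolP (beval s b)) => hb.
  by apply: wpN_le (h1 hb); rewrite leq_addr.
by apply: wpN_le (h2 hb); rewrite leq_addl.
Qed.

Lemma wp_set a v Q s : safe s -> a < NA -> neval s v < 2 ^ B ->
  Q (nupd s a 0 (neval s v)) -> wp (Set_ a v) Q s.
Proof. by move=> *; apply: wp_nwrite. Qed.

Lemma wp_fset a f Q s : safe s -> a < NA -> Q (fupd s a 0 (feval s f)) ->
  wp (FSet a f) Q s.
Proof. by move=> *; apply: wp_fwrite. Qed.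

(** The constants are weights: 5 for clearing the counter, 26 for the test (12, apart from its
    bound) and the increment (14); [n.+1] covers the final failing test. The count [n] need only fit
    in [B] bits, so the rule also serves the exponential loops. The invariant receives the count as
    [j] and must be insensitive to the counter cell, which changes after the body. *)
Lemma wpN_for N i e body (Inv : nat -> state F -> Prop) n s :
  safe s -> neval s e = n -> n < 2 ^ B -> i < NA -> i \notin nmods body ->
  all (fun a => a \notin i :: nmods body) (nreads e) ->
  (forall j s1 s2, agree [:: i] [::] s1 s2 -> Inv j s1 -> Inv j s2) ->
  Inv 0 s ->
  (forall j s1, j < n -> safe s1 -> agree (i :: nmods body) (fmods body) s s1 ->
     nread s1 i 0 = j -> Inv j s1 -> wpN N body (Inv j.+1) s1) ->
  wpN (5 + n.+1 * (26 + nweight e + N)) (For i e body) (Inv n) s.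
Proof.
move=> hs he hn hi hib hrd hstab h0 hbody.
set b := BLe (NAdd (V i) (NConst 1)) e.
set c := Seq body (Set_ i (NAdd (V i) (NConst 1))).
have bwE : bweight b = 12 + nweight e by rewrite /b /=; lia.
have cw : bweight b + (N + 14) = 26 + nweight e + N by rewrite bwE; lia.
have loop : forall k j s1, n = j + k -> safe s1 ->
   agree (i :: nmods body) (fmods body) s s1 -> nread s1 i 0 = j -> Inv j s1 ->
   wpN (k * (26 + nweight e + N) + bweight b) (While b c) (Inv n) s1.
  elim=> [|k IH] j s1 nE hs1 ag ij inv.
    have nb : ~~ beval s1 b.
      by rewrite /b /= (neval_agree ag hrd) he ij nE; lia.
    exists s1, (bcost s1 b), (state_size s1 + bcost s1 b); split=> //.
    - exact: ExWhileDone.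
    - by rewrite mul0n add0n bcost_weight.
    - apply: (leq_trans (space_instr hs1 (bcost_weight b hs1))).
      by rewrite leq_add2l leq_mul2r leq_maxl orbT.
    by move: inv; rewrite nE addn0.
  have bt : beval s1 b by rewrite /b /= (neval_agree ag hrd) he ij nE; lia.
  have jn : j < n by lia.
  have hc : wpN (N + 14) c (fun s2 => [/\ agree (i :: nmods body) (fmods body) s s2,
      nread s2 i 0 = j.+1 & Inv j.+1 s2]) s1.
    apply: wpN_seq (hbody j s1 jn hs1 ag ij inv) _ => s2 hs2 ag2 inv2.
    have i2 : nread s2 i 0 = j by rewrite ag2.1.
    apply: (@wpN_le (tweight L (Set_ i (NAdd (V i) (NConst 1))))); first by [].
    apply: wp_set => //=; rewrite i2 ?addn1; first by apply: leq_ltn_trans hn.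
    split; last 1 first.
    - by apply: hstab inv2; apply: agree_nupd.
    - apply: agree_trans ag _; apply: (@agree_trans _ _ _ s2).
        by apply: agree_sub ag2 => // x hx; rewrite inE hx orbT.
      by apply: agree_sub (agree_nupd _ _ _ _) => // x; rewrite !inE => ->.
    by rewrite nread_nupd !eqxx.
  have [s2 [t2 [m2 [g1 g2 g3 g4 [g5 g6 g7]]]]] := hc.
  have [|s3 [t3 [m3 [k1 k2 k3 k4 k5]]]] := IH j.+1 s2 _ g4 g5 g6 g7; first by lia.
  exists s3, (bcost s1 b + t2 + t3), (maxn (state_size s1 + bcost s1 b) (maxn m2 m3)).
  split=> //; first exact: ExWhileLoop bt g1 k1.
    have := bcost_weight b hs1; move: k2 g2; rewrite mulSn -cw !mulnDl; lia.
  have -> : iweight (While b c) = maxn (bweight b) (iweight c) by [].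
  rewrite !geq_max k3 andbT; apply/andP; split.
    apply: (leq_trans (space_instr hs1 (bcost_weight b hs1))).
    by rewrite leq_add2l leq_mul2r leq_maxl orbT.
  by apply: leq_trans g3 _; rewrite leq_add2l leq_mul2r leq_maxr orbT.
have h1 : wp (Set_ i (NConst 0)) (fun s1 => [/\ agree [:: i] [::] s s1,
    nread s1 i 0 = 0 & Inv 0 s1]) s.
  apply: wp_set => //=; first by rewrite expn_gt0.
  split; first exact: agree_nupd.
    by rewrite nread_nupd !eqxx.
  by apply: hstab h0; apply: agree_nupd.
apply: (@wpN_le (5 + (n * (26 + nweight e + N) + bweight b))).
  by rewrite leq_add2l mulSn addnC leq_add2r bwE; lia.
apply: wpN_seq h1 _ => s1 hs1 _ [h2 h3 h4].
apply: (loop n 0) => //.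
by apply: agree_sub h2 => // x; rewrite !inE => ->.
Qed.

Lemma wp_for i e body (Inv : nat -> state F -> Prop) n s :
  safe s -> neval s e = n -> n <= L -> i < NA -> i \notin nmods body ->
  all (fun a => a \notin i :: nmods body) (nreads e) ->
  (forall j s1 s2, agree [:: i] [::] s1 s2 -> Inv j s1 -> Inv j s2) ->
  Inv 0 s ->
  (forall j s1, j < n -> safe s1 -> agree (i :: nmods body) (fmods body) s s1 ->
     nread s1 i 0 = j -> Inv j s1 -> wp body (Inv j.+1) s1) ->
  wp (For i e body) (Inv n) s.
Proof.
move=> hs he hn hi hib hrd hstab h0 hbody.
have hnB : n < 2 ^ B by apply: leq_ltn_trans LB.
apply: wpN_le (wpN_for hs he hnB hi hib hrd hstab h0 hbody).
rewrite [tweight L (For _ _ _)]/=; apply: leq_add => //.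
by apply: leq_mul; lia.
Qed.

(** While cell [j] is computed, the cells already filled and those still untouched are both known.
    This allows [v] to read the array being filled, as the update of a kernel matrix in place and
    the copying of rows inside array 2 do. *)
Lemma wp_fill i e a base pre v n b (g : nat -> F) s :
  safe s -> neval s e = n -> neval s base = b -> b + n <= L -> i < NA -> a < NA ->
  i \notin nmods pre -> a \notin fmods pre ->
  all (fun x => x \notin i :: nmods pre) (nreads e ++ nreads base) ->
  (forall j s1, j < n -> safe s1 ->
     agree (i :: nmods pre) (a :: fmods pre) s s1 -> nread s1 i 0 = j ->
     (forall x, fread s1 a x = if b <= x < b + j then g (x - b) else fread s a x) ->
     wp pre (fun s2 => feval s2 v = g j) s1) ->
  wp (Fill i e a base pre v) (fun s' => forall x,
    fread s' a x = if b <= x < b + n then g (x - b) else fread s a x) s.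
Proof.
move=> hs he hb hn hi ha hip hap; rewrite all_cat => /andP[hre hrb] hbody.
pose Inv j (s1 : state F) := forall x,
  fread s1 a x = if b <= x < b + j then g (x - b) else fread s a x.
apply: (@wp_for _ _ _ Inv n); rewrite //= ?cats0 //.
- by apply: leq_trans hn; rewrite leq_addl.
- by move=> j s1 s2 [_ h] inv x; rewrite h //.
- by move=> x; case: ifP => //; lia.
move=> j s1 jn hs1 ag ij inv.
have ag' : agree (i :: nmods pre) (a :: fmods pre) s s1.
  by apply: agree_sub ag => // x; rewrite mem_cat !inE orbC.
apply: wp_seq (hbody j s1 jn hs1 ag' ij inv) _ => s2 hs2 ag2 hv.
have i2 : nread s2 i 0 = j by rewrite ag2.1.
have b2 : neval s2 base = b.
  rewrite -hb; apply: (@neval_agree (i :: nmods pre) (a :: fmods pre)) => //.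
  by apply: agree_trans ag' _; apply: agree_sub ag2 => x hx; rewrite inE hx orbT.
apply: wp_fwrite => //=; rewrite b2 i2.
  by apply: leq_trans hn; rewrite ltn_add2l.
move=> x; rewrite fread_fupd hv eqxx /=; case: eqP => [->|/eqP hx].
  by rewrite leq_addr addnS leqnn addKn.
by rewrite ag2.2 // inv addnS ltnS [x <= b + j]leq_eqVlt (negPf hx).
Qed.

Lemma wp_acc i e a op init pre v n (G : nat -> F) s :
  safe s -> neval s e = n -> n <= L -> i < NA -> a < NA ->
  i \notin nmods pre -> a \notin fmods pre ->
  all (fun x => x \notin i :: nmods pre) (nreads e) ->
  feval s init = G 0 ->
  (forall j s1, j < n -> safe s1 ->
     agree (i :: nmods pre) (a :: fmods pre) s s1 -> nread s1 i 0 = j ->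
     fread s1 a 0 = G j ->
     wp pre (fun s2 => feval s2 (op (FV a) v) = G j.+1) s1) ->
  wp (Acc i e a op init pre v) (fun s' => fread s' a 0 = G n) s.
Proof.
move=> hs he hn hi ha hip hap hre h0 hbody.
apply: (@wp_seq _ _ (fun s1 => fread s1 a 0 = G 0)).
  by apply: wp_fset => //; rewrite fread_fupd !eqxx h0.
move=> s0 hs0 ag0 h00.
apply: (@wp_for _ _ _ (fun j s1 => fread s1 a 0 = G j) n); rewrite //= ?cats0 //.
- by rewrite -he; apply: neval_agree ag0 _; apply: sub_all hre.
- by move=> j s1 s2 [_ h] inv; rewrite h.
move=> j s1 jn hs1 ag ij inv.
have ag' : agree (i :: nmods pre) (a :: fmods pre) s s1.
  apply: (@agree_trans _ _ _ s0).
    by apply: agree_sub ag0 => // x; rewrite /= !inE => ->.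
  by apply: agree_sub ag => // x; rewrite mem_cat !inE orbC.
apply: wp_seq (hbody j s1 jn hs1 ag' ij inv) _ => s2 hs2 ag2 hv.
by apply: wp_fset => //; rewrite fread_fupd !eqxx.
Qed.

Lemma wp_search p i e v n (g : nat -> F) s :
  safe s -> neval s e = n -> 0 < n -> n <= L -> i < NA -> p < NA -> i != p ->
  all (fun x => x \notin [:: i; p]) (nreads e) ->
  (forall j s1, j < n -> safe s1 -> agree [:: i; p] [::] s s1 -> nread s1 i 0 = j ->
     feval s1 v = g j) ->
  wp (Search p i e v) (fun s' => nread s' p 0 < n /\
    forall l, l < n -> g l != 0%R -> g (nread s' p 0) != 0%R) s.
Proof.
move=> hs he n0 hn hi hp ip hre hbody.
apply: (@wp_seq _ _ (fun s1 => nread s1 p 0 = 0)).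
  by apply: wp_set => //=; rewrite ?expn_gt0 ?nread_nupd ?eqxx.
move=> s0 hs0 ag0 p0.
pose Inv j (s1 : state F) := nread s1 p 0 < n /\
  forall l, l < j -> g l != 0%R -> g (nread s1 p 0) != 0%R.
apply: (@wp_for _ _ _ Inv n); rewrite //= ?inE //.
- rewrite -he; apply: neval_agree ag0 _; apply: sub_all hre => x /=.
  by rewrite !inE negb_or => /andP[_ ->].
- move=> j s1 s2 [h _] inv; rewrite /Inv; have -> : nread s2 p 0 = nread s1 p 0.
    by apply: h; rewrite inE eq_sym.
  exact: inv.
- by split; rewrite ?p0.
move=> j s1 jn hs1 ag ij [pn inv].
have ag' : agree [:: i; p] [::] s s1.
  apply: (@agree_trans _ _ _ s0); last exact: ag.
  by apply: agree_sub ag0 => // x; rewrite /= !inE => ->; rewrite orbT.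
have vE := hbody j s1 jn hs1 ag' ij.
apply: wp_if => //=; rewrite vE => hg.
  apply: wp_set => //=; first by rewrite ij; apply: leq_ltn_trans LB; lia.
  by split; rewrite nread_nupd !eqxx ij.
apply: wp_skip => //; split=> // l; rewrite ltnS leq_eqVlt => /predU1P[->|lj] gl.
  by rewrite gl in hg.
exact: inv gl.
Qed.

End Logic.

(** * The algorithm *)

Local Open Scope nat_scope.
Local Infix "+'" := NAdd (at level 50, left associativity).
Local Infix "-'" := NSub (at level 50, left associativity).
Local Infix "*'" := NMul (at level 40, left associativity).
Local Infix "/'" := NDiv (at level 40, left associativity).
Local Infix "%'" := NMod (at level 40, left associativity).
Local Notation "c1 ;; c2" := (Seq c1 c2) (at level 70, right associativity).
Local Coercion NConst : nat >-> nexp.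

(* Natural number arrays: 0 input, 1 flag, 2 number m of columns of T_(0),
   3 strides, 4 offsets of A_d in a flattened (A_1, ..., A_(D-1)), 5 and 6 sum of
   n_d for d >= 1 and d >= 2, 7 and 8 numbers of outer and inner guesses,
   9 (R - n_0) sum_(d >= 1) n_d, 10 number of rows of array X in use, 11 and 12
   current guesses, 14 pivot row, 15 position of a nonzero entry, 16 success of
   Solve, 17 to 21 loop counters, 22 powers of #|F|, 25 scratch.
   Field arrays: 0 input, 1 output, 2 X (R + 1 rows (a_1, ..., a_(D-1)), the last
   one being the current candidate), 3 matrix to be eliminated, 4 and 5 kernels,
   6 and 8 pivot column and row, 7 accumulator, 9 coefficients and 10 entries of
   the current combination.
   Matrices are stored row by row; each is filled by a single loop over its
   cells. *)
Definition vD := NRead 0 0.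
Definition vR := NRead 0 1.
Definition vq := NRead 0 2.
Definition vn (e : nexp) := NRead 0 (3 +' e).
Definition vn0 := NRead 0 3.
Definition vn1 := NRead 0 4.
Definition vm := V 2.
Definition vstr (e : nexp) := NRead 3 e.
Definition voff (e : nexp) := NRead 4 e.
Definition vS1 := V 5.
Definition vS2 := V 6.
Definition vQ1 := V 7.
Definition vQ2 := V 8.
Definition vE1 := V 9.
Definition vpow (e : nexp) := NRead 22 e.

Definition vdig (d c : nexp) := (c /' vstr d) %' vn d.

Definition Outer (r c : nexp) :=
  Acc 19 (vD -' 1) 7 FMul FOne Skip
    (FRead 2 (r *' vS1 +' (voff (V 19 +' 1) +' vdig (V 19 +' 1) c))).

Definition FillOuter :=
  Fill 17 ((vR +' 1) *' vm) 3 0 (Outer (V 17 /' vm) (V 17 %' vm)) (FV 7).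

Definition KernelInit (k : nexp) (K : nat) :=
  Fill 17 (k *' k) K 0
    (If (BAnd (BLe (V 17 /' k) (V 17 %' k)) (BLe (V 17 %' k) (V 17 /' k)))
        (FSet 7 FOne) (FSet 7 FZero)) (FV 7).

(* If K already annihilates column c, no pivot exists and the update is void. *)
Definition KernelStep (k : nexp) (K : nat) :=
  Fill 17 k 6 0
    (Acc 20 k 7 FAdd FZero Skip
       (FMul (FRead K (V 17 *' k +' V 20)) (FRead 3 (V 20 *' vm +' V 18)))) (FV 7) ;;
  Search 14 17 k (FRead 6 (V 17)) ;;
  FSet 7 (FInv (FRead 6 (V 14))) ;;
  Fill 17 k 8 0 Skip (FRead K (V 14 *' k +' V 17)) ;;
  Fill 17 (k *' k) K 0 Skip
    (FAdd (FRead K (V 17))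
       (FOpp (FMul (FMul (FV 7) (FRead 6 (V 17 /' k))) (FRead 8 (V 17 %' k))))).

(* Array 3 holds a matrix B with k rows and m columns; array K receives a k x k
   matrix whose row space is the left kernel of B. *)
Definition Kernel (k : nexp) (K : nat) :=
  KernelInit k K ;; For 18 vm (KernelStep k K).

(** The last of the R + 1 rows is a combination of the others iff some row of the kernel matrix has
    a nonzero last entry; dividing that row by minus this entry then gives the coefficients. The
    same test decides membership in a span and solves for A_0. *)
Definition Relation :=
  Kernel (vR +' 1) 4 ;;
  Search 14 17 (vR +' 1) (FRead 4 (V 17 *' (vR +' 1) +' vR)).
Definition LastCoef := FRead 4 (V 14 *' (vR +' 1) +' vR).

(** The row blocks are the R rows from array 2, the n_0 rows of T_(0), and the tensors e_l x b for l
    < n_1. With the axis 1 part of the candidate set to ones, [Outer] returns the tail b in every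
    column, and the test on the digit of axis 1 masks it to e_l x b. Row R produced by [FillOuter]
    is overwritten by T_(0). *)
Definition StepSystem :=
  Fill 17 vn1 2 (vR *' vS1) Skip FOne ;;
  FillOuter ;;
  Fill 17 (vn0 *' vm) 3 (vR *' vm) Skip (FRead 0 (V 17)) ;;
  Fill 17 (vn1 *' vm) 3 ((vR +' vn0) *' vm)
    (Outer vR (V 17 %' vm) ;;
     If (BAnd (BLe (V 17 /' vm) (vdig 1 (V 17 %' vm)))
              (BLe (vdig 1 (V 17 %' vm)) (V 17 /' vm))) Skip (FSet 7 FZero)) (FV 7).

Definition vk := vR +' vn0 +' vn1.

(** Only the axis 1 part of the candidate row is rewritten, so b survives from one trial to the
    next. A vanishing last coefficient means that the candidate lies outside the current span, which
    includes what earlier trials appended. *)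
Definition StepTry :=
  Fill 17 vn1 2 (vR *' vS1) Skip (FRead 5 (V 21 *' vk +' (vR +' vn0 +' V 17))) ;;
  FillOuter ;;
  Relation ;;
  If (BEq LastCoef FZero)
     (Fill 17 vS1 2 (V 10 *' vS1) Skip (FRead 2 (vR *' vS1 +' V 17)) ;;
      Set_ 10 (V 10 +' 1))
     Skip.

Definition Step := StepSystem ;; Kernel vk 5 ;; For 21 vk StepTry.

(** The generators are the rows of T_(0) and the R - n_0 guessed rows, never the rows appended
    since: there are always R coefficients, and the meaning of a guess does not change while X
    grows. The last loop moves one coordinate of the nonzero entry at a time, which reads off the
    slices through it. *)
Definition GuessCombination :=
  FillOuter ;;
  Fill 17 vR 9 0 Skip (FElt ((V 12 /' vpow (V 17)) %' vq)) ;;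
  Fill 17 vm 10 0
    (Acc 20 vn0 7 FAdd FZero Skip
       (FMul (FRead 9 (V 20)) (FRead 0 (V 20 *' vm +' V 17))) ;;
     Acc 20 (vR -' vn0) 7 FAdd (FV 7) Skip
       (FMul (FRead 9 (vn0 +' V 20)) (FRead 3 (V 20 *' vm +' V 17)))) (FV 7) ;;
  Search 15 17 vm (FRead 10 (V 17)) ;;
  For 18 (vD -' 2)
    (Fill 17 (vn (V 18 +' 2)) 2 (vR *' vS1 +' voff (V 18 +' 2)) Skip
       (FRead 10 (V 15 -' vdig (V 18 +' 2) (V 15) *' vstr (V 18 +' 2)
                  +' V 17 *' vstr (V 18 +' 2)))).

Definition GuessVectors :=
  Fill 17 vS2 2 (vR *' vS1 +' vn1) Skip (FElt ((V 12 /' vpow (V 17)) %' vq)).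

Definition Guess := If (BLe vR vS2) GuessCombination GuessVectors.

Definition Decode :=
  Fill 17 ((vR +' 1) *' vS1) 2 0
    (If (BLe (V 17 +' 1) vE1)
        (FSet 7 (FElt ((V 11 /' vpow (V 17)) %' vq))) (FSet 7 FZero)) (FV 7) ;;
  Set_ 10 (vR -' vn0).

Definition SolveRow :=
  FillOuter ;;
  Fill 17 vm 3 (vR *' vm) Skip (FRead 0 (V 21 *' vm +' V 17)) ;;
  Relation ;;
  If (BEq LastCoef FZero) (Set_ 16 0)
     (Fill 17 vR 1 (V 21 *' vR) Skip
        (FMul (FOpp (FRead 4 (V 14 *' (vR +' 1) +' V 17))) (FInv LastCoef))).

Definition Solve :=
  Set_ 16 1 ;; For 21 vn0 SolveRow ;;
  If (BLe 1 (V 16))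
     (Fill 17 (vS1 *' vR) 1 (vn0 *' vR) Skip
           (FRead 2 ((V 17 %' vR) *' vS1 +' V 17 /' vR)) ;;
      Set_ 1 1)
     Skip.

Definition Setup :=
  Set_ 25 1 ;;
  For 17 vD (NWrite 3 (vD -' 1 -' V 17) (V 25) ;;
             Set_ 25 (V 25 *' vn (vD -' 1 -' V 17))) ;;
  Set_ 2 (vstr 0) ;;
  Set_ 25 0 ;;
  For 17 (vD -' 1) (NWrite 4 (V 17 +' 1) (V 25) ;;
                    Set_ 25 (V 25 +' vn (V 17 +' 1))) ;;
  Set_ 5 (V 25) ;;
  Set_ 6 (V 25 -' vn1) ;;
  Set_ 9 ((vR -' vn0) *' vS1) ;;
  Set_ 25 1 ;;
  For 17 (vE1 +' vR +' vS2 +' 1) (NWrite 22 (V 17) (V 25) ;; Set_ 25 (V 25 *' vq)) ;;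
  Set_ 7 (vpow vE1) ;;
  If (BLe vR vS2) (Set_ 8 (vpow vR)) (Set_ 8 (vpow vS2)).

Definition Inner := Guess ;; Step.
(** Once a CPD is recorded, the flag makes all later attempts void; otherwise a later attempt could
    overwrite the factors in field array 1. *)
Definition Attempt :=
  If (BLe (V 1) 0) (Decode ;; For 12 vQ2 Inner ;; Solve) Skip.
(* A concise tensor with D = 1 has at most one entry. *)
Definition Main :=
  If (BLe vn0 0) (Set_ 1 1)
    (If (BLe (vR +' 1) vn0) Skip
       (If (BLe vD 1) (FWrite 1 0 (FRead 0 0) ;; Set_ 1 1)
           (Setup ;; For 11 vQ1 Attempt))).

(** * Digits, outer products and elimination *)

Section Digits.
Local Open Scope nat_scope.
Variables (D : nat) (N : nat -> nat).

(** * Mixed radix digits of column indices *)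

Definition stride d := \prod_(d.+1 <= e < D) N e.
Definition offset d := \sum_(1 <= e < d) N e.
Definition digit d c := c %/ stride d %% N d.
Definition undigits (x : nat -> nat) := \sum_(1 <= d < D) x d * stride d.

Hypothesis N_gt0 : forall d, d < D -> 0 < N d.

Lemma stride_gt0 d : 0 < stride d.
Proof.
rewrite /stride big_nat_cond; apply: prodn_cond_gt0 => e.
by rewrite andbT => /andP[_]; apply: N_gt0.
Qed.

Lemma stride_rec d : d.+1 < D -> stride d = N d.+1 * stride d.+1.
Proof. by move=> dD; rewrite /stride big_ltn. Qed.

Lemma stride_dvd d e : d <= e -> e < D -> stride e %| stride d.
Proof.
move=> de eD; rewrite /stride [X in _ %| X](@big_cat_nat _ _ _ e.+1) //=.
by rewrite dvdn_mull.
Qed.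

Lemma offset_rec d : 0 < d -> offset d.+1 = offset d + N d.
Proof. by move=> d0; rewrite /offset big_nat_recr. Qed.

Lemma offset_le d e : 0 < d -> d <= e -> offset d <= offset e.
Proof.
by move=> d0 de; rewrite /offset [X in _ <= X](@big_cat_nat _ _ _ d) //= leq_addr.
Qed.

Lemma digit_lt d c : d < D -> digit d c < N d.
Proof. by move=> dD; rewrite ltn_mod N_gt0. Qed.

Lemma offset_digit_lt d c : 0 < d -> d < D -> offset d + digit d c < offset D.
Proof.
move=> d0 dD; apply: leq_trans (offset_le (isT : 0 < d.+1) dD).
by rewrite offset_rec // ltn_add2l digit_lt.
Qed.

Lemma undigits_tail_lt (x : nat -> nat) d : d < D ->
  (forall e, 0 < e < D -> x e < N e) ->
  \sum_(d.+1 <= e < D) x e * stride e < stride d.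
Proof.
move=> dD hx; have [k] := ubnP (D - d); elim: k => // k IH in d dD *.
rewrite ltnS => hk; have [dD'|] := ltnP d.+1 D; last first.
  by move=> h; rewrite big_geq // stride_gt0.
rewrite big_ltn // (stride_rec dD'); have := IH _ dD' ltac:(lia).
have := hx d.+1 dD'; set u := \sum_(_ <= _ < _) _; move=> h1 h2.
by apply: leq_trans (leq_mul h1 (leqnn _)); rewrite mulSn addnC ltn_add2r.
Qed.

Lemma undigits_lt (x : nat -> nat) : 0 < D ->
  (forall e, 0 < e < D -> x e < N e) -> undigits x < stride 0.
Proof. exact: undigits_tail_lt. Qed.

Lemma digit_undigits (x : nat -> nat) d : 0 < d < D ->
  (forall e, 0 < e < D -> x e < N e) -> digit d (undigits x) = x d.
Proof.
move=> /andP[d0 dD] hx; rewrite /digit /undigits (@big_cat_nat _ _ _ d) ?(ltnW dD) //=.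
rewrite [X in _ + X]big_ltn //.
have /dvdnP[w ->] : N d * stride d %| \sum_(1 <= i < d) x i * stride i.
  rewrite big_nat_cond; apply: dvdn_sum => i; rewrite andbT => /andP[i0 id_].
  apply: dvdn_mull; case: d d0 dD id_ => // d _ dD id_.
  by rewrite -stride_rec // stride_dvd // ltnW.
rewrite mulnA addnA -mulnDl divnMDl ?stride_gt0 // divn_small ?undigits_tail_lt //.
by rewrite addn0 modnMDl modn_small // hx // d0.
Qed.

Lemma undigits_digit c : c < stride 0 -> undigits (digit^~ c) = c.
Proof.
suff tail d : \sum_(d.+1 <= e < D) digit e c * stride e = c %% stride d.
  by move=> hc; rewrite /undigits tail modn_small.
have [k] := ubnP (D - d); elim: k => // k IH in d *.
rewrite ltnS => hk; have [dD'|h] := ltnP d.+1 D; last first.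
  by rewrite /stride !big_geq ?modn1.
rewrite big_ltn // (stride_rec dD') IH; last by lia.
rewrite /digit; set a := N _; set b := stride _.
have b0 : 0 < b by apply: stride_gt0.
have a0 : 0 < a by apply: N_gt0.
have E : c = (c %/ b %/ a) * (a * b) + (c %/ b %% a * b + c %% b).
  by rewrite mulnA addnA -mulnDl -!divn_eq.
rewrite [in RHS]E modnMDl [RHS]modn_small //; apply: leq_trans (leq_mul (ltn_pmod (c %/ b) a0) (leqnn b)).
by rewrite mulSn addnC ltn_add2r ltn_pmod.
Qed.

Lemma undigits_set (x : nat -> nat) d i : 0 < d < D ->
  undigits (fun e => if e == d then i else x e) = undigits x - x d * stride d + i * stride d.
Proof.
move=> dD; rewrite /undigits; have dI : d \in index_iota 1 D by rewrite mem_index_iota.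
rewrite (bigD1_seq d) ?iota_uniq //= eqxx [in RHS](bigD1_seq d) ?iota_uniq //= addKn addnC.
by congr (_ + _); apply: eq_bigr => e /negPf->.
Qed.

Section Outer.
Local Open Scope ring_scope.
Variable F : fieldType.
Implicit Types (x b : nat -> F).

(** * Rank one tensors as functions of the column index *)

Definition outer x c : F := \prod_(1 <= d < D) x (offset d + digit d c)%N.
Definition outer_tail x c : F := \prod_(2 <= d < D) x (offset d + digit d c)%N.

Lemma outer_split x c : (1 < D)%N -> outer x c = x (digit 1 c) * outer_tail x c.
Proof. by move=> D1; rewrite /outer big_ltn // /offset big_geq. Qed.

Lemma eq_outer x y c : (forall p, (p < offset D)%N -> x p = y p) ->
  outer x c = outer y c.
Proof.
move=> h; rewrite /outer big_nat_cond [RHS]big_nat_cond; apply: eq_bigr => d.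
by rewrite andbT => /andP[d0 dD]; rewrite h // offset_digit_lt.
Qed.

Lemma eq_outer_tail x y c :
  (forall d i, (1 < d < D)%N -> (i < N d)%N -> x (offset d + i)%N = y (offset d + i)%N) ->
  outer_tail x c = outer_tail y c.
Proof.
move=> h; rewrite /outer_tail big_nat_cond [RHS]big_nat_cond; apply: eq_bigr => d.
by rewrite andbT => /[dup] dD /andP[_ dD']; rewrite h // digit_lt.
Qed.

Lemma outer0 x c : (1 < D)%N -> (forall p, (p < offset D)%N -> x p = 0) -> outer x c = 0.
Proof.
move=> D1 h; rewrite outer_split // h ?mul0r //.
have := @offset_digit_lt 1 c isT D1; rewrite {1}/offset big_geq //.
Qed.

(* The slices of a rank one tensor through a nonzero entry are proportional to
   its factors. *)
Lemma outer_slices x b cs : (1 < D)%N -> (cs < stride 0)%N -> outer x cs != 0 ->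
  (forall d i, (1 < d < D)%N -> (i < N d)%N ->
     b (offset d + i)%N = outer x (cs - digit d cs * stride d + i * stride d)%N) ->
  exists a : nat -> F, forall c, outer x c = a (digit 1 c) * outer_tail b c.
Proof.
move=> D1 hcs nz hb.
(* [lam d] is the ratio between the slice along axis [d] and the factor of that axis. It is nonzero
   because it divides the entry at [cs]; the product of these ratios is compensated in [a]. *)
pose lam d := \prod_(1 <= e < D | e != d) x (offset e + digit e cs)%N.
have dig_set d i e : (1 < d < D)%N -> (i < N d)%N -> (0 < e < D)%N ->
    digit e (cs - digit d cs * stride d + i * stride d)%N = if e == d then i else digit e cs.
  move=> dD iN eD; rewrite -[in LHS](undigits_digit hcs).
  have d0 : (0 < d < D)%N by lia.
  rewrite (undigits_digit hcs) -{1}(undigits_digit hcs) -(undigits_set (digit^~ cs)) //.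
  rewrite digit_undigits // => e' /andP[_ e'D]; case: eqP => [->|_] //.
  exact: digit_lt.
have bE d i : (1 < d < D)%N -> (i < N d)%N ->
    b (offset d + i)%N = x (offset d + i)%N * lam d.
  move=> dD iN; rewrite hb // /outer.
  have dI : d \in index_iota 1 D by rewrite mem_index_iota; lia.
  have d0 : (0 < d < D)%N by lia.
  rewrite (bigD1_seq d) ?iota_uniq //= (dig_set d i d dD iN d0) eqxx.
  congr (_ * _); rewrite /lam big_nat_cond [RHS]big_nat_cond.
  apply: eq_bigr => e /andP[eD /negPf ne].
  by rewrite (dig_set d i e) // ne.
have lam_neq0 d : lam d != 0.
  apply: contra nz; rewrite /lam /outer !prodf_seq_eq0 => /hasP[e eI /andP[_ h]].
  by apply/hasP; exists e.
have Lnz : \prod_(2 <= d < D) lam d != 0.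
  by rewrite prodf_seq_neq0; apply/allP => d _; rewrite lam_neq0.
exists (fun i => x i / \prod_(2 <= d < D) lam d) => c.
have -> : outer_tail b c = outer_tail x c * \prod_(2 <= d < D) lam d.
  rewrite /outer_tail -big_split big_nat_cond [RHS]big_nat_cond.
  apply: eq_bigr => d; rewrite andbT => dD.
  by rewrite bE // digit_lt //; case/andP: dD.
by rewrite outer_split // mulrA mulrAC mulrVK ?unitfE // mulrC mulrA mulrC mulrA.
Qed.

End Outer.
End Digits.

Section Algebra.
Local Open Scope ring_scope.
Variable F : fieldType.

(** * Elimination and column bases *)

Definition rmx p q (f : nat -> F) : 'M[F]_(p, q) :=
  \matrix_(i < p, j < q) f (i * q + j)%N.

(* The row space of K is the left kernel of the first c columns of B. *)
Definition kernel_upto k m (B : 'M[F]_(k, m)) c (K : 'M[F]_k) :=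
  forall y : 'rV_k, (y <= K)%MS <-> (forall j : 'I_m, (j < c)%N -> (y *m B) 0 j = 0).

Lemma kernel_upto_0 k m (B : 'M[F]_(k, m)) : kernel_upto B 0 1%:M.
Proof. by move=> y; split=> // _; apply: submx1. Qed.

(* Elimination without row exchanges: the pivot row p is not moved away, it
   becomes zero. *)
Lemma kernel_upto_step k m (B : 'M[F]_(k, m)) (c : 'I_m) (K : 'M[F]_k) (p : 'I_k) :
  let w := K *m col c B in
  (w != 0 -> w p 0 != 0) ->
  kernel_upto B c K -> kernel_upto B c.+1 (K - ((w p 0)^-1 *: w) *m row p K).
Proof.
move=> w hp hK y; set K' := _ - _.
(* Multiplying by [K'] corrects [z *m K] by the multiple of the pivot row that cancels column [c]. A
   combination that already annihilates column [c] receives no correction, so no kernel vector is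
   lost. *)
have K'E z : z *m K' = z *m K - ((w p 0)^-1 * (z *m w) 0 0) *: row p K.
  rewrite mulmxBr mulmxA; congr (_ - _).
  by rewrite -scalemxAr -scalemxAl {1}[z *m w]mx11_scalar mul_scalar_mx scalerA.
have colE z : (z *m B) 0 c = (z *m col c B) 0 0 by rewrite !mxE; apply: eq_bigr => j _; rewrite !mxE.
have -> : (y <= K')%MS <-> (y <= K)%MS /\ (y *m B) 0 c = 0.
  split=> [/submxP[z ->]|[/submxP[z yE]]]; last first.
    rewrite colE yE -mulmxA -/w => zw.
    by apply/submxP; exists z; rewrite K'E zw mulr0 scale0r subr0.
  split.
    rewrite K'E addmx_sub ?submxMl // -scaleNr scalemx_sub // row_sub //.
  rewrite colE K'E mulmxBl -mulmxA -/w -scalemxAl -row_mul -/w.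
  rewrite mxE [X in _ + X]mxE [X in - X]mxE [row p w 0 0]mxE.
  have [w0|/hp wp] := eqVneq w 0; first by rewrite w0 mulmx0 !mxE mulr0 subrr.
  by rewrite mulrAC mulVf // mul1r subrr.
rewrite hK; split=> [[h1 h2] j|h]; last by split=> [j jc|]; apply: h => //; apply: ltnW.
by rewrite ltnS leq_eqVlt => /predU1P[/val_inj->|/h1].
Qed.

(* The R - n rows of G selected by g correspond to the columns of A outside a
   column basis of A. *)
Lemma complement_rows n R m (T : 'M[F]_(n, m)) (A : 'M[F]_(n, R)) (G : 'M[F]_(R, m)) :
  T = A *m G -> \rank A = n ->
  exists g : 'I_R -> 'I_R, forall G0 : 'M[F]_(R, m),
    (forall r : 'I_R, (r < R - n)%N -> row r G0 = row (g r) G) -> (G <= T + G0)%MS.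
Proof.
move=> TE rA.
have rAT : row_full A^T by rewrite /row_full mxrank_tr rA.
pose f := fullrankfun rAT.
pose J := [set f i | i : 'I_n].
have cJ : #|J| = n by rewrite card_imset ?card_ord //; apply: fullrankfun_inj.
have P_unit : rowsub f A^T \in unitmx by apply: fullrowsub_unit.
have cJ' : size (enum (~: J)) = (R - n)%N by rewrite -cardE cardsCs setCK cJ card_ord.
(* The default value [r] occurs only for r >= R - n, where nothing is required of [G0]. *)
exists (fun r => nth r (enum (~: J)) r) => G0 hG0.
have rowJ' j : j \notin J -> (row j G <= T + G0)%MS.
  rewrite -in_setC -mem_enum => jJ.
  have := jJ; rewrite -index_mem cJ' => hj.
  have hjR : (index j (enum (~: J)) < R)%N by apply: leq_trans hj _; rewrite leq_subr.
  have := hG0 (Ordinal hjR) hj; rewrite nth_index // => <-.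
  by apply: submx_trans (row_sub _ _) (addsmxSr _ _).
(* Split the columns of [A] at the basis [J]: the invertible block times the rows of [G] in [J]
   equals [T] minus a combination of the rows of [G] outside [J]. Inverting the block puts the rows
   in [J] into the span. *)
have PG : (rowsub f A^T)^T *m rowsub f G = T - \matrix_(i, j) ((j \notin J)%:R * A i j) *m G.
  rewrite TE -mulmxBl; apply/matrixP => i c; rewrite !mxE.
  rewrite (bigID (mem J)) /= [X in _ = _ + X]big1 ?addr0; last first.
    by move=> j jJ; rewrite !mxE (negPf jJ) /= mul1r subrr mul0r.
  rewrite big_imset /=; last by move=> a b _ _; apply: fullrankfun_inj.
  apply: eq_bigr => j _; rewrite !mxE.
  by rewrite imset_f // mul0r subr0.
have rowJ : (rowsub f G <= T + G0)%MS.
  have -> : rowsub f G = invmx (rowsub f A^T)^T *m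
      (T - \matrix_(i, j) ((j \notin J)%:R * A i j) *m G).
    by rewrite -PG mulKmx // unitmx_tr.
  apply: mulmx_sub; apply: addmx_sub; first exact: addsmxSl.
  rewrite eqmx_opp; apply/row_subP => i; rewrite row_mul mulmx_sum_row.
  apply: summx_sub => j _; rewrite !mxE; case: (boolP (j \in J)) => jJ.
    by rewrite mul0r scale0r sub0mx.
  by rewrite scalemx_sub // rowJ'.
apply/row_subP => j; have [/imsetP[i _ ->]|] := boolP (j \in J); last exact: rowJ'.
by move/row_subP: rowJ => /(_ i); rewrite row_rowsub.
Qed.

End Algebra.

(** * Correctness of the procedures *)

Section Procedures.
Local Open Scope nat_scope.
Variables (F : finFieldType) (L B D R : nat) (N : nat -> nat) (T : nat -> F).
Hypothesis (L_gt0 : 0 < L) (LB : L < 2 ^ B) (qB : bitlen #|F| <= B).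

Local Notation NA := 30.
Local Notation wp := (wp NA L B).
Local Notation safe := (safe NA L B).
Local Notation m := (stride D N 0).
Local Notation S1 := (offset N D).
Local Notation n0 := (N 0).
Local Notation n1 := (N 1).
Local Notation S2 := (S1 - n1).
Local Notation E1 := ((R - n0) * S1).
Local Notation E2 := (minn R S2).
Local Notation k2 := (R + n0 + n1).
Local Notation dig := (digit D N).
Local Notation off := (offset N).
Local Notation str := (stride D N).
Local Notation outr := (@outer D N F).

Hypothesis (D_gt1 : 1 < D) (N_gt0 : forall d, d < D -> 0 < N d) (n0R : n0 <= R).
Hypothesis DL : D + 3 <= L.
Hypothesis kkL : k2 * k2 <= L.
Hypothesis kmL : k2 * m <= L.
Hypothesis RSL : R.+1 * S1 <= L.
Hypothesis outL : (n0 + S1) * R <= L.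
Hypothesis powL : E1 + R + S2 + 1 <= L.
Hypothesis powB : #|F| ^ (E1 + R + S2 + 1) < 2 ^ B.

Implicit Types (s : state F).

Record env (s : state F) : Prop := Env {
  env_D : nread s 0 0 = D;
  env_R : nread s 0 1 = R;
  env_q : nread s 0 2 = #|F|;
  env_N : forall d, d < D -> nread s 0 (3 + d) = N d;
  env_m : nread s 2 0 = m;
  env_str : forall d, d < D -> nread s 3 d = str d;
  env_off : forall d, 0 < d < D -> nread s 4 d = off d;
  env_S1 : nread s 5 0 = S1;
  env_S2 : nread s 6 0 = S2;
  env_Q1 : nread s 7 0 = #|F| ^ E1;
  env_Q2 : nread s 8 0 = #|F| ^ E2;
  env_E1 : nread s 9 0 = E1;
  env_pow : forall j, j <= E1 + R + S2 -> nread s 22 j = #|F| ^ j;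
  env_T : forall x, fread s 0 x = T x }.

Definition env_nat := [:: 0; 2; 3; 4; 5; 6; 7; 8; 9; 22].

Lemma env_agree nm fm s s' : env s -> agree nm fm s s' ->
  all (fun a => a \notin nm) env_nat -> 0 \notin fm -> env s'.
Proof.
move=> [e1 e2 e3 e4 e5 e6 e7 e8 e9 e10 e11 e12 e13 e14] [h1 h2].
rewrite /= => /and5P[i0 i2 i3 i4 /and5P[i5 i6 i7 i8 /and3P[i9 i22 _]]] f0.
by split=> *; rewrite ?h1 ?h2 //; auto.
Qed.

Lemma env_n0 s : env s -> nread s 0 3 = n0.
Proof. by move=> e; rewrite (env_N e (d := 0)) // ltnW. Qed.
Lemma env_n1 s : env s -> nread s 0 4 = n1.
Proof. by move=> e; rewrite (env_N e (d := 1)). Qed.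

Definition envE s (e : env s) :=
  (env_D e, env_R e, env_q e, env_n0 e, env_n1 e, env_m e,
   (env_S1 e, env_S2 e, env_Q1 e, env_Q2 e, env_E1 e, env_T e)).

Lemma m_gt0 : 0 < m. Proof. exact: stride_gt0. Qed.
Lemma R_gt0 : 0 < R. Proof. by apply: leq_trans n0R; apply: N_gt0; lia. Qed.
Lemma n1_gt0 : 0 < n1. Proof. exact: N_gt0. Qed.
Lemma n1_le : n1 <= S1.
Proof.
have := offset_le N (isT : 0 < 2) D_gt1.
by rewrite /offset big_nat1.
Qed.

(** * Rows of the transposed Khatri-Rao product *)

Lemma wp_outer s r c rv cv : safe s -> env s -> neval s r = rv -> neval s c = cv ->
  all (fun a => a \notin [:: 19]) (nreads r) ->
  all (fun a => a \notin [:: 19]) (nreads c) ->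
  wp (Outer r c) (fun s' =>
    fread s' 7 0 = outr (fun p => fread s 2 (rv * S1 + p)) cv) s.
Proof.
move=> hs he hr hc nr nc.
pose G j : F := (\prod_(1 <= d < j.+1) fread s 2 (rv * S1 + (off d + dig d cv)))%R.
have GD : G (D - 1) = outr (fun p => fread s 2 (rv * S1 + p)) cv.
  by rewrite /G subn1 prednK // ltnW.
rewrite -GD; apply: (wp_acc L_gt0 LB qB) => //.
- by rewrite /= (envE he).
- by apply: leq_trans DL; lia.
- by rewrite /G big_geq.
move=> j s1 jD hs1 ag ij acc.
have he1 := env_agree he ag isT isT.
apply: (wp_skip qB) => //=; rewrite acc /G [RHS]big_nat_recr //=; congr (_ * _)%R.
rewrite (neval_agree ag nr) (neval_agree ag nc) hr hc ij (envE he1) addn1.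
have jD' : j.+1 < D by lia.
by rewrite (env_off he1) // (env_str he1) // (env_N he1) // ag.2.
Qed.

Lemma wp_fill_outer s : safe s -> env s -> wp FillOuter (fun s' => forall x,
    fread s' 3 x = if x < R.+1 * m
      then outr (fun p => fread s 2 (x %/ m * S1 + p)) (x %% m) else fread s 3 x) s.
Proof.
move=> hs he; have n1_gt0 := n1_gt0.
apply: (wp_call (wp_fill (n := R.+1 * m) (b := 0)
  (g := fun x => outr (fun p => fread s 2 (x %/ m * S1 + p)) (x %% m))
  L_gt0 LB qB hs _ _ _ _ _ _ _ _ _)) => //.
- by rewrite /= !(envE he) addn1.
- by rewrite add0n; apply: leq_trans kmL; rewrite leq_mul2r -addnA -addn1 leq_add2l addn_gt0 n1_gt0 !orbT.
- move=> j s1 jD hs1 ag ij inv; have he1 := env_agree he ag isT isT.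
  apply: (wp_call (wp_outer hs1 he1 (erefl _) (erefl _) _ _)) => // s2 _ _ /= ->.
  rewrite ij (envE he1); apply: (eq_outer N_gt0) => p _.
  by rewrite ag.2.
by move=> s' _ _ inv x; rewrite inv subn0 add0n.
Qed.

Lemma rmxE p q (f : nat -> F) (i : 'I_p) (j : 'I_q) : rmx p q f i j = f (i * q + j).
Proof. by rewrite mxE. Qed.

Lemma flat_lt i j p q : i < p -> j < q -> i * q + j < p * q.
Proof. by move=> ip jq; apply: leq_trans (leq_mul ip (leqnn q)); rewrite mulSn addnC ltn_add2r. Qed.

(** * Left kernels by elimination *)

Section Kernel.
Variables (k : nexp) (kv K : nat).
Hypothesis (k_reads : all (fun a => a \notin [:: 17; 18; 20; 14]) (nreads k)).
Hypothesis (kv_gt0 : 0 < kv) (kvL : kv * kv <= L).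
Hypothesis (K_ok : K < NA) (K_fresh : K \notin [:: 3; 6; 7; 8; 0]).

Lemma kernel_dim_le : kv <= L.
Proof. by apply: leq_trans kvL; rewrite leq_pmulr. Qed.

Lemma kernel_dim_fresh l : all (fun x => x \in [:: 17; 18; 20; 14]) l ->
  all (fun a => a \notin l) (nreads k).
Proof. by move=> /allP h; apply: sub_all k_reads => x; apply: contra; apply: h. Qed.

Lemma kernel_dim_agree nm fm s s' : agree nm fm s s' ->
  all (fun x => x \in [:: 17; 18; 20; 14]) nm -> neval s k = kv -> neval s' k = kv.
Proof. by move=> ag hnm <-; apply: neval_agree ag _; apply: kernel_dim_fresh. Qed.

Lemma wp_kernel_init (s : state F) : safe s -> neval s k = kv ->
  wp (KernelInit k K) (fun s' => rmx kv kv (fread s' K) = 1%:M)%R s.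
Proof.
move=> hs hk.
apply: (wp_call (wp_fill (n := kv * kv) (b := 0)
  (g := fun x => ((x %/ kv == x %% kv)%N%:R)%R) L_gt0 LB qB hs _ _ _ _ _ _ _ _ _)) => //=.
- by rewrite hk.
- by move: K_fresh; rewrite !inE; lia.
- by rewrite cats0 all_cat kernel_dim_fresh.
- move=> j s1 jk hs1 ag ij inv.
  have hk1 : neval s1 k = kv by apply: (kernel_dim_agree ag).
  apply: (wp_if L_gt0 LB qB) => //= hb; apply: (wp_fset L_gt0 LB qB) => //=;
    rewrite fread_fupd /=; move: hb; rewrite ij hk1 -eqn_leq.
    by move=> ->.
  by move=> /negPf->.
move=> s' _ _ inv; apply/matrixP => i j; rewrite rmxE inv ?add0n ?subn0 /=.
have hij : i * kv + j < kv * kv.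
  exact: flat_lt.
rewrite hij divnMDl // modnMDl divn_small // modn_small // addn0 !mxE.
by rewrite (inj_eq val_inj).
Qed.

Ltac kfresh := by move: K_fresh; rewrite /= !inE; lia.

Lemma wp_kernel_step (s : state F) (c : 'I_m) (Bm : 'M[F]_(kv, m)) :
  safe s -> env s -> neval s k = kv -> nread s 18 0 = c ->
  Bm = rmx kv m (fread s 3) ->
  kernel_upto Bm c (rmx kv kv (fread s K)) ->
  wp (KernelStep k K) (fun s' => kernel_upto Bm c.+1 (rmx kv kv (fread s' K))) s.
Proof.
move=> hs he hk hc BE inv; have kL := kernel_dim_le.
pose w i : F := (\sum_(0 <= l < kv) fread s K (i * kv + l)%N * fread s 3 (l * m + c)%N)%R.
have wE (i : 'I_kv) : w i = (rmx kv kv (fread s K) *m col c Bm)%R i ord0.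
  rewrite /w big_mkord mxE; apply: eq_bigr => l _.
  by rewrite rmxE mxE BE rmxE.
apply: wp_seq.
  apply: (wp_fill (n := kv) (b := 0) (g := w) L_gt0 LB qB hs hk _ _ _ _ _ _ _) => //=.
    by rewrite cats0 kernel_dim_fresh.
  move=> j s1 jk hs1 ag ij _.
  have hk1 : neval s1 k = kv by apply: (kernel_dim_agree ag).
  pose G i : F := (\sum_(0 <= l < i) fread s K (j * kv + l)%N * fread s 3 (l * m + c)%N)%R.
  apply: (wp_acc (n := kv) (G := G) L_gt0 LB qB hs1 hk1 _ _ _ _ _ _ _) => //=.
  - by rewrite kernel_dim_fresh.
  - by rewrite /G big_geq.
  move=> l s2 lk hs2 ag2 il acc; apply: (wp_skip qB) => //=.
  rewrite acc /G [RHS]big_nat_recr //=; congr (_ + _ * _)%R.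
    rewrite (ag2.1 17) // ij il ag2.2 ?ag.2 ?(kernel_dim_agree ag2) //; kfresh.
  by rewrite il (env_m (env_agree (env_agree he ag isT isT) ag2 isT isT)) ag2.2 // ag.2 // ag2.1 // ag.1 // hc.
move=> s1 hs1 ag1 /= w1.
have hk1 : neval s1 k = kv.
  by apply: (kernel_dim_agree ag1).
apply: wp_seq.
  apply: (wp_search (n := kv) (g := w) L_gt0 LB qB hs1 hk1 _ _ _ _ _ _ _) => //=.
    by rewrite kernel_dim_fresh.
  by move=> j s2 jk hs2 ag2 /= ->; rewrite ag2.2 // w1 add0n jk subn0.
move=> s2 hs2 ag2 /=; set p := nread s2 14 0 => -[pk wp].
have hk2 : neval s2 k = kv.
  by apply: (kernel_dim_agree ag2).
apply: (@wp_seq _ _ _ _ _ _ (fun s' => fread s' 7 0 = (fread s2 6 p)^-1)%R).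
  by apply: (wp_fset L_gt0 LB qB) => //=; rewrite fread_fupd.
move=> s3 hs3 ag3 f7.
have hk3 : neval s3 k = kv by apply: (kernel_dim_agree ag3).
have K3 x : fread s3 K x = fread s K x.
  by rewrite ag3.2 ?ag2.2 ?ag1.2 //; kfresh.
apply: wp_seq.
  apply: (wp_fill (n := kv) (b := 0) (g := fun x => fread s K (p * kv + x))
    L_gt0 LB qB hs3 hk3 _ _ _ _ _ _ _) => //=.
    by rewrite cats0 kernel_dim_fresh.
  move=> j s4 jk hs4 ag4 ij _; apply: (wp_skip qB) => //=.
  rewrite ag4.1 // ag3.1 // ij (kernel_dim_agree ag4) //.
  by rewrite ag4.2 ?K3 //; kfresh.
move=> s4 hs4 ag4 f8.
have hk4 : neval s4 k = kv.
  by apply: (kernel_dim_agree ag4).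
have K4 x : fread s4 K x = fread s K x by rewrite ag4.2 ?K3 //; kfresh.
apply: wp_call.
  apply: (wp_fill (n := kv * kv) (b := 0) (g := fun x =>
    (fread s K x - (fread s2 6 p)^-1 * w (x %/ kv)%N * fread s K (p * kv + x %% kv)%N)%R)
    L_gt0 LB qB hs4 _ _ _ _ _ _ _ _ _) => //=.
  - by rewrite hk4.
  - by rewrite cats0 all_cat kernel_dim_fresh.
  move=> j s5 jk hs5 ag5 ij inv5; apply: (wp_skip qB) => //=.
  have hk5 : neval s5 k = kv.
    by apply: (kernel_dim_agree ag5).
  have j1 : j %/ kv < kv by rewrite ltn_divLR.
  have j2 : j %% kv < kv by rewrite ltn_mod.
  (* The update in place is safe: cell [j] still holds its old value when it is read, and the pivot
     column and the pivot row were saved in arrays 6 and 8. *)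
  rewrite ij hk5 inv5 add0n ltnn K4.
  rewrite !ag5.2 ?f8 ?add0n ?j2 ?subn0; try kfresh.
  have -> : fread s4 6 (j %/ kv) = w (j %/ kv).
    by rewrite ag4.2 // ag3.2 // ag2.2 // w1 add0n j1 subn0.
  by rewrite ag4.2 // f7.
move=> s5 hs5 ag5 f5.
have KE (i j : 'I_kv) : rmx kv kv (fread s5 K) i j =
    (fread s K (i * kv + j) - (fread s2 6 p)^-1 * w i * fread s K (p * kv + j)%N)%R.
  rewrite rmxE f5 /= add0n subn0.
  have hij : i * kv + j < kv * kv.
    exact: flat_lt.
  by rewrite hij divnMDl // modnMDl divn_small // modn_small // addn0.
have hp : (rmx kv kv (fread s K) *m col c Bm != 0 ->
    (rmx kv kv (fread s K) *m col c Bm) (Ordinal pk) ord0 != 0)%R.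
  by case/matrix0Pn => i [o]; rewrite (ord1 o) -!wE => /(wp _ (ltn_ord i)).
move: (kernel_upto_step hp inv).
congr (kernel_upto _ _ _); apply/matrixP => i' j.
have f6 : fread s2 6 p = w p by rewrite ag2.2 // w1 add0n pk subn0.
rewrite KE f6 (wE (Ordinal pk)) (wE i') mxE rmxE [X in (_ + X)%R]mxE [X in (- X)%R]mxE big_ord1.
congr (_ - _)%R; rewrite [row _ _ _ _]mxE rmxE; congr (_ * _)%R.
by rewrite [LHS]mxE.
Qed.

Lemma wp_kernel s : safe s -> env s -> neval s k = kv ->
  wp (Kernel k K) (fun s' =>
    kernel_upto (rmx kv m (fread s 3)) m (rmx kv kv (fread s' K))) s.
Proof.
move=> hs he hk; apply: wp_seq (wp_kernel_init hs hk) _ => s1 hs1 ag1 K1.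
have he1 : env s1 by apply: (env_agree he ag1); rewrite //= ?cats0; kfresh.
have hk1 : neval s1 k = kv.
  by apply: (kernel_dim_agree ag1).
have B1 : rmx kv m (fread s1 3) = rmx kv m (fread s 3).
  by apply/matrixP => i j; rewrite !rmxE ag1.2 //=; kfresh.
apply: (wp_for (n := m) (Inv := fun c s' =>
  kernel_upto (rmx kv m (fread s 3)) c (rmx kv kv (fread s' K))) L_gt0 LB qB hs1).
- by rewrite /= (envE he1).
- by apply: leq_trans kmL; rewrite leq_pmull // -addnA addn_gt0 R_gt0.
- by [].
- by [].
- by [].
- move=> j s2 s3 ag; congr (kernel_upto _ _ _); apply/matrixP => i l.
  by rewrite !rmxE ag.2.
- by rewrite K1; apply: kernel_upto_0.
move=> c s2 cm hs2 ag2 ic inv.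
have he2 : env s2 by apply: (env_agree he1 ag2); rewrite //= ?cats0; kfresh.
apply: (wp_kernel_step (c := Ordinal cm)) => //.
  exact: (kernel_dim_agree ag2).
by rewrite -B1; apply/matrixP => i j; rewrite !rmxE ag2.2 //=; kfresh.
Qed.

End Kernel.

(** * Linear dependence of the last row on the others *)

Lemma R1_sq : R.+1 * R.+1 <= L.
Proof.
have h : R.+1 <= k2 by rewrite -addnA -addn1 leq_add2l addn_gt0 n1_gt0 orbT.
by apply: leq_trans kkL; apply: leq_mul.
Qed.

Lemma wp_relation s : safe s -> env s ->
  wp Relation (fun s' =>
    let lc := fread s' 4 (nread s' 14 0 * R.+1 + R) in
    let Cm := rmx R m (fread s 3) in
    let tv := (\row_(j < m) fread s 3 (R * m + j))%R in
    if lc == 0%R then is_true (~~ (tv <= Cm)%MS) else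
    tv = ((\row_(r < R) (- fread s' 4 (nread s' 14 0 * R.+1 + r)%N * lc^-1)) *m Cm)%R) s.
Proof.
move=> hs he.
have kE : neval s (vR +' 1) = R.+1 by rewrite /= (envE he) addn1.
have kr : all (fun a => a \notin [:: 17; 18; 20; 14]) (nreads (vR +' 1)) by [].
apply: (wp_seq (wp_kernel kr (ltn0Sn R) R1_sq (isT : 4 < NA) (isT : 4 \notin [:: 3; 6; 7; 8; 0]) hs he kE)).
move=> s1 hs1 ag1 ker.
have he1 : env s1 by apply: (env_agree he ag1).
apply: wp_call.
  apply: (wp_search (n := R.+1) (g := fun l => fread s1 4 (l * R.+1 + R)) L_gt0 LB qB hs1) => //=.
  - by rewrite (envE he1) addn1.
  - by apply: leq_trans R1_sq; rewrite leq_pmulr.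
  move=> j s2 jR hs2 ag2 ij; rewrite ij (envE (env_agree he1 ag2 isT isT)) addn1.
  by rewrite ag2.2.
move=> s2 hs2 ag2 /=; set p := nread s2 14 0 => -[pR hp].
have -> : fread s2 4 (p * R.+1 + R) = fread s1 4 (p * R.+1 + R) by rewrite ag2.2.
set Km := rmx R.+1 R.+1 (fread s1 4) in ker.
set Bm := rmx R.+1 m (fread s 3) in ker.
have kerE (y : 'rV_R.+1) : (y <= Km)%MS <-> (y *m Bm)%R = 0%R.
  rewrite ker; split=> [h|-> j _]; last by rewrite mxE.
  by apply/rowP => j; rewrite h ?mxE.
case: eqP => [lc0|/eqP lc0].
  apply/negP => /submxP[z tvE].
  (* If [z] represents the last row, then (-z, 1) is a relation, hence a combination of the rows of
     [Km]. All these rows have last entry 0, since the search found no other; this contradicts the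
     1. *)
  pose y : 'rV[F]_R.+1 :=
    (\row_(r < R.+1) (if insub (nat_of_ord r) is Some r' then - z ord0 r' else 1))%R.
  have yl (r : 'I_R) : y ord0 (widen_ord (leqnSn R) r) = (- z ord0 r)%R.
    by rewrite mxE /= valK.
  have yr : y ord0 ord_max = 1%R by rewrite mxE /= insubF // ltnn.
  have /submxP[x yE] : (y <= Km)%MS.
    apply/kerE/rowP => j; rewrite mxE big_ord_recr /= yr mul1r mxE.
    have /rowP/(_ j) := tvE; rewrite !mxE => ->.
    rewrite -big_split /= big1 // => r _.
    by rewrite yl mulNr !mxE addNr.
  have : y ord0 ord_max = 0%R.
    rewrite yE mxE big1 // => l _; rewrite rmxE /=.
    have [->|nz] := eqVneq (fread s1 4 (l * R.+1 + R)) 0%R; first by rewrite mulr0.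
    by have := hp _ (ltn_ord l) nz; rewrite lc0 eqxx.
  by rewrite yr => /eqP; rewrite oner_eq0.
have /kerE/rowP rel : (row (Ordinal pR) Km <= Km)%MS by apply: row_sub.
apply/rowP => j; have := rel j; rewrite !mxE big_ord_recr /= !mxE => h.
have -> : fread s 3 (R * m + j) =
   (- (fread s1 4 (p * R.+1 + R))^-1 * \sum_(i < R) fread s1 4 (p * R.+1 + i)%N * fread s 3 (i * m + j)%N)%R.
  apply: (mulfI lc0); rewrite mulNr mulrN mulVKf //.
  apply/eqP; rewrite -addr_eq0 addrC; apply/eqP; rewrite -[RHS]h; congr (_ + _)%R.
  by apply: eq_bigr => i _; rewrite !mxE.
rewrite mulr_sumr; apply: eq_bigr => i _; rewrite !mxE ag2.2 //.
by rewrite mulrA; congr (_ * _)%R; rewrite !mulNr mulrC.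
Qed.

(* Row r of the array x consists of the r-th columns of A_1, ..., A_(D-1), and
   gives row r of the transposed Khatri-Rao product. *)
Definition KR (x : nat -> F) : 'M[F]_(R, m) :=
  (\matrix_(r < R, c < m) outr (fun p => x (r * S1 + p)%N) c)%R.

(** * Enlarging the span by rank one tensors of V *)

Definition Tmx : 'M[F]_(n0, m) := rmx n0 m T.
Definition cand_tail (x : nat -> F) := outer_tail D N (fun p => x (R * S1 + p)).
(** The tensor a x b with [b] given as a function of the column index; in its uses [b] does not
    depend on the coordinate of axis 1. *)
Definition slab (a b : nat -> F) : 'rV[F]_m := (\row_(c < m) (a (dig 1 c) * b c))%R.

(** [x0] is array 2 as decoded from the outer guess, and V is [Tmx + KR x0]. By [si_sup] and
    [si_sub] the current rows together with [Tmx] still span V. [si_rank] says that every appended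
    row raised the rank, which bounds their number. Free rows are zero ([si_zero]), so filling one
    loses nothing of the span. [si_rows] keeps the guessed rows available as generators for the
    inner guesses. *)
Record search_inv (x0 : nat -> F) s : Prop := SearchInv {
  si_lo : R - n0 <= nread s 10 0;
  si_hi : nread s 10 0 <= R;
  si_zero : forall x, nread s 10 0 * S1 <= x < R * S1 -> fread s 2 x = 0%R;
  si_sup : (KR x0 <= KR (fread s 2))%MS;
  si_sub : (KR (fread s 2) <= Tmx + KR x0)%MS;
  si_rank : \rank (KR x0) + (nread s 10 0 - (R - n0)) <= \rank (KR (fread s 2));
  si_rows : forall x, x < (R - n0) * S1 -> fread s 2 x = x0 x }.

Lemma KR_eq x y : (forall p, p < R * S1 -> x p = y p) -> KR x = KR y.
Proof.
move=> h; apply/matrixP => r c; rewrite !mxE; apply: (eq_outer N_gt0) => p pS.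
by apply: h; apply: flat_lt.
Qed.

Lemma search_inv_agree nm fm x0 s s' : search_inv x0 s -> agree nm fm s s' ->
  10 \notin nm -> (forall x, x < R * S1 -> fread s' 2 x = fread s 2 x) ->
  search_inv x0 s'.
Proof.
move=> [h1 h2 h3 h4 h5 h6 h7] [ag _] nm10 hx.
have KE : KR (fread s' 2) = KR (fread s 2) by apply: KR_eq.
split; rewrite ?KE ?ag //.
  by move=> x /[dup] /andP[_ xR]; rewrite hx //; apply: h3.
move=> x hx'; rewrite hx ?h7 //.
by apply: leq_trans hx' _; rewrite leq_mul2r leq_subr orbT.
Qed.

Lemma cand_tail_eq x y : (forall p, n1 <= p < S1 -> x (R * S1 + p) = y (R * S1 + p)) ->
  cand_tail x =1 cand_tail y.
Proof.
move=> h c; apply: (eq_outer_tail N_gt0) => d i /andP[d1 dD] iN; apply: h.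
apply/andP; split.
  apply: leq_trans (leq_addr _ _).
  by have := offset_le N (isT : 0 < 2) d1; rewrite {1}/offset big_nat1.
apply: leq_trans (offset_le N (isT : 0 < d.+1) dD).
by rewrite offset_rec ?ltn_add2l // ltnW.
Qed.

Lemma slab_eq a a' b b' : (forall l, l < n1 -> a l = a' l) -> b =1 b' ->
  slab a b = slab a' b'.
Proof. by move=> ha hb; apply/rowP => c; rewrite !mxE hb ha // digit_lt. Qed.

Lemma outer_slab x a : (forall l, l < n1 -> x (R * S1 + l) = a l) ->
  (\row_(c < m) outr (fun p => x (R * S1 + p)%N) c)%R = slab a (cand_tail x).
Proof.
by move=> h; apply/rowP => c; rewrite !mxE outer_split // h // digit_lt.
Qed.

Lemma append_row (C C' : 'M[F]_(R, m)) (v : 'rV_m) (r0 : 'I_R) :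
  row r0 C = 0%R -> row r0 C' = v -> (forall r, r != r0 -> row r C' = row r C) ->
  [/\ (C <= C')%MS, (v <= C')%MS & (C' <= C + v)%MS].
Proof.
move=> h0 hv hr; split.
- apply/row_subP => r; have [->|/hr <-] := eqVneq r r0; last exact: row_sub.
  by rewrite h0 sub0mx.
- by rewrite -hv row_sub.
apply/row_subP => r; have [->|/hr ->] := eqVneq r r0.
  by rewrite hv addsmxSr.
exact: submx_trans (row_sub _ _) (addsmxSl _ _).
Qed.

Lemma wp_step_try x0 s (a : nat -> F) : safe s -> env s -> search_inv x0 s ->
  nread s 21 0 < k2 ->
  (forall l, l < n1 -> a l = fread s 5 (nread s 21 0 * k2 + (R + n0 + l))) ->
  (slab a (cand_tail (fread s 2)) <= Tmx + KR x0)%MS ->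
  wp StepTry (fun s' => [/\ search_inv x0 s', (KR (fread s 2) <= KR (fread s' 2))%MS,
    (slab a (cand_tail (fread s 2)) <= KR (fread s' 2))%MS &
    forall p, n1 <= p < S1 -> fread s' 2 (R * S1 + p) = fread s 2 (R * S1 + p)]) s.
Proof.
move=> hs he inv jk ha aV; set v := slab _ _ in aV *.
have n1S := n1_le.
have RSL' : R * S1 + S1 <= L by rewrite addnC -mulSn.
apply: wp_seq.
  apply: (wp_fill (n := n1) (b := R * S1) (g := a) L_gt0 LB qB hs) => //=.
  - by rewrite !(envE he).
  - by rewrite !(envE he).
  - by apply: leq_trans RSL'; rewrite leq_add2l.
  move=> j s1 jn hs1 ag1 ij _; apply: (wp_skip qB) => //=.
  have he1 := env_agree he ag1 isT isT.
  by rewrite !(envE he1) ij ag1.1 // ag1.2 // ha.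
move=> s1 hs1 ag1 x1.
have he1 : env s1 by apply: (env_agree he ag1).
have x1lo x : x < R * S1 -> fread s1 2 x = fread s 2 x.
  by move=> h; rewrite x1 leqNgt h.
have x1hi p : n1 <= p -> fread s1 2 (R * S1 + p) = fread s 2 (R * S1 + p).
  by move=> h; rewrite x1 ltn_add2l [p < _]ltnNge h andbF.
have inv1 : search_inv x0 s1 by apply: (search_inv_agree inv ag1).
apply: wp_seq (wp_fill_outer hs1 he1) _ => s2 hs2 ag2 f2.
have he2 : env s2 by apply: (env_agree he1 ag2).
have C2 : rmx R m (fread s2 3) = KR (fread s 2).
  rewrite -(KR_eq (x := fread s1 2)) //; apply/matrixP => r c; rewrite rmxE mxE f2.
  have -> : r * m + c < R.+1 * m.
    by apply: flat_lt => //; apply: leqW.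
  by rewrite divnMDl ?m_gt0 // modnMDl divn_small // modn_small // addn0.
have v2 : (\row_(j < m) fread s2 3 (R * m + j)%N)%R = v.
  rewrite /v (slab_eq (a' := a) (b' := cand_tail (fread s1 2)) (fun l _ => erefl)); last first.
    by move=> c; apply: cand_tail_eq => p /andP[h _]; rewrite x1hi.
  rewrite -outer_slab; last first.
    by move=> l ln; rewrite x1 leq_addr ltn_add2l ln addKn.
  apply/rowP => c; rewrite !mxE f2.
  have -> : R * m + c < R.+1 * m by rewrite mulSn addnC ltn_add2r.
  by rewrite divnMDl ?m_gt0 // modnMDl divn_small // modn_small // addn0.
apply: wp_seq (wp_relation hs2 he2) _ => s3 hs3 ag3 /=; rewrite C2 v2.
have he3 : env s3 by apply: (env_agree he2 ag3).
have x3 x : fread s3 2 x = fread s1 2 x by rewrite ag3.2 ?ag2.2.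
have inv3 : search_inv x0 s3.
  have inv2 : search_inv x0 s2.
    by apply: (search_inv_agree inv1 ag2) => // x _; rewrite ag2.2.
  by apply: (search_inv_agree inv2 ag3) => // x _; rewrite ag3.2.
have KR3 : KR (fread s3 2) = KR (fread s 2).
  by apply: KR_eq => p hp; rewrite x3 x1lo.
move=> rel; apply: (wp_if L_gt0 LB qB) => //=; rewrite (envE he3) addn1 => lc0; last first.
  apply: (wp_skip qB) => //; split=> //; first by rewrite KR3.
    by move: rel; rewrite (negPf lc0) KR3 => ->; rewrite submxMl.
  by move=> p /andP[h _]; rewrite x3 x1hi.
rewrite lc0 in rel.
have [h1 h2 h3 h4 h5 h6 h7] := inv3.
set cnt := nread s3 10 0 in h1 h2 h3 h6.
(* A free row is left: with all R rows used, [si_rank] would give the span rank at least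
   [\rank (KR x0) + n0], which is at least dim V. The span would be V and contain the candidate,
   against [rel]. *)
have cR : cnt < R.
  rewrite ltn_neqAle h2 andbT; apply: contraNneq rel => cE; rewrite -KR3.
  apply: submx_trans aV _; rewrite -(mxrank_leqif_sup h5).
  rewrite eqn_leq mxrankS //=; apply: leq_trans h6.
  rewrite cE subKn //; apply: leq_trans (mxrank_adds_leqif _ _) _.
  by rewrite addnC leq_add2l rank_leq_row.
have cS : cnt * S1 + S1 <= R * S1 by rewrite addnC -mulSn leq_mul2r cR orbT.
apply: wp_seq.
  apply: (wp_fill (n := S1) (b := cnt * S1) (g := fun p => fread s3 2 (R * S1 + p))
     L_gt0 LB qB hs3) => //=.
  - by rewrite !(envE he3).
  - by rewrite !(envE he3).
  - by apply: leq_trans cS _; apply: leq_trans RSL'; rewrite leq_addr.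
  move=> j s4 jS hs4 ag4 ij f4; apply: (wp_skip qB) => //=.
  have he4 := env_agree he3 ag4 isT isT.
  rewrite !(envE he4) ij f4; case: ifP => // /andP[_ h]; exfalso.
  by move: h cS jS; lia.
move=> s4 hs4 ag4 f4.
have cnt4 : nread s4 10 0 = cnt by rewrite ag4.1.
apply: (wp_set L_gt0 LB qB) => //=.
  rewrite cnt4 addn1; apply: leq_ltn_trans LB; apply: leq_trans cR _.
  by apply: leq_trans R1_sq; apply: leq_trans (leqnSn R) _; rewrite leq_pmulr.
set s5 := nupd _ _ _ _.
have x5 x : fread s5 2 x = if cnt * S1 <= x < cnt * S1 + S1
    then fread s3 2 (R * S1 + (x - cnt * S1)) else fread s3 2 x by apply: f4.
have cnt5 : nread s5 10 0 = cnt.+1 by rewrite nread_nupd /= cnt4 addn1.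
have S1_gt0 : 0 < S1 by apply: leq_trans n1_gt0 n1S.
have [k1 k2' k3] : [/\ (KR (fread s 2) <= KR (fread s5 2))%MS,
    (v <= KR (fread s5 2))%MS & (KR (fread s5 2) <= KR (fread s 2) + v)%MS].
  apply: (append_row (r0 := Ordinal cR)).
  - rewrite -KR3; apply/rowP => c; rewrite !mxE; apply: (outer0 N_gt0) => // p pS.
    by rewrite h3 //= leq_addr /=; apply: leq_trans cS; rewrite ltn_add2l.
  - rewrite -v2; apply/rowP => c; rewrite !mxE f2.
    have -> : R * m + c < R.+1 * m by rewrite mulSn addnC ltn_add2r.
    rewrite divnMDl ?m_gt0 // modnMDl divn_small // modn_small // addn0.
    apply: (eq_outer N_gt0) => p pS.
    by rewrite x5 leq_addr ltn_add2l pS addKn x3.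
  move=> r rc; rewrite -KR3; apply/rowP => c; rewrite !mxE.
  apply: (eq_outer N_gt0) => p pS; rewrite x5; case: ifP => // /andP[g1 g2].
  case/eqP: rc; apply: val_inj => /=; apply/eqP; rewrite eqn_leq.
  have : r * S1 < cnt.+1 * S1 by rewrite mulSn [S1 + _]addnC; apply: leq_ltn_trans g2; rewrite leq_addr.
  rewrite ltn_mul2r S1_gt0 ltnS /= => -> /=.
  have : cnt * S1 < r.+1 * S1 by apply: leq_ltn_trans g1 _; rewrite mulSn addnC ltn_add2r.
  by rewrite ltn_mul2r S1_gt0.
split=> //; last first.
  move=> p /andP[pn pS]; rewrite x5; case: ifP => [/andP[_ h]|_].
    by exfalso; move: h cS; lia.
  by rewrite x3 x1hi.
split; rewrite ?cnt5 //.
- by apply: leq_trans h1 _.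
- move=> x /andP[g1 g2]; rewrite x5 ifF ?h3 //; last by move: g1; rewrite mulSn addnC; lia.
  rewrite g2 andbT; apply: leq_trans g1; rewrite leq_mul2r leqnSn orbT //.
- by rewrite -KR3 in k1; apply: submx_trans h4 k1.
- apply: submx_trans k3 _; rewrite addsmx_sub aV andbT -KR3 //.
- have lt : \rank (KR (fread s 2)) < \rank (KR (fread s5 2)).
    apply: rank_ltmx; rewrite ltmxE k1 /=; apply: contra rel => h.
    exact: submx_trans k2' h.
  apply: leq_trans lt; rewrite subSn // addnS ltnS -KR3 //.
move=> x hx; rewrite x5 ifF ?h7 //; apply/negP => /andP[g _].
move: (leq_trans hx (leq_mul h1 (leqnn S1))); lia.
Qed.

Lemma fill_outer_row (x f3 f3' : nat -> F) r c :
  (forall y, f3' y = if y < R.+1 * m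
      then outr (fun p => x (y %/ m * S1 + p)) (y %% m) else f3 y) ->
  r <= R -> c < m -> f3' (r * m + c) = outr (fun p => x (r * S1 + p)) c.
Proof.
move=> h rR cm; rewrite h flat_lt // divnMDl ?m_gt0 // modnMDl divn_small //.
by rewrite modn_small // addn0.
Qed.

Lemma wp_step_system s : safe s -> env s ->
  wp StepSystem (fun s' =>
    [/\ forall x, fread s' 2 x = if R * S1 <= x < R * S1 + n1 then 1%R else fread s 2 x,
     forall r c, r < R -> c < m ->
       fread s' 3 (r * m + c) = outr (fun p => fread s 2 (r * S1 + p)) c,
     forall i c, i < n0 -> c < m -> fread s' 3 ((R + i) * m + c) = T (i * m + c) &
     forall l c, l < n1 -> c < m -> fread s' 3 ((R + n0 + l) * m + c) =
       if l == dig 1 c then cand_tail (fread s 2) c else 0%R]) s.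
Proof.
move=> hs he; have n1S := n1_le.
have RSL' : R * S1 + S1 <= L by rewrite addnC -mulSn.
apply: wp_seq.
  apply: (wp_fill (n := n1) (b := R * S1) (g := fun=> 1%R) L_gt0 LB qB hs) => //=.
  - by rewrite !(envE he).
  - by rewrite !(envE he).
  - by apply: leq_trans RSL'; rewrite leq_add2l.
  by move=> j s1 jn hs1 ag1 ij _; apply: (wp_skip qB).
move=> s1 hs1 ag1 x1.
have he1 : env s1 by apply: (env_agree he ag1).
apply: wp_seq (wp_fill_outer hs1 he1) _ => s2 hs2 ag2 f2.
have he2 : env s2 by apply: (env_agree he1 ag2).
apply: wp_seq.
  apply: (wp_fill (n := n0 * m) (b := R * m) (g := T) L_gt0 LB qB hs2) => //=.
  - by rewrite !(envE he2).
  - by rewrite !(envE he2).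
  - by apply: leq_trans kmL; rewrite -mulnDl leq_mul2r leq_addr orbT.
  move=> j s3 jn hs3 ag3 ij _; apply: (wp_skip qB) => //=.
  by rewrite !(envE (env_agree he2 ag3 isT isT)) ij.
move=> s3 hs3 ag3 f3.
have he3 : env s3 by apply: (env_agree he2 ag3).
have x3 x : fread s3 2 x = fread s1 2 x by rewrite ag3.2 ?ag2.2.
apply: wp_call.
  apply: (wp_fill (n := n1 * m) (b := (R + n0) * m)
    (g := fun x => if x %/ m == dig 1 (x %% m) then cand_tail (fread s 2) (x %% m) else 0%R)
    L_gt0 LB qB hs3) => //=.
  - by rewrite !(envE he3).
  - by rewrite !(envE he3).
  - by apply: leq_trans kmL; rewrite -mulnDl.
  move=> j s4 jn hs4 ag4 ij _.
  have he4 : env s4 by apply: (env_agree he3 ag4).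
  apply: wp_seq (wp_outer (r := vR) (c := V 17 %' vm) hs4 he4 (erefl _) (erefl _) _ _) _ => //.
  move=> s5 hs5 ag5 /=; rewrite ij !(envE he4) => f5.
  have he5 : env s5 by apply: (env_agree he4 ag5).
  have i5 : nread s5 17 0 = j by rewrite ag5.1.
  have tl : (fread s5 7 0 = cand_tail (fread s 2) (j %% m))%R.
    rewrite f5 outer_split // -(@cand_tail_eq (fread s4 2)); last first.
      move=> p /andP[pn _]; rewrite ag4.2 // x3 x1 ltn_add2l [p < _]ltnNge pn andbF //.
    rewrite ag4.2 // x3 x1 leq_addr ltn_add2l digit_lt // mul1r.
    by [].
  apply: (wp_if L_gt0 LB qB) => //= hb.
    apply: (wp_skip qB) => //; move: hb; rewrite -eqn_leq i5 !(envE he5) (env_str he5) //.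
    by rewrite tl => ->.
  apply: (wp_fset L_gt0 LB qB) => //=; rewrite fread_fupd /=.
  by move: hb; rewrite -eqn_leq i5 !(envE he5) (env_str he5) // => /negPf ->.
move=> s4 hs4 ag4 f4; split.
- by move=> x; rewrite ag4.2 // x3 x1; case: ifP.
- move=> r c rR cm; rewrite f4 ifF; last first.
    by apply: negbTE; rewrite negb_and -ltnNge (leq_trans (flat_lt rR cm)) // leq_mul2r leq_addr orbT.
  rewrite f3 ifF; last first.
    by apply: negbTE; rewrite negb_and -ltnNge flat_lt.
  rewrite (fill_outer_row f2 (ltnW rR) cm); apply: (eq_outer N_gt0) => p pS.
  by rewrite x1 ifF //; apply: negbTE; rewrite negb_and -ltnNge flat_lt.
- move=> i c i0 cm; rewrite f4 ifF; last first.
    by apply: negbTE; rewrite negb_and -ltnNge flat_lt // ltn_add2l.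
  rewrite f3 mulnDl -addnA leq_addr ltn_add2l flat_lt //= addKn //.
move=> l c ln cm; rewrite f4 [(_ + l) * m]mulnDl -addnA leq_addr ltn_add2l flat_lt //= addKn.
by rewrite divnMDl ?m_gt0 // modnMDl divn_small // modn_small // addn0.
Qed.

(** Linearity in [a]: the coordinates of a kernel vector on the last block of the system are the
    entries of a vector [a]. *)
Lemma slabE (a b : nat -> F) : slab a b =
  ((\row_(l < n1) a l) *m \matrix_(l < n1, c < m) (if l == dig 1 c :> nat then b c else 0))%R.
Proof.
apply/rowP => c; rewrite !mxE (bigD1 (Ordinal (digit_lt N_gt0 c D_gt1))) //= !mxE eqxx.
rewrite big1 ?addr0 // => l nl; rewrite !mxE ifF ?mulr0 //; apply: contraNF nl => /eqP h.
exact/eqP/val_inj.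
Qed.

Lemma wp_step x0 s : safe s -> env s -> search_inv x0 s ->
  wp Step (fun s' => [/\ search_inv x0 s', (KR (fread s 2) <= KR (fread s' 2))%MS &
    forall a, (slab a (cand_tail (fread s 2)) <= Tmx + KR x0)%MS ->
      (slab a (cand_tail (fread s 2)) <= KR (fread s' 2))%MS]) s.
Proof.
move=> hs he inv; apply: wp_seq (wp_step_system hs he) _ => s1 hs1 ag1 [x1 fC fT fE].
have he1 : env s1 by apply: (env_agree he ag1).
have k2_gt0 : 0 < k2 by rewrite -addnA addn_gt0 R_gt0.
have kE : neval s1 vk = k2 by rewrite /= !(envE he1).
apply: (wp_seq (wp_kernel (k := vk) (K := 5) isT k2_gt0 kkL isT isT hs1 he1 kE)).
move=> s2 hs2 ag2; set Km := rmx k2 k2 _ => ker.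
have he2 : env s2 by apply: (env_agree he1 ag2).
set be := cand_tail (fread s 2).
pose E : 'M[F]_(n1, m) :=
  (\matrix_(l < n1, c < m) (if l == dig 1 c :> nat then be c else 0))%R.
have BE : rmx k2 m (fread s1 3) = col_mx (col_mx (KR (fread s 2)) Tmx) E.
  apply/matrixP => i c; rewrite rmxE -[i]splitK.
  case: (split i) => [i'|l] /=; rewrite ?col_mxEu ?col_mxEd.
    rewrite -[i']splitK; case: (split i') => [r|i0] /=; rewrite ?col_mxEu ?col_mxEd mxE.
      by rewrite fC.
    by rewrite fT.
  by rewrite fE // mxE.
have kerE (y1 : 'rV_R) (y2 : 'rV_n0) (y3 : 'rV_n1) : (row_mx (row_mx y1 y2) y3 <= Km)%MS <->
    (y1 *m KR (fread s 2) + y2 *m Tmx + y3 *m E)%R = 0%R.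
  rewrite ker BE !mul_row_col; split=> [h|-> j _]; last by rewrite mxE.
  by apply/rowP => j; rewrite h ?mxE.
(* The system was built from the current rows, while V is defined by the initial ones; the two spans
   agree. *)
have VE : (Tmx + KR x0 :=: Tmx + KR (fread s 2))%MS.
  apply/eqmxP; case: inv => _ _ _ h4 h5 _ _.
  by rewrite !addsmx_sub !addsmxSl h5 /= (submx_trans h4) // addsmxSr.
pose a_ i l := fread s2 5 (i * k2 + (R + n0 + l)).
(* For a kernel row (y1, y2, y3) the tensor y3 x b is minus a combination of the current rows and of
   T_(0), so it lies in V. *)
have a_sub (i : 'I_k2) : (slab (a_ i) be <= Tmx + KR x0)%MS.
  have : (row i Km <= Km)%MS by apply: row_sub.
  rewrite -[row i Km]hsubmxK -[lsubmx _]hsubmxK => /kerE /eqP.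
  rewrite addr_eq0 => /eqP h; rewrite VE slabE -/E.
  have -> : (\row_l a_ i l)%R = rsubmx (row i Km).
    by apply/rowP => l; rewrite !mxE.
  rewrite -[X in (X <= _)%MS]opprK -h -[(- _)%R]scaleN1r scalemx_sub //.
  by rewrite addrC addmx_sub_adds ?submxMl.
have xlo x : x < R * S1 -> fread s2 2 x = fread s 2 x.
  by move=> xR; rewrite ag2.2 // x1 leqNgt xR.
have tl2 : cand_tail (fread s2 2) =1 be.
  apply: cand_tail_eq => p /andP[pn _].
  by rewrite ag2.2 // x1 ltn_add2l [p < _]ltnNge pn andbF.
have inv1 : search_inv x0 s1.
  by apply: (search_inv_agree inv ag1) => // x xR; rewrite x1 leqNgt xR.
have inv2 : search_inv x0 s2.
  by apply: (search_inv_agree inv1 ag2) => // x xR; rewrite ag2.2.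
pose Inv j s' := [/\ search_inv x0 s', (KR (fread s 2) <= KR (fread s' 2))%MS,
  cand_tail (fread s' 2) =1 be & forall i, i < j -> (slab (a_ i) be <= KR (fread s' 2))%MS].
apply: wp_call.
  apply: (wp_for (n := k2) (Inv := Inv) L_gt0 LB qB hs2) => //=.
  - by rewrite !(envE he2).
  - by apply: leq_trans kkL; rewrite leq_pmulr.
  - move=> j t1 t2 ag [h1 h2 h3 h4].
    have tE x : fread t2 2 x = fread t1 2 x by rewrite ag.2.
    have KE : KR (fread t2 2) = KR (fread t1 2) by apply: KR_eq.
    split; rewrite ?KE //; first by apply: (search_inv_agree h1 ag).
    by move=> c; rewrite -h3; apply: cand_tail_eq.
  - by split=> //; rewrite (KR_eq xlo).
  move=> j s3 jk hs3 ag3 ij [h1 h2 h3 h4].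
  have he3 : env s3 by apply: (env_agree he2 ag3).
  have sE : slab (a_ j) (cand_tail (fread s3 2)) = slab (a_ j) be by apply: slab_eq.
  apply: wp_call.
    apply: (wp_step_try (a := a_ j) hs3 he3 h1); first by rewrite ij.
      by move=> l ln; rewrite ij ag3.2.
    by rewrite sE; apply: (a_sub (Ordinal jk)).
  move=> s4 hs4 ag4 [g1 g2 g3 g4]; split=> //.
  - exact: submx_trans g2.
  - by move=> c; rewrite -h3; apply: cand_tail_eq.
  move=> i; rewrite ltnS leq_eqVlt => /predU1P[->|ij']; first by rewrite -sE.
  by apply: submx_trans (h4 i ij') g2.
move=> s3 hs3 ag3 [h1 h2 h3 h4]; split=> // a; rewrite -/be VE => /sub_addsmxP[[u v] /= aE].
(* Conversely, a x b in V gives the kernel vector (-v, -u, a). Thus [a] is a combination of the last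
   blocks of the rows of [Km], and each of those was tried. *)
have : (row_mx (row_mx (- v) (- u)) (\row_l a l) <= Km)%MS.
  by apply/kerE; rewrite -slabE aE !mulNmx -opprD [X in (- X)%R]addrC addNr.
case/submxP=> z zE.
pose Am : 'M[F]_(k2, n1) := (\matrix_(i, l) a_ i l)%R.
have -> : slab a be = (z *m (Am *m E))%R.
  rewrite slabE -/E mulmxA; congr (_ *m _)%R.
  rewrite -[LHS](row_mxKr (row_mx (- v) (- u))) zE; apply/rowP => l.
  by rewrite !mxE; apply: eq_bigr => i _; rewrite !mxE.
apply: mulmx_sub; apply/row_subP => i; rewrite row_mul.
have -> : row i Am = (\row_l a_ i l)%R by apply/rowP => l; rewrite !mxE.
by rewrite -slabE h4.
Qed.

(** * Guessing the tails *)

Definition elt i j : F := nth 0%R (enum F) (i %/ #|F| ^ j %% #|F|).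

Lemma elt_onto k (y : nat -> F) : exists2 i, i < #|F| ^ k & forall j, j < k -> elt i j = y j.
Proof.
have q0 : 0 < #|F| by apply/card_gt0P; exists 0%R.
elim: k y => [|k IH] y; first by exists 0; rewrite ?expn0.
have [i ik hi] := IH (fun j => y j.+1).
have yq : index (y 0) (enum F) < #|F| by rewrite cardE index_mem mem_enum.
exists (i * #|F| + index (y 0) (enum F)); first by rewrite expnSr flat_lt.
case=> [|j] jk; rewrite /elt.
  by rewrite expn0 divn1 modnMDl modn_small // nth_index // mem_enum.
by rewrite expnS divnMA divnMDl // (divn_small yq) addn0; apply: hi.
Qed.

Lemma wp_fill_elt i e base n b s c v : safe s -> env s -> neval s e = n ->
  neval s base = b -> b + n <= L -> n <= E1 + R + S2 ->
  all (fun x => x \notin [:: 17]) (nreads e ++ nreads base) ->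
  i < NA -> c != 17 -> nread s c 0 = v ->
  wp (Fill 17 e i base Skip (FElt ((V c /' vpow (V 17)) %' vq)))
    (fun s' => forall x, fread s' i x = if b <= x < b + n then elt v (x - b) else fread s i x) s.
Proof.
move=> hs he hn hb bL nE nr iNA c17 hv.
apply: (wp_fill (n := n) (b := b) (g := elt v) L_gt0 LB qB hs) => //=.
move=> j s1 jn hs1 ag1 ij _; apply: (wp_skip qB) => //=.
have hc : nread s1 c 0 = v by rewrite ag1.1 ?inE.
have -> : nread s1 22 (nread s1 17 0) = #|F| ^ j.
  by rewrite ag1.1 // ij (env_pow he) //; apply: leq_trans (ltnW jn) nE.
by rewrite hc ag1.1 // (env_q he).
Qed.

Definition combination (x0 : nat -> F) i c : F :=
  (\sum_(0 <= j < n0) elt i j * T (j * m + c)%N +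
   \sum_(0 <= r < R - n0) elt i (n0 + r)%N * outr (fun p => x0 (r * S1 + p)%N) c)%R.

(* What the i-th guess b for the factors of axes >= 2 is known to satisfy. *)
Definition guess_spec (x0 : nat -> F) i (b : nat -> F) : Prop :=
  if R <= S2 then
    (exists2 c, c < m & combination x0 i c != 0%R) ->
    exists cs, [/\ cs < m, combination x0 i cs != 0%R & forall d k, 1 < d < D -> k < N d ->
      b (off d + k) = combination x0 i (cs - dig d cs * str d + k * str d)]
  else forall p, p < S2 -> b (n1 + p) = elt i p.

(** For large R the tail of the tensor is guessed verbatim. Otherwise the tensor is a combination of
    R generators of V; guessing the coefficients determines the tensor, whose slices through a
    nonzero entry give the tail up to scalars that [a] absorbs. *)
Lemma guess_complete x0 x :
  (forall p, (R - n0) * S1 <= p < R * S1 -> x0 p = 0%R) ->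
  ((\row_(c < m) outr x c)%R <= Tmx + KR x0)%MS ->
  exists2 i, i < #|F| ^ E2 & forall b, guess_spec x0 i b ->
    exists a, (\row_(c < m) outr x c)%R = slab a (outer_tail D N b).
Proof.
move=> hx0 /sub_addsmxP[[u v] /= xE]; rewrite /guess_spec; have [RS|RS] := leqP R S2; last first.
  have [i iq hi] := elt_onto S2 (fun p => x (n1 + p)).
  exists i => //.
  move=> b hb; exists x; apply/rowP => c; rewrite !mxE outer_split //; congr (_ * _)%R.
  apply: (eq_outer_tail N_gt0) => d k dD kN.
  have /andP[d1 dD'] := dD.
  have nd : n1 <= off d by have := offset_le N (isT : 0 < 2) d1; rewrite {1}/offset big_nat1.
  have kS : off d + k < S1.
    apply: leq_trans (offset_le N (isT : 0 < d.+1) dD').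
    by rewrite offset_rec ?ltn_add2l // ltnW.
  have {1 2}-> : off d + k = n1 + (off d + k - n1) by rewrite subnKC // (leq_trans nd) ?leq_addr.
  have h : off d + k - n1 < S2 by rewrite ltn_sub2r // (leq_ltn_trans _ kS) // (leq_trans nd) ?leq_addr.
  by rewrite hb // hi.
(* The coefficients are [u] on the rows of T_(0), followed by [v] on the guessed rows. The remaining
   rows of [x0] vanish and need none. *)
pose y j : F := if insub j is Some j' then u ord0 j'
  else if insub (j - n0) is Some r then v ord0 r else 0%R.
have [i iq hi] := elt_onto R y.
exists i => //.
have n0_gt0 : 0 < n0 by apply: N_gt0; lia.
have cE c : c < m -> combination x0 i c = outr x c.
  move=> cm; have := congr1 (fun M : 'rV_m => M ord0 (Ordinal cm)) xE; rewrite !mxE /= => ->.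
  rewrite /combination; congr (_ + _)%R.
    rewrite big_mkord; apply: eq_bigr => j _; rewrite hi; last by apply: leq_trans n0R.
    by rewrite /y valK !mxE.
  rewrite (bigID (fun r : 'I_R => r < R - n0)) /= [X in _ = (_ + X)%R]big1 ?addr0; last first.
    move=> r; rewrite -leqNgt => hr; rewrite !mxE (outer0 N_gt0) ?mulr0 // => p pS.
    by rewrite hx0 // flat_lt // andbT (leq_trans _ (leq_addr _ _)) // leq_mul2r hr orbT.
  rewrite big_mkord (big_ord_widen_cond R (fun=> true)
    (fun r => elt i (n0 + r)%N * outr (fun p => x0 (r * S1 + p)%N) c)%R) ?leq_subr //.
  apply: eq_bigr => r /= hr; rewrite !mxE hi; last by lia.
  by rewrite /y insubF ?addKn ?valK //; apply: negbTE; rewrite -leqNgt leq_addr.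
move=> b hb; have [nz|z] := boolP [exists c : 'I_m, outr x c != 0%R]; last first.
  (* The zero tensor has no nonzero entry to slice through, but it is a x b with a = 0, whatever [b]
     is. *)
  exists (fun=> 0%R); apply/rowP => c; rewrite !mxE mul0r.
  by apply/eqP; apply: contraNT z => nz; apply/existsP; exists c.
have [|cs [csm csnz hcs]] := hb.
  by case/existsP: nz => c nz; exists c => //; rewrite cE.
rewrite cE // in csnz.
have [|a ha] := @outer_slices D N N_gt0 F x b cs D_gt1 csm csnz.
  move=> d k dD kN; rewrite hcs // cE //.
  have d0 : 0 < d < D by lia.
  rewrite -{1}(undigits_digit N_gt0 csm) -(undigits_set N (dig^~ cs) k d0).
  apply: (undigits_lt N_gt0); first by lia.
  move=> e /andP[_ eD]; case: eqP => [->|_] //; exact: digit_lt.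
by exists a; apply/rowP => c; rewrite !mxE ha.
Qed.

Lemma wp_guess_combination x0 s : safe s -> env s -> search_inv x0 s -> R <= S2 ->
  wp GuessCombination (fun s' =>
    (forall x, x < R * S1 -> fread s' 2 x = fread s 2 x) /\
    guess_spec x0 (nread s 12 0) (fun p => fread s' 2 (R * S1 + p))) s.
Proof.
move=> hs he inv RS; set N2 := nread s 12 0.
have RSL' : R * S1 + S1 <= L by rewrite addnC -mulSn.
have mL : m <= L by apply: leq_trans kmL; rewrite leq_pmull // -addnA addn_gt0 R_gt0.
have RL : R <= L by apply: leq_trans R1_sq; rewrite mulSn (leq_trans (leqnSn R)) // leq_addr.
apply: wp_seq (wp_fill_outer hs he) _ => s1 hs1 ag1 f1.
have he1 : env s1 by apply: (env_agree he ag1).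
apply: wp_seq.
  apply: (wp_fill_elt (n := R) (b := 0) (v := N2) hs1 he1) => //=.
  - by rewrite (envE he1).
  - by rewrite addnAC leq_addl.
  by rewrite ag1.1.
move=> s2 hs2 ag2 f2.
have he2 : env s2 by apply: (env_agree he1 ag2).
have f2' j : j < R -> fread s2 9 j = elt N2 j by move=> jR; rewrite f2 jR subn0.
have B2 r c : r < R -> c < m -> fread s2 3 (r * m + c) = outr (fun p => fread s 2 (r * S1 + p)) c.
  by move=> rR cm; rewrite ag2.2 // (fill_outer_row f1 (ltnW rR) cm).
apply: wp_seq.
  apply: (wp_fill (n := m) (b := 0) (g := combination x0 N2) L_gt0 LB qB hs2) => //=.
    by rewrite (envE he2).
  move=> c s3 cm hs3 ag3 ic _.
  have he3 : env s3 by apply: (env_agree he2 ag3).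
  pose G j : F := (\sum_(0 <= l < j) elt N2 l * T (l * m + c)%N)%R.
  apply: wp_seq.
    apply: (wp_acc (n := n0) (G := G) L_gt0 LB qB hs3) => //=.
    - by rewrite (envE he3).
    - by apply: leq_trans RL.
    - by rewrite /G big_geq.
    move=> j s4 jn hs4 ag4 ij acc; apply: (wp_skip qB) => //=.
    have he4 : env s4 by apply: (env_agree he3 ag4).
    rewrite acc /G [RHS]big_nat_recr //= !(envE he4) ij; congr (_ + _ * _)%R.
      by rewrite ag4.2 // ag3.2 // f2' //; apply: leq_trans n0R.
    by rewrite (ag4.1 17) // ic.
  move=> s4 hs4 ag4 f4.
  have he4 : env s4 by apply: (env_agree he3 ag4).
  pose H j : F := (G n0 + \sum_(0 <= r < j) elt N2 (n0 + r)%N *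
    outr (fun p => x0 (r * S1 + p)%N) c)%R.
  have -> : combination x0 N2 c = H (R - n0) by [].
  apply: (wp_acc (n := R - n0) (G := H) L_gt0 LB qB hs4) => //=.
  - by rewrite !(envE he4).
  - by apply: leq_trans RL; rewrite leq_subr.
  - by rewrite f4 /H big_geq // addr0.
  move=> j s5 jn hs5 ag5 ij acc; apply: (wp_skip qB) => //=.
  have he5 : env s5 by apply: (env_agree he4 ag5).
  have jR : n0 + j < R by lia.
  have jR' : j < R by lia.
  rewrite acc /H [in RHS]big_nat_recr //= addrA !(envE he5) ij; congr (_ + _ * _)%R.
    by rewrite ag5.2 // ag4.2 // ag3.2 // f2'.
  rewrite (ag5.1 17) // (ag4.1 17) // ic ag5.2 // ag4.2 // ag3.2 // B2 //.
  apply: (eq_outer N_gt0) => p pS; apply: (si_rows inv).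
  exact: flat_lt.
move=> s3 hs3 ag3 /= f3.
have he3 : env s3 by apply: (env_agree he2 ag3).
have f3' c : c < m -> fread s3 10 c = combination x0 N2 c.
  by move=> cm; rewrite f3 cm subn0.
apply: wp_seq.
  apply: (wp_search (n := m) (g := combination x0 N2) L_gt0 LB qB hs3) => //=.
  - by rewrite (envE he3).
  - exact: m_gt0.
  by move=> c s4 cm hs4 ag4 ic; rewrite ic ag4.2 // f3'.
move=> s4 hs4 ag4 /=; set cs := nread s4 15 0 => -[csm hcs].
have he4 : env s4 by apply: (env_agree he3 ag4).
have f4 c : c < m -> fread s4 10 c = combination x0 N2 c.
  by move=> cm; rewrite ag4.2 // f3'.
have x4 x : fread s4 2 x = fread s 2 x.
  by rewrite ag4.2 // ag3.2 // ag2.2 // ag1.2.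
have set_lt d k : 1 < d < D -> k < N d -> cs - dig d cs * str d + k * str d < m.
  move=> dD kN; have d0 : 0 < d < D by lia.
  rewrite -{1}(undigits_digit N_gt0 csm) -(undigits_set N (dig^~ cs) k d0).
  apply: (undigits_lt N_gt0); first by lia.
  move=> e /andP[_ eD]; case: eqP => [->|_] //.
  exact: digit_lt.
pose slice d k := combination x0 N2 (cs - dig d cs * str d + k * str d).
pose Inv j s' := (forall x, x < R * S1 -> fread s' 2 x = fread s 2 x) /\
  forall d k, 1 < d < j.+2 -> k < N d -> fread s' 2 (R * S1 + off d + k) = slice d k.
apply: wp_call.
  apply: (wp_for (n := D - 2) (Inv := Inv) L_gt0 LB qB hs4) => //=.
  - by rewrite (envE he4).
  - by apply: leq_trans DL; lia.
  - by move=> j t1 t2 [_ ag] [h1 h2]; split=> [x|d k dj kN]; rewrite ag //; auto.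
  - by split=> [x _|d k]; [rewrite x4|lia].
  move=> j s5 jD hs5 ag5 ij [h1 h2].
  have he5 : env s5 by apply: (env_agree he4 ag5).
  have dD : 0 < j.+2 < D by lia.
  have dD' : j.+2 < D by lia.
  have offS : off j.+2 + N j.+2 <= S1.
    by rewrite -offset_rec //; apply: offset_le.
  apply: wp_call.
    apply: (wp_fill (n := N j.+2) (b := R * S1 + off j.+2) (g := slice j.+2) L_gt0 LB qB hs5) => //=.
    - by rewrite ij addn2 (env_N he5).
    - by rewrite !(envE he5) ij addn2 (env_off he5).
    - by rewrite -addnA; apply: leq_trans RSL'; rewrite leq_add2l.
    move=> k s6 kN hs6 ag6 ik _; apply: (wp_skip qB) => //=.
    have he6 : env s6 by apply: (env_agree he5 ag6).
    have j6 : nread s6 18 0 = j by rewrite ag6.1.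
    have c6 : nread s6 15 0 = cs by rewrite ag6.1 // ag5.1.
    rewrite ik j6 c6 addn2 (env_str he6) // (env_N he6) // ag6.2 // ag5.2 //.
    by apply: f4; apply: set_lt.
  move=> s6 hs6 ag6 f6; split.
    move=> x xR; rewrite f6 ifF ?h1 //; apply/negbTE.
    by rewrite negb_and -ltnNge (leq_trans xR) // leq_addr.
  move=> d k /andP[d1 dj]; rewrite f6; case: (eqVneq d j.+2) => [->|dj'] kN.
    by rewrite leq_addr ltn_add2l kN addKn.
  have dj2 : d < j.+2 by rewrite ltn_neqAle dj' -ltnS.
  rewrite ifF ?h2 ?d1 //; apply/negbTE; rewrite negb_and -ltnNge -addnA ltn_add2l.
  apply/orP; left; apply: leq_trans (offset_le N (isT : 0 < d.+1) dj2).
  by rewrite offset_rec ?ltn_add2l // ltnW.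
move=> s5 hs5 ag5 [h1 h2]; split=> //; rewrite /guess_spec RS => -[c cm nz].
exists cs; split=> //; first exact: hcs nz.
move=> d k dD kN; rewrite addnA h2 //.
by move: dD; lia.
Qed.

Lemma wp_guess x0 s : safe s -> env s -> search_inv x0 s ->
  wp Guess (fun s' => [/\ search_inv x0 s', KR (fread s' 2) = KR (fread s 2) &
    guess_spec x0 (nread s 12 0) (fun p => fread s' 2 (R * S1 + p))]) s.
Proof.
move=> hs he inv.
have inv' s' nm fm : agree nm fm s s' -> 10 \notin nm ->
    (forall x, x < R * S1 -> fread s' 2 x = fread s 2 x) ->
    search_inv x0 s' /\ KR (fread s' 2) = KR (fread s 2).
  by move=> ag h10 hx; split; [apply: (search_inv_agree inv ag)|apply: KR_eq].
apply: (wp_if L_gt0 LB qB) => //=; rewrite !(envE he) => RS.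
  apply: (wp_call (wp_guess_combination hs he inv RS)) => s' _ ag [h1 h2].
  by have [] := inv' s' _ _ ag isT h1.
have n1S := n1_le.
have S1E : n1 + S2 = S1 by rewrite subnKC.
apply: wp_call.
  apply: (wp_fill_elt (n := S2) (b := R * S1 + n1) (v := nread s 12 0) hs he) => //=.
  - by rewrite (envE he).
  - by rewrite !(envE he).
  - by rewrite -addnA S1E addnC -mulSn.
  by rewrite leq_addl.
move=> s' _ ag f; have xlo x : x < R * S1 -> fread s' 2 x = fread s 2 x.
  move=> xR; rewrite f ifF //; apply/negbTE.
  by rewrite negb_and -ltnNge (leq_trans xR) // leq_addr.
have [h1 h2] := inv' s' _ _ ag isT xlo; split=> //.
rewrite /guess_spec (negbTE RS) => p pS.
by rewrite addnA f leq_addr ltn_add2l pS addKn.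
Qed.

(** * Decoding an outer guess and solving for A_0 *)

Definition start_rows i x0 :=
  forall x, x < R.+1 * S1 -> x0 x = if x < E1 then elt i x else 0%R.

Lemma wp_decode s : safe s -> env s ->
  wp Decode (fun s' => search_inv (fread s' 2) s' /\ start_rows (nread s 11 0) (fread s' 2)) s.
Proof.
move=> hs he; set N1 := nread s 11 0.
have RL : R < 2 ^ B.
  apply: leq_ltn_trans LB; apply: leq_trans R1_sq.
  by rewrite mulSn (leq_trans (leqnSn R)) // leq_addr.
apply: wp_seq.
  apply: (wp_fill (n := R.+1 * S1) (b := 0)
    (g := fun x => if x < E1 then elt N1 x else 0%R) L_gt0 LB qB hs) => //=.
    by rewrite !(envE he) addn1.
  move=> j s1 jn hs1 ag1 ij _.
  have he1 : env s1 by apply: (env_agree he ag1).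
  apply: (wp_if L_gt0 LB qB) => //=; rewrite ij addn1 (envE he1) => hj;
    apply: (wp_fset L_gt0 LB qB) => //=; rewrite fread_fupd /=; last by rewrite (negbTE hj).
  rewrite hj ij (env_pow he1) ?(envE he1) ?ag1.1 //.
  by rewrite -addnA (leq_trans (ltnW hj)) // leq_addr.
move=> s1 hs1 ag1 f1.
have he1 : env s1 by apply: (env_agree he ag1).
apply: (wp_set L_gt0 LB qB) => //=; rewrite !(envE he1).
  by apply: leq_ltn_trans RL; rewrite leq_subr.
set s2 := nupd _ _ _ _.
have x2 x : fread s2 2 x = fread s1 2 x by [].
have c2 : nread s2 10 0 = R - n0 by rewrite nread_nupd.
have st : start_rows N1 (fread s2 2) by move=> x xR; rewrite x2 f1 xR subn0.
split=> //; split; rewrite ?c2 ?leq_subr ?subnn ?addn0 //.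
  move=> x /andP[x1 x3]; rewrite st; first by rewrite ltnNge x1.
  by apply: leq_trans x3 _; rewrite leq_mul2r leqnSn orbT.
exact: addsmxSr.
Qed.

Definition row_ok (x out : nat -> F) i := forall c, c < m ->
  T (i * m + c) = (\sum_(r < R) out (i * R + r)%N * outr (fun p => x (r * S1 + p)%N) c)%R.

Lemma wp_solve_row s i : safe s -> env s -> i < n0 -> nread s 21 0 = i ->
  wp SolveRow (fun s' =>
    (nread s' 16 0 = nread s 16 0 /\ row_ok (fread s 2) (fread s' 1) i /\
     forall y, y < i * R -> fread s' 1 y = fread s 1 y) \/
    (nread s' 16 0 = 0 /\ ~~ (Tmx <= KR (fread s 2))%MS)) s.
Proof.
move=> hs he i0 hi.
have outL' : (i + 1) * R <= L.
  by apply: leq_trans outL; rewrite leq_mul2r addn1 (leq_trans i0) ?leq_addr ?orbT.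
apply: wp_seq (wp_fill_outer hs he) _ => s1 hs1 ag1 f1.
have he1 : env s1 by apply: (env_agree he ag1).
apply: wp_seq.
  apply: (wp_fill (n := m) (b := R * m) (g := fun c => T (i * m + c)) L_gt0 LB qB hs1) => //=.
  - by rewrite !(envE he1).
  - by rewrite !(envE he1).
  - apply: leq_trans kmL; rewrite addnC -mulSn leq_mul2r -addnA -addn1 leq_add2l.
    by rewrite addn_gt0 n1_gt0 !orbT.
  move=> c s2 cm hs2 ag2 ic _; apply: (wp_skip qB) => //=.
  by rewrite (ag2.1 21) // (ag1.1 21) // hi ic !(envE (env_agree he1 ag2 isT isT)).
move=> s2 hs2 ag2 f2.
have he2 : env s2 by apply: (env_agree he1 ag2).
have C2 : rmx R m (fread s2 3) = KR (fread s 2).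
  apply/matrixP => r c; rewrite rmxE mxE f2 ifF; last first.
    by apply/negbTE; rewrite negb_and -ltnNge flat_lt.
  by rewrite (fill_outer_row f1 (ltnW (ltn_ord r))).
have T2 : (\row_(c < m) fread s2 3 (R * m + c)%N)%R = row (Ordinal i0) Tmx.
  by apply/rowP => c; rewrite !mxE f2 leq_addr ltn_add2l ltn_ord addKn.
apply: wp_seq (wp_relation hs2 he2) _ => s3 hs3 ag3 /=; rewrite C2 T2.
have he3 : env s3 by apply: (env_agree he2 ag3).
have k3 : nread s3 16 0 = nread s 16 0 by rewrite ag3.1 // ag2.1 // ag1.1.
have i3 : nread s3 21 0 = i by rewrite ag3.1 // ag2.1 // ag1.1.
move=> rel; apply: (wp_if L_gt0 LB qB) => //=; rewrite (envE he3) addn1 => lc.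
  apply: (wp_set L_gt0 LB qB) => //=; first by rewrite expn_gt0.
  right; split; first by rewrite nread_nupd.
  by move: rel; rewrite lc; apply: contra; apply: submx_trans; apply: row_sub.
rewrite (negPf lc) in rel.
set p := nread s3 14 0 in lc rel.
pose A r : F := (- fread s3 4 (p * R.+1 + r)%N * (fread s3 4 (p * R.+1 + R)%N)^-1)%R.
apply: wp_call.
  apply: (wp_fill (n := R) (b := i * R) (g := A) L_gt0 LB qB hs3) => //=.
  - by rewrite (envE he3).
  - by rewrite i3 (envE he3).
  - by rewrite -{2}[R]mul1n -mulnDl.
  move=> r s4 rR hs4 ag4 ir _; apply: (wp_skip qB) => //=.
  have he4 : env s4 by apply: (env_agree he3 ag4).
  by rewrite ir (envE he4) (ag4.1 14) // addn1 !ag4.2.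
move=> s4 hs4 ag4 f4; left; split; first by rewrite ag4.1.
have x4 x : fread s4 2 x = fread s 2 x.
  by rewrite ag4.2 // ag3.2 // ag2.2 // ag1.2.
split; last first.
  move=> y yi; rewrite f4 ifF; first by rewrite ag3.2 // ag2.2 // ag1.2.
  by apply/negbTE; rewrite negb_and -ltnNge yi.
move=> c cm; have /rowP/(_ (Ordinal cm)) := rel; rewrite !mxE /= => ->.
apply: eq_bigr => r _; rewrite !mxE; congr (_ * _)%R.
by rewrite f4 leq_addr ltn_add2l ltn_ord addKn.
Qed.

Definition good_out (out : nat -> F) := forall i c, i < n0 -> c < m ->
  T (i * m + c) =
  (\sum_(r < R) out (i * R + r)%N * outr (fun p => out ((n0 + p) * R + r)%N) c)%R.

Lemma wp_solve s : safe s -> env s ->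
  wp Solve (fun s' => (nread s' 1 0 = 1 /\ good_out (fread s' 1)) \/
    (nread s' 1 0 = nread s 1 0 /\ ~~ (Tmx <= KR (fread s 2))%MS)) s.
Proof.
move=> hs he.
have B1 : 1 < 2 ^ B by apply: leq_trans LB; rewrite ltnS.
have n0_gt0 : 0 < n0 by apply: N_gt0; lia.
apply: (@wp_seq _ _ _ _ _ _ (fun s1 => nread s1 16 0 = 1)).
  by apply: (wp_set L_gt0 LB qB) => //=; rewrite nread_nupd.
move=> s1 hs1 ag1 k1.
have he1 : env s1 by apply: (env_agree he ag1).
pose Inv j (s' : state F) :=
  (nread s' 16 0 = 1 /\ forall i, i < j -> row_ok (fread s 2) (fread s' 1) i) \/
  (nread s' 16 0 = 0 /\ ~~ (Tmx <= KR (fread s 2))%MS).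
apply: wp_seq.
  apply: (wp_for (n := n0) (Inv := Inv) L_gt0 LB qB hs1) => //=.
  - by rewrite (envE he1).
  - apply: leq_trans outL; rewrite mulnDl; apply: leq_trans (leq_addr _ _).
    by rewrite leq_pmulr // R_gt0.
  - move=> j t1 t2 [agn agf] [[h1 h2]|[h1 h2]]; [left|right]; rewrite agn //; split=> //.
    by move=> i ij c cm; rewrite (h2 i ij c cm); apply: eq_bigr => r _; rewrite agf.
  - by left; split.
  move=> j s2 jn hs2 ag2 ij inv.
  have he2 : env s2 by apply: (env_agree he1 ag2).
  have x2 x : fread s2 2 x = fread s 2 x by rewrite ag2.2 // ag1.2.
  have K2 : KR (fread s2 2) = KR (fread s 2) by apply: KR_eq.
  apply: (wp_call (wp_solve_row hs2 he2 jn ij)) => s3 hs3 ag3.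
  rewrite K2 => -[[k3 [ok3 lo3]]|[k3 h3]]; last by right.
  case: inv => [[k2' h2]|[k2' h2]]; [left|right]; rewrite k3; split=> // i.
  rewrite ltnS leq_eqVlt => /predU1P[->|ij'] c cm.
    rewrite ok3 //; apply: eq_bigr => r _; congr (_ * _)%R.
    by apply: (eq_outer N_gt0) => p pS; rewrite x2.
  rewrite (h2 i ij' c cm); apply: eq_bigr => r _; rewrite lo3 //.
  exact: flat_lt.
move=> s2 hs2 ag2 inv.
have he2 : env s2 by apply: (env_agree he1 ag2).
have x2 x : fread s2 2 x = fread s 2 x by rewrite ag2.2 // ag1.2.
apply: (wp_if L_gt0 LB qB) => //= k2'; last first.
  apply: (wp_skip qB) => //; right; rewrite ag2.1 // ag1.1 //; split=> //.
  by case: inv k2' => [[->]|[]].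
case: inv k2' => [[_ ok] _|[-> //]].
have R0 := R_gt0.
apply: wp_seq.
  apply: (wp_fill (n := S1 * R) (b := n0 * R) (g := fun x => fread s 2 (x %% R * S1 + x %/ R))
    L_gt0 LB qB hs2) => //=.
  - by rewrite !(envE he2).
  - by rewrite !(envE he2).
  - by rewrite -mulnDl.
  move=> j s3 jn hs3 ag3 ij _; apply: (wp_skip qB) => //=.
  have he3 : env s3 by apply: (env_agree he2 ag3).
  by rewrite ij !(envE he3) ag3.2.
move=> s3 hs3 ag3 f3; apply: (wp_set L_gt0 LB qB) => //=.
left; split; first by rewrite nread_nupd.
move=> i c i0 cm; rewrite (ok i i0 c cm); apply: eq_bigr => r _.
have lo y : y < n0 * R -> fread s3 1 y = fread s2 1 y.
  by move=> h; rewrite f3 ifF //; apply/negbTE; rewrite negb_and -ltnNge h.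
rewrite !fread_nupd lo; last exact: flat_lt.
congr (_ * _)%R; apply: (eq_outer N_gt0) => p pS.
rewrite fread_nupd f3 mulnDl -addnA leq_addr ltn_add2l flat_lt // addKn.
by rewrite divnMDl // modnMDl divn_small // modn_small // addn0.
Qed.

Lemma wp_inner x0 s : safe s -> env s -> search_inv x0 s ->
  wp Inner (fun s' => [/\ search_inv x0 s', (KR (fread s 2) <= KR (fread s' 2))%MS &
    exists2 b, guess_spec x0 (nread s 12 0) b &
      forall a, (slab a (outer_tail D N b) <= Tmx + KR x0)%MS ->
        (slab a (outer_tail D N b) <= KR (fread s' 2))%MS]) s.
Proof.
move=> hs he inv; apply: wp_seq (wp_guess hs he inv) _ => s1 hs1 ag1 [inv1 KE gs].
have he1 : env s1 by apply: (env_agree he ag1).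
apply: (wp_call (wp_step hs1 he1 inv1)) => s2 _ _ [inv2 K2 sl]; split=> //.
  by rewrite -KE.
by exists (fun p => fread s1 2 (R * S1 + p)).
Qed.

(** * Exhaustiveness of the guesses *)

Definition outer_mx (xs : 'I_R -> nat -> F) : 'M[F]_(R, m) :=
  (\matrix_(r < R, c < m) outr (xs r) c)%R.

(** Failure expressed without the machine: no R rank one tensors span a space between T_(0) and the
    V of guess [i]. It is stated for every [x0] that decodes [i], since the guess fixes only
    finitely many cells. *)
Definition start_fails i := forall x0, start_rows i x0 ->
  ~ exists xs, (Tmx <= outer_mx xs)%MS /\ (outer_mx xs <= Tmx + KR x0)%MS.

Definition attempt_weight := bweight (BLe (V 1) 0) +
  (tweight L Decode + (5 + (#|F| ^ E2).+1 * (26 + nweight vQ2 + tweight L Inner) +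
   tweight L Solve)).

Lemma expn_lt e : e <= E1 + R + S2 -> #|F| ^ e < 2 ^ B.
Proof.
move=> he; apply: leq_ltn_trans powB; rewrite leq_pexp2l ?(leq_trans he) ?leq_addr //.
by apply/card_gt0P; exists 0%R.
Qed.

Lemma wp_attempt s : safe s -> env s ->
  nread s 1 0 = 0 \/ nread s 1 0 = 1 /\ good_out (fread s 1) ->
  wpN NA L B attempt_weight Attempt (fun s' =>
    nread s' 1 0 = 1 /\ good_out (fread s' 1) \/
    [/\ nread s 1 0 = 0, nread s' 1 0 = 0 & start_fails (nread s 11 0)]) s.
Proof.
move=> hs he hflag; apply: (wpN_if L_gt0 LB qB) => //=.
case: hflag => [fl|[fl go]]; last first.
  apply: (@wpN_le _ _ _ _ 1); last by rewrite fl; apply: (wp_skip qB) => //; left.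
  by rewrite addnA addnCA leq_addr.
rewrite fl /=; set i := nread s 11 0.
apply: wpN_seq (wp_decode hs he) _ => s1 hs1 ag1 [inv1 st1].
have he1 : env s1 by apply: (env_agree he ag1).
set x0 := fread s1 2 in inv1 st1.
pose Inv j s' := search_inv x0 s' /\ forall l, l < j -> exists2 b, guess_spec x0 l b &
  forall a, (slab a (outer_tail D N b) <= Tmx + KR x0)%MS ->
    (slab a (outer_tail D N b) <= KR (fread s' 2))%MS.
have q2 : #|F| ^ E2 < 2 ^ B by apply: expn_lt; apply: leq_trans (geq_minl _ _) _; rewrite addnAC leq_addl.
apply: wpN_seq.
  apply: (wpN_for (n := #|F| ^ E2) (N := tweight L Inner) (Inv := Inv) L_gt0 LB qB hs1) => //=.
  - by rewrite (envE he1).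
  - move=> j t1 t2 ag [h1 h2].
    have KE : KR (fread t2 2) = KR (fread t1 2) by apply: KR_eq => p _; rewrite ag.2.
    split; first by apply: (search_inv_agree h1 ag) => // x _; rewrite ag.2.
    by move=> l lj; rewrite KE; apply: h2.
  move=> j s2 jn hs2 ag2 ij [h1 h2].
  have he2 : env s2 by apply: (env_agree he1 ag2).
  apply: (wp_call (wp_inner hs2 he2 h1)) => s3 hs3 ag3 [h3 h4 h5]; split=> // l.
  rewrite ltnS leq_eqVlt => /predU1P[->|lj]; first by rewrite -ij.
  have [b hb hb'] := h2 l lj; exists b => // a ha.
  by apply: submx_trans h4; apply: hb'.
move=> s2 hs2 ag2 [inv2 sl2].
have he2 : env s2 by apply: (env_agree he1 ag2).
apply: (wp_call (wp_solve hs2 he2)) => s3 hs3 ag3 [?|[f3 nT]]; first by left.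
right; split=> //; first by rewrite f3 ag2.1 // ag1.1.
move=> y0 sty [xs [TG GV]]; case/negP: nT; apply: submx_trans TG _.
have KE : KR y0 = KR x0.
  apply: KR_eq => p pR; have pR' : p < R.+1 * S1.
    by apply: leq_trans pR _; rewrite leq_mul2r leqnSn orbT.
  by rewrite sty // st1.
(* Each row of [outer_mx xs] is a rank one tensor of V. By [guess_complete] it is a x b for the tail
   b tried at some inner guess, and that iteration put it into the span. *)
apply/row_subP => r.
have rE : row r (outer_mx xs) = (\row_(c < m) outr (xs r) c)%R.
  by apply/rowP => c; rewrite !mxE.
have rV : (row r (outer_mx xs) <= Tmx + KR x0)%MS.
  by rewrite -KE; apply: submx_trans GV; apply: row_sub.
rewrite rE in rV *.
have [|l lq hl] := guess_complete _ rV.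
  move=> p /andP[p1 p2]; rewrite st1; first by rewrite ltnNge p1.
  by apply: leq_trans p2 _; rewrite leq_mul2r leqnSn orbT.
have [b hb hb'] := sl2 l lq; have [a aE] := hl b hb.
by rewrite aE in rV *; apply: hb'.
Qed.

(** A CPD whose [A] has rank n_0 selects R - n_0 of its rank one tensors through [complement_rows].
    The number [i] encoding them gives a V that contains all R tensors, so guess [i] cannot fail. *)
Lemma start_fails_no_cpd : (forall i, i < #|F| ^ E1 -> start_fails i) ->
  ~ exists (A : 'M[F]_(n0, R)) xs, (Tmx = A *m outer_mx xs)%R /\ \rank A = n0.
Proof.
move=> fails [A [xs [TE rA]]]; have [g hg] := complement_rows TE rA.
have S1_gt0 : 0 < S1 by apply: leq_trans n1_gt0 n1_le.
pose x x' := if insub (x' %/ S1) is Some r then xs (g r) (x' %% S1) else 0%R.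
have [i iq hi] := elt_onto E1 x.
apply: (fails i iq (fun x' => if x' < E1 then elt i x' else 0%R)) => //.
exists xs; split; first by rewrite TE submxMl.
apply: hg => r hr; apply/rowP => c; rewrite !mxE; apply: (eq_outer N_gt0) => p pS.
rewrite flat_lt // hi ?flat_lt // /x divnMDl // divn_small // addn0 valK.
by rewrite modnMDl modn_small.
Qed.

Definition search_weight :=
  5 + (#|F| ^ E1).+1 * (26 + nweight vQ1 + attempt_weight).

Lemma wp_search_loop s : safe s -> env s -> nread s 1 0 = 0 ->
  wpN NA L B search_weight (For 11 vQ1 Attempt) (fun s' =>
    nread s' 1 0 = 1 /\ good_out (fread s' 1) \/
    nread s' 1 0 = 0 /\ ~ exists (A : 'M[F]_(n0, R)) xs,
      (Tmx = A *m outer_mx xs)%R /\ \rank A = n0) s.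
Proof.
move=> hs he fl.
pose Inv j (s' : state F) := nread s' 1 0 = 1 /\ good_out (fread s' 1) \/
  nread s' 1 0 = 0 /\ forall i, i < j -> start_fails i.
have q1 : #|F| ^ E1 < 2 ^ B by apply: expn_lt; rewrite -addnA leq_addr.
apply: wpN_call.
  apply: (wpN_for (n := #|F| ^ E1) (N := attempt_weight) (Inv := Inv) L_gt0 LB qB hs) => //=.
  - by rewrite (envE he).
  - move=> j t1 t2 [agn agf] [[h1 h2]|[h1 h2]]; [left|right]; rewrite agn //; split=> //.
    move=> i c i0 cm; rewrite (h2 i c i0 cm); apply: eq_bigr => r _; rewrite agf //.
    by congr (_ * _)%R; apply: (eq_outer N_gt0) => p _; rewrite agf.
  - by right; split.
  move=> j s1 jn hs1 ag1 ij inv.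
  have he1 : env s1 by apply: (env_agree he ag1).
  have hflag : nread s1 1 0 = 0 \/ nread s1 1 0 = 1 /\ good_out (fread s1 1).
    by case: inv => [|[]]; [right|left].
  apply: (wpN_call (wp_attempt hs1 he1 hflag)) => s2 hs2 ag2 [?|[h1 h2 h3]]; first by left.
  right; split=> // i; rewrite ltnS leq_eqVlt => /predU1P[->|lj]; first by rewrite -ij.
  by case: inv => [[]|[_]]; [rewrite h1|apply].
move=> s1 hs1 ag1 [?|[h1 h2]]; [by left|right; split=> //].
exact: start_fails_no_cpd.
Qed.

(** * Precomputed tables *)

Definition loaded s := [/\ nread s 0 0 = D, nread s 0 1 = R, nread s 0 2 = #|F|,
  forall d, d < D -> nread s 0 (3 + d) = N d & forall x, fread s 0 x = T x].

Lemma loaded_agree nm fm s s' : loaded s -> agree nm fm s s' ->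
  0 \notin nm -> 0 \notin fm -> loaded s'.
Proof.
move=> [h1 h2 h3 h4 h5] [agn agf] n0' f0.
by split=> *; rewrite ?agn ?agf //; auto.
Qed.

Lemma wp_setup s : safe s -> loaded s -> wp Setup env s.
Proof.
move=> hs ld; have n0_gt0 : 0 < n0 by apply: N_gt0; lia.
have small x : x <= L -> x < 2 ^ B by move=> h; apply: leq_ltn_trans LB.
have LDN s' : loaded s' -> (nread s' 0 0 = D) * (nread s' 0 1 = R) * (nread s' 0 2 = #|F|).
  by case.
have LN s' d : loaded s' -> d < D -> nread s' 0 (3 + d) = N d by case=> _ _ _ h _; apply: h.
have n0mL : n0 * m <= L.
  by apply: leq_trans kmL; rewrite leq_mul2r addnAC leq_addl orbT.
have S1L : S1 <= L by apply: leq_trans RSL; rewrite mulSn leq_addr.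
have DL' : D <= L by apply: leq_trans DL; rewrite leq_addr.
apply: (@wp_seq _ _ _ _ _ _ (fun s1 => nread s1 25 0 = 1)).
  apply: (wp_set L_gt0 LB qB) => //=; first exact: small.
  by rewrite nread_nupd.
move=> s1 hs1 ag1 v1; have ld1 : loaded s1 by apply: (loaded_agree ld ag1).
(* [P j] is the content of scratch cell 25 after [j] rounds: strides are computed from the last axis
   backwards. The omitted dimensions are positive, so every [P j] is at most the number of entries
   of the tensor. *)
pose P j := \prod_(D - j <= e < D) N e.
have PS j : j < D -> P j.+1 = P j * N (D - 1 - j).
  move=> jD; rewrite /P big_ltn ?(subnSK jD) //; last by lia.
  by rewrite mulnC; congr (_ * N _); lia.
have PL j : j <= D -> P j <= L.
  move=> jD; apply: leq_trans n0mL.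
  have -> : n0 * m = (\prod_(0 <= e < D - j) N e) * P j.
    by rewrite -big_cat_nat ?leq_subr //= [RHS]big_ltn // ltnW.
  rewrite leq_pmull // big_nat_cond; apply: prodn_cond_gt0 => e.
  by rewrite andbT => /andP[_ he]; apply: N_gt0; lia.
have strP d : d < D -> str d = P (D - 1 - d).
  by move=> dD; rewrite /P /stride; congr (\prod_(_ <= _ < _) _); lia.
apply: wp_seq.
  apply: (wp_for (n := D) (Inv := fun j (s' : state F) => nread s' 25 0 = P j /\
    forall d, D - j <= d < D -> nread s' 3 d = str d) L_gt0 LB qB hs1) => //=.
  - by rewrite (LDN s1).
  - move=> j t1 t2 [agn _] [h1 h2]; split=> [|d dj]; rewrite agn //; exact: h2.
  - by split; [rewrite v1 /P subn0 big_geq|move=> d; lia].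
  move=> j s2 jD hs2 ag2 ij [h1 h2].
  have ld2 : loaded s2 by apply: (loaded_agree ld1 ag2).
  have jD' : D - 1 - j < D by lia.
  apply: (@wp_seq _ _ _ _ _ _ (fun s3 =>
      forall d, D - j.+1 <= d < D -> nread s3 3 d = str d)).
    apply: (wp_nwrite L_gt0 LB qB) => //=; rewrite ?(LDN s2) // ?ij ?h1.
    - by apply: leq_trans DL'; lia.
    - by apply: small; apply: PL; apply: ltnW.
    move=> d dj; rewrite nread_nupd /=; case: eqP => [->|nd]; last by apply: h2; lia.
    by rewrite strP //; congr P; lia.
  move=> s3 hs3 ag3 h3; have ld3 : loaded s3 by apply: (loaded_agree ld2 ag3).
  have e3 : nread s3 25 0 * nread s3 0 (3 + (nread s3 0 0 - 1 - nread s3 17 0)) = P j.+1.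
    by rewrite (ag3.1 25) // (ag3.1 17) // ij (LDN s3) // (LN s3) // h1 PS.
  apply: (wp_set L_gt0 LB qB) => //=; rewrite e3; first by apply: small; apply: PL.
  by split=> [|d hd]; rewrite nread_nupd //; apply: h3.
move=> s2 hs2 ag2 [_ h2]; have ld2 : loaded s2 by apply: (loaded_agree ld1 ag2).
have str2 d : d < D -> nread s2 3 d = str d by move=> dD; apply: h2; lia.
apply: (@wp_seq _ _ _ _ _ _ (fun s3 => nread s3 2 0 = m)).
  apply: (wp_set L_gt0 LB qB) => //=; rewrite str2 ?(ltnW D_gt1) //; last by rewrite nread_nupd.
  by apply: small; apply: leq_trans n0mL; rewrite leq_pmull.
move=> s3 hs3 ag3 m3; have ld3 : loaded s3 by apply: (loaded_agree ld2 ag3).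
apply: (@wp_seq _ _ _ _ _ _ (fun s4 => nread s4 25 0 = 0)).
  by apply: (wp_set L_gt0 LB qB) => //=; [apply: small|rewrite nread_nupd].
move=> s4 hs4 ag4 v4; have ld4 : loaded s4 by apply: (loaded_agree ld3 ag4).
have offL j : 0 < j -> j <= D -> off j <= L.
  by move=> j0 jD; apply: leq_trans S1L; apply: offset_le.
apply: wp_seq.
  apply: (wp_for (n := D - 1) (Inv := fun j (s' : state F) => nread s' 25 0 = off j.+1 /\
    forall d, 0 < d < j.+1 -> nread s' 4 d = off d) L_gt0 LB qB hs4) => //=.
  - by rewrite (LDN s4).
  - by apply: leq_trans DL'; rewrite leq_subr.
  - move=> j t1 t2 [agn _] [g1 g2]; split=> [|d dj]; rewrite agn //; exact: g2.
  - by split; [rewrite v4 /offset big_geq|move=> d; lia].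
  move=> j s5 jD hs5 ag5 ij [h5 h5'].
  have ld5 : loaded s5 by apply: (loaded_agree ld4 ag5).
  have jD' : j.+1 < D by lia.
  apply: (@wp_seq _ _ _ _ _ _ (fun s6 =>
      forall d, 0 < d < j.+2 -> nread s6 4 d = off d)).
    apply: (wp_nwrite L_gt0 LB qB) => //=; rewrite ?ij ?h5 ?addn1.
    - by apply: leq_trans DL'.
    - by apply: small; apply: offL => //; apply: ltnW.
    move=> d dj; rewrite nread_nupd /=; case: eqP => [-> //|nd]; apply: h5'; lia.
  move=> s6 hs6 ag6 h6; have ld6 : loaded s6 by apply: (loaded_agree ld5 ag6).
  have e6 : nread s6 25 0 + nread s6 0 (3 + (nread s6 17 0 + 1)) = off j.+2.
    by rewrite (ag6.1 25) // (ag6.1 17) // ij addn1 (LN s6) // h5 [RHS]offset_rec.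
  apply: (wp_set L_gt0 LB qB) => //=; rewrite e6; first by apply: small; apply: offL.
  by split=> [|d hd]; rewrite nread_nupd //; apply: h6.
move=> s5 hs5 ag5 [v5 h5]; have ld5 : loaded s5 by apply: (loaded_agree ld4 ag5).
rewrite subn1 prednK ?(ltnW D_gt1) // in v5 h5.
apply: (@wp_seq _ _ _ _ _ _ (fun s6 => nread s6 5 0 = S1)).
  by apply: (wp_set L_gt0 LB qB) => //=; rewrite v5 ?nread_nupd //; apply: small.
move=> s6 hs6 ag6 v6; have ld6 : loaded s6 by apply: (loaded_agree ld5 ag6).
apply: (@wp_seq _ _ _ _ _ _ (fun s7 => nread s7 6 0 = S2)).
  apply: (wp_set L_gt0 LB qB) => //=; rewrite ag6.1 // v5 (LN s6 1) ?nread_nupd //.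
  by apply: small; apply: leq_trans S1L; rewrite leq_subr.
move=> s7 hs7 ag7 v7; have ld7 : loaded s7 by apply: (loaded_agree ld6 ag7).
have E1L : E1 <= L by apply: leq_trans powL; rewrite -!addnA leq_addr.
apply: (@wp_seq _ _ _ _ _ _ (fun s8 => nread s8 9 0 = E1)).
  apply: (wp_set L_gt0 LB qB) => //=; rewrite (LDN s7) // (LN s7 0) ?(ltnW D_gt1) //;
    rewrite ag7.1 // v6 ?nread_nupd //; exact: small.
move=> s8 hs8 ag8 v8; have ld8 : loaded s8 by apply: (loaded_agree ld7 ag8).
apply: (@wp_seq _ _ _ _ _ _ (fun s9 => nread s9 25 0 = 1)).
  by apply: (wp_set L_gt0 LB qB) => //=; [apply: small|rewrite nread_nupd].
move=> s9 hs9 ag9 v9; have ld9 : loaded s9 by apply: (loaded_agree ld8 ag9).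
have e9 : nread s9 9 0 = E1 by rewrite ag9.1.
have s29 : nread s9 6 0 = S2 by rewrite ag9.1 // ag8.1.
have powB' j : j <= E1 + R + S2 + 1 -> #|F| ^ j < 2 ^ B.
  move=> hj; apply: leq_ltn_trans powB; rewrite leq_pexp2l //.
  by apply/card_gt0P; exists 0%R.
apply: wp_seq.
  apply: (wp_for (n := E1 + R + S2 + 1) (Inv := fun j (s' : state F) =>
    nread s' 25 0 = #|F| ^ j /\ forall i, i < j -> nread s' 22 i = #|F| ^ i)
    L_gt0 LB qB hs9) => //=.
  - by rewrite (LDN s9) // e9 s29.
  - move=> j t1 t2 [agn _] [g1 g2]; split=> [|i ij]; rewrite agn //; exact: g2.
  move=> j s10 jD hs10 ag10 ij [g1 g2].
  have ld10 : loaded s10 by apply: (loaded_agree ld9 ag10).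
  apply: (@wp_seq _ _ _ _ _ _ (fun s11 => forall i, i < j.+1 -> nread s11 22 i = #|F| ^ i)).
    apply: (wp_nwrite L_gt0 LB qB) => //=; rewrite ?ij ?g1.
    - by apply: leq_trans powL.
    - by apply: powB'; apply: ltnW.
    move=> i hi; rewrite nread_nupd /=; case: eqP => [-> //|ni]; apply: g2; lia.
  move=> s11 hs11 ag11 g3; have ld11 : loaded s11 by apply: (loaded_agree ld10 ag11).
  have e11 : nread s11 25 0 * nread s11 0 2 = #|F| ^ j.+1.
    by rewrite (ag11.1 25) // g1 (LDN s11) // expnSr.
  apply: (wp_set L_gt0 LB qB) => //=; rewrite e11; first exact: powB'.
  by split=> [|i hi]; rewrite nread_nupd //; apply: g3.
move=> s10 hs10 ag10 [_ pw]; have ld10 : loaded s10 by apply: (loaded_agree ld9 ag10).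
have pw' j : j <= E1 + R + S2 -> nread s10 22 j = #|F| ^ j.
  by move=> hj; apply: pw; rewrite addn1.
apply: (@wp_seq _ _ _ _ _ _ (fun s11 => nread s11 7 0 = #|F| ^ E1)).
  apply: (wp_set L_gt0 LB qB) => //=; rewrite (ag10.1 9) // e9 pw' -?addnA ?leq_addr //.
    by apply: expn_lt; rewrite -addnA leq_addr.
  by rewrite nread_nupd.
move=> s11 hs11 ag11 v11; have ld11 : loaded s11 by apply: (loaded_agree ld10 ag11).
have s211 : nread s11 6 0 = S2 by rewrite ag11.1 // ag10.1.
have fin s' : agree [:: 8] [::] s11 s' -> nread s' 8 0 = #|F| ^ E2 -> env s'.
  move=> ag q2; have [h1 h2' h3 h4 h6] := loaded_agree ld11 ag isT isT.
  split=> //.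
  - by rewrite ag.1 // ag11.1 // ag10.1 // ag9.1 // ag8.1 // ag7.1 // ag6.1 // ag5.1 // ag4.1.
  - move=> d dD; rewrite ag.1 // ag11.1 // ag10.1 // ag9.1 // ag8.1 // ag7.1 // ag6.1 // ag5.1 //.
    by rewrite ag4.1 // ag3.1 // str2.
  - by move=> d dD; rewrite ag.1 // ag11.1 // ag10.1 // ag9.1 // ag8.1 // ag7.1 // ag6.1 // h5.
  - by rewrite ag.1 // ag11.1 // ag10.1 // ag9.1 // ag8.1 // ag7.1.
  - by rewrite ag.1.
  - by rewrite ag.1.
  - by rewrite ag.1 // ag11.1 // ag10.1 // ag9.1.
  by move=> j jE; rewrite ag.1 // ag11.1 // pw'.
have e2 : nread s11 22 E2 = #|F| ^ E2.
  by rewrite ag11.1 // pw' //; apply: leq_trans (geq_minl _ _) _; rewrite addnAC leq_addl.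
have e2B : #|F| ^ E2 < 2 ^ B.
  by apply: expn_lt; apply: leq_trans (geq_minl _ _) _; rewrite addnAC leq_addl.
apply: (wp_if L_gt0 LB qB) => //=; rewrite (LDN s11) // s211 => RS.
  rewrite (minn_idPl RS) in e2 e2B fin.
  apply: (wp_set L_gt0 LB qB) => //=; rewrite (LDN s11) // e2 //.
  by apply: fin; [apply: agree_nupd|rewrite nread_nupd].
have SR : S2 <= R by rewrite ltnW // ltnNge.
rewrite (minn_idPr SR) in e2 e2B fin.
apply: (wp_set L_gt0 LB qB) => //=; rewrite s211 e2 //.
by apply: fin; [apply: agree_nupd|rewrite nread_nupd].
Qed.

(** * Time of the two guessing loops *)

Lemma tweight_for i v body :
  tweight L (For i (V v) body) = 5 + L.+1 * (26 + 4 + tweight L body).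
Proof. by rewrite /=; congr (_ + L.+1 * _); lia. Qed.

(** Running a loop [q] times where the weight allows for [l] costs at most a factor [q], because q +
    1 <= q (l + 1). Applied to both loops, this yields the factor [#|F| ^ (E1 + E2)] on top of a
    polynomial weight. *)
Lemma scaled_loop_le q l a x c : 0 < q -> 0 < l ->
  a + (5 + q.+1 * x + c) <= q * (a + (5 + l.+1 * x + c)).
Proof.
move=> q0 l0; have h : q.+1 * x <= q * (l.+1 * x).
  by rewrite mulnA leq_mul2r; apply/orP; right; nia.
move: h (leq_pmull a q0) (leq_pmull c q0); rewrite !mulnDr.
move: (q * a) (q * c) (q * (_ * _)) (q.+1 * x) => *; lia.
Qed.

Lemma card_expn_gt0 j : 0 < #|F| ^ j.
Proof. by rewrite expn_gt0; apply/orP; left; apply/card_gt0P; exists 0%R. Qed.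

Lemma attempt_weight_le : attempt_weight <= #|F| ^ E2 * tweight L Attempt.
Proof.
have -> : tweight L Attempt = bweight (BLe (V 1) 0) +
   (tweight L Decode + (tweight L (For 12 vQ2 Inner) + tweight L Solve) + 1) by [].
rewrite tweight_for /attempt_weight -[nweight vQ2]/4.
move: (bweight _) (tweight L Decode) (tweight L Solve) (26 + 4 + tweight L Inner) => a b c x.
have := scaled_loop_le (a + b) x c (card_expn_gt0 E2) L_gt0; rewrite -!addnA => h.
apply: leq_trans h _; rewrite leq_mul2l; apply/orP; right.
by lia.
Qed.

Lemma search_weight_le :
  search_weight <= #|F| ^ (E1 + E2) * tweight L (For 11 vQ1 Attempt).
Proof.
rewrite tweight_for /search_weight -[nweight vQ1]/4 expnD.
have := attempt_weight_le; move: attempt_weight (tweight L Attempt) => w t h.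
apply: (@leq_trans (5 + (#|F| ^ E1).+1 * (#|F| ^ E2 * (26 + 4 + t)))).
  rewrite leq_add2l leq_mul2l mulnDr leq_add ?orbT // leq_pmull //.
  exact: card_expn_gt0.
have := scaled_loop_le 0 (#|F| ^ E2 * (26 + 4 + t)) 0 (card_expn_gt0 E1) L_gt0.
rewrite !add0n !addn0 => /leq_trans; apply.
rewrite -mulnA leq_mul2l; apply/orP; right.
rewrite [X in _ <= X]mulnDr [X in _ <= _ + X]mulnCA leq_add //.
by rewrite leq_pmull // card_expn_gt0.
Qed.

Lemma wp_main s : safe s -> loaded s -> nread s 1 0 = 0 ->
  wpN NA L B (#|F| ^ (E1 + E2) * tweight L Main) Main (fun s' =>
    nread s' 1 0 = 1 /\ good_out (fread s' 1) \/
    nread s' 1 0 = 0 /\ ~ exists (A : 'M[F]_(n0, R)) xs,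
      (Tmx = A *m outer_mx xs)%R /\ \rank A = n0) s.
Proof.
move=> hs ld fl; have [eD eR _ eN _] := ld.
have n0_gt0 : 0 < n0 by apply: N_gt0; lia.
have e3 : nread s 0 3 = n0 by apply: (eN 0); lia.
pose W := bweight (BLe vn0 0) + (bweight (BLe (vR +' 1) vn0) + (bweight (BLe vD 1) +
  (tweight L Setup + search_weight))).
apply: (@wpN_le _ _ _ _ W).
  have -> : tweight L Main = bweight (BLe vn0 0) + (tweight L (Set_ 1 1) +
    (bweight (BLe (vR +' 1) vn0) + (1 + (bweight (BLe vD 1) +
    (tweight L (FWrite 1 0 (FRead 0 0) ;; Set_ 1 1) +
    (tweight L Setup + tweight L (For 11 vQ1 Attempt))))))) by [].
  have := search_weight_le; rewrite /W.
  move: search_weight (tweight L (For 11 vQ1 Attempt)) (card_expn_gt0 (E1 + E2)).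
  move: (#|F| ^ (E1 + E2)) (tweight L Setup) (tweight L _) (tweight L _).
  move: (bweight _) (bweight _) (bweight _) => a b c q d e f w t q0 h.
  rewrite !mulnDr; move: (leq_pmull a q0) (leq_pmull b q0) (leq_pmull c q0) (leq_pmull d q0) (leq_pmull f q0) => *.
  lia.
have b1 : beval s (BLe vn0 0) = false by rewrite /= e3 leqNgt n0_gt0.
have b2 : beval s (BLe (vR +' 1) vn0) = false by rewrite /= e3 eR addn1 ltnNge n0R.
have b3 : beval s (BLe vD 1) = false by rewrite /= eD leqNgt D_gt1.
apply: (wpN_if L_gt0 LB qB) => //; rewrite b1.
apply: (wpN_if L_gt0 LB qB) => //; rewrite b2.
apply: (wpN_if L_gt0 LB qB) => //; rewrite b3.
apply: wpN_seq (wp_setup hs ld) _ => s1 hs1 ag1 he1.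
by apply: (wp_search_loop hs1 he1); rewrite ag1.1.
Qed.

End Procedures.

(** * Flat tensors and the final bounds *)

Section Bridge.
Local Open Scope nat_scope.
Variables (F : finFieldType) (D : nat) (hD : 0 < D) (n : 'I_D -> nat).
Variables (T : tensor F n) (R : nat).

(* By cases, so that [axis_dim 0] is convertible to [n (Ordinal hD)]. *)
Definition axis_dim k := if k is 0 then n (Ordinal hD) else
  if insub k is Some d then n d else 1.
Definition flat_tensor k := nth 0%R (tensor_seq T) k.

Local Notation N := axis_dim.
Local Notation Tf := flat_tensor.
Local Notation m := (stride D N 0).
Local Notation off := (offset N).
Local Notation str := (stride D N).

Lemma axis_dimE (d : 'I_D) : N d = n d.
Proof.
case: d => -[|k] kD /=; first by congr n; apply: val_inj.
by rewrite insubT.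
Qed.

Lemma axis_dim_lt k (h : k < D) : N k = n (Ordinal h).
Proof. exact: (axis_dimE (Ordinal h)). Qed.

Definition mcoord (i : midx n) k := if insub k is Some d then nat_of_ord (i d) else 0.

Lemma mcoordE i (d : 'I_D) : mcoord i d = i d.
Proof. by rewrite /mcoord valK. Qed.

Lemma mcoord_lt i k : k < D -> mcoord i k < N k.
Proof. by move=> h; rewrite (mcoordE i (Ordinal h)) axis_dim_lt. Qed.

Lemma linE i : lin i = mcoord i 0 * m + undigits D N (mcoord i).
Proof.
rewrite /undigits -(big_ltn (F := fun d => mcoord i d * str d) hD) big_mkord.
apply: eq_bigr => d _; rewrite mcoordE; congr (_ * _).
rewrite /stride (big_nat_widenl _ 0) // big_mkord.
by apply: eq_big => [//|e _]; rewrite axis_dimE.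
Qed.

Lemma prod_axis_dim : \prod_(d < D) n d = N 0 * m.
Proof.
rewrite /stride -(big_ltn (F := N) hD) big_mkord.
by apply: eq_bigr => d _; rewrite axis_dimE.
Qed.

Lemma sum_axis_dim_from k : \sum_(d < D | k <= d) n d = \sum_(k <= d < D) N d.
Proof.
rewrite (big_nat_widenl _ 0) // big_mkord.
by apply: eq_big => [//|e _]; rewrite axis_dimE.
Qed.

Lemma flat_tensorE (i : midx n) :
  T i = Tf (mcoord i 0 * m + undigits D N (mcoord i)).
Proof. by rewrite -linE /flat_tensor tensor_seqE. Qed.

Lemma loaded_input : loaded D R N Tf (input_state T R).
Proof.
split=> // d dD; rewrite /nread /= (nth_map (Ordinal hD)) ?size_enum_ord //.
rewrite axis_dim_lt; congr n; apply: val_inj => /=.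
by rewrite nth_enum_ord.
Qed.

Lemma unfolding_cpd (A : factors F n R) : is_cpd T A -> concise T ->
  \rank (A (Ordinal hD)) = n (Ordinal hD).
Proof.
move=> TA /(_ (Ordinal hD)); set d0 := Ordinal hD => rT.
apply/eqP; rewrite eqn_leq rank_leq_row /= -{1}rT.
pose G : 'M[F]_(R, #|{: slice_idx n d0}|) := (\matrix_(r, c) \prod_(d < D | d != d0)
  (if insub d is Some e then A (val e) ((enum_val c : slice_idx n d0) e) r else 1))%R.
suff -> : unfolding T d0 = (A d0 *m G)%R by apply: mxrankM_maxl.
apply/matrixP => i c; rewrite !mxE TA ffunE; apply: eq_bigr => r _.
rewrite (bigD1 d0) //= insert_coord_axis mxE; congr (_ * _)%R.
apply: eq_bigr => d dd0; rewrite insubT /=.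
by have := insert_coord_off i (enum_val c) (exist _ d dd0) => /= ->.
Qed.

(** An empty axis other than axis 0 leaves the unfolding along axis 0 without columns, so its rank
    n_0 would be 0. *)
Lemma concise_axis_dim_gt0 : concise T -> 0 < N 0 -> forall d, d < D -> 0 < N d.
Proof.
move=> cT N0 d dD; rewrite lt0n; apply: contraTneq N0 => Nd0.
case: d => [|d] in dD Nd0 *; first by rewrite Nd0.
rewrite -leqNgt leqn0 -[N 0](cT (Ordinal hD)) -leqn0.
apply: leq_trans (rank_leq_col _) _; rewrite leqn0; apply/eqP/eq_card0 => j.
have ne : Ordinal dD != Ordinal hD by [].
have : 0 < n (Ordinal dD).
  exact: leq_ltn_trans (leq0n _) (ltn_ord (j (exist _ (Ordinal dD) ne))).
by rewrite -axis_dim_lt Nd0.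
Qed.

(** With a single axis a slice has no coordinates left, so the unfolding has one column and rank at
    most 1. *)
Lemma concise_one_axis : D = 1 -> concise T -> N 0 <= 1.
Proof.
move=> D1 cT; rewrite -[N 0](cT (Ordinal hD)); apply: leq_trans (rank_leq_col _) _.
apply/card_le1P => j1 _ j2; rewrite !inE; apply/esym/eqP/ffunP => -[e ne].
by case/eqP: (ne); apply: val_inj => /=; have := ltn_ord e; lia.
Qed.

Lemma is_cpd_flat (A : factors F n R) :
  is_cpd T A <-> forall i : midx n, T i = (\sum_(r < R) \prod_(d < D) A d (i d) r)%R.
Proof. by split=> [-> i|h]; [rewrite ffunE|apply/ffunP => i; rewrite ffunE h]. Qed.

Lemma sum_axis_dim_below (d : 'I_D) : 0 < d ->
  \sum_(e < D | e < d) n e = N 0 + off d.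
Proof.
move=> d0; transitivity (\sum_(0 <= e < d) N e); last by rewrite big_ltn.
rewrite (big_nat_widen 0 d D) ?(ltnW (ltn_ord d)) // big_mkord.
by apply: eq_bigr => e _; rewrite axis_dimE.
Qed.

Lemma good_out_cpd (s : state F) : (forall d, d < D -> 0 < N d) ->
  good_out D R N Tf (fread s 1) -> is_cpd T (output_factors n R s).
Proof.
move=> N_gt0 go; apply/is_cpd_flat => i.
have ci e : 0 < e < D -> mcoord i e < N e by case/andP=> _; apply: mcoord_lt.
rewrite flat_tensorE go ?undigits_lt ?mcoord_lt //; apply: eq_bigr => r _.
rewrite (bigD1 (Ordinal hD)) //= mxE big1 // add0n -mcoordE /=; congr (_ * _)%R.
pose f d := fread s 1 ((N 0 + (off d + mcoord i d)) * R + r).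
have -> : (\prod_(d < D | d != Ordinal hD) output_factors n R s d (i d) r =
    \prod_(1 <= d < D) f d)%R.
  rewrite (big_nat_widenl _ 0) // big_mkord; apply: eq_big => [d|d dd0].
    by rewrite lt0n.
  have d0 : 0 < d by rewrite lt0n.
  by rewrite mxE sum_axis_dim_below // -mcoordE -addnA.
rewrite /outer big_nat_cond [RHS]big_nat_cond; apply: eq_bigr => d /andP[dD _].
by rewrite digit_undigits.
Qed.

(** The r-th columns of A_1, ..., A_(D-1) laid end to end. The pair of axis and coordinate is
    recovered from the position [p] by [pick]; it is unique because the blocks of different axes do
    not overlap. *)
Definition stacked_factors (A : factors F n R) (r : 'I_R) p : F :=
  if [pick x : {d : 'I_D & 'I_(n d)} | (0 < tag x) && (off (tag x) + tagged x == p)]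
  is Some x then A (tag x) (tagged x) r else 0%R.

Lemma stacked_factorsE A r (d : 'I_D) (i : 'I_(n d)) : 0 < d ->
  stacked_factors A r (off d + i) = A d i r.
Proof.
move=> d0; rewrite /stacked_factors; case: pickP => [[e j]|/(_ (Tagged _ i))] /=; last first.
  by rewrite d0 eqxx.
case/andP=> e0 /eqP eij; have lt (d1 d2 : 'I_D) (i1 : 'I_(n d1)) (i2 : 'I_(n d2)) :
    0 < d1 -> d1 < d2 -> off d1 + i1 < off d2 + i2.
  move=> h1 h2; apply: leq_trans (leq_addr _ _).
  apply: leq_trans (offset_le N (isT : 0 < d1.+1) h2).
  by rewrite offset_rec // ltn_add2l axis_dimE.
have ed : e = d.
  apply: val_inj; case: (ltngtP e d) => // h.
    by have := lt _ _ j i e0 h; rewrite eij ltnn.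
  by have := lt _ _ i j d0 h; rewrite eij ltnn.
subst e; congr (A _ _ _); apply: val_inj.
by move/eqP: eij; rewrite eqn_add2l => /eqP.
Qed.

Lemma cpd_outer_mx (A : factors F n R) : (forall d, d < D -> 0 < N d) -> is_cpd T A ->
  Tmx D N Tf = (A (Ordinal hD) *m outer_mx D N (stacked_factors A))%R.
Proof.
move=> N_gt0 /is_cpd_flat TA; apply/matrixP => i0 c; rewrite !mxE.
pose x k := if k is 0 then nat_of_ord i0 else digit D N k c.
have x_lt (d : 'I_D) : x d < n d.
  rewrite -axis_dimE; case: d => -[|k] kD /=; first exact: ltn_ord.
  exact: digit_lt.
pose i : midx n := [ffun d => Ordinal (x_lt d)].
have ci k : k < D -> mcoord i k = x k by move=> kD; rewrite (mcoordE i (Ordinal kD)) ffunE.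
have ui : undigits D N (mcoord i) = c.
  rewrite -[RHS](undigits_digit N_gt0 (ltn_ord c)) /undigits big_nat_cond [RHS]big_nat_cond.
  by apply: eq_bigr => -[|d] //; rewrite andbT => /andP[_ dD]; rewrite ci.
have := flat_tensorE i; rewrite ui ci //= => <-; rewrite TA; apply: eq_bigr => r _.
rewrite (bigD1 (Ordinal hD)) //= !mxE; congr (_ * _)%R.
  by congr (A _ _ _); apply: val_inj; rewrite /= ffunE.
rewrite /outer (big_nat_widenl _ 0) // big_mkord; apply: eq_big => [d|d dd0].
  by rewrite lt0n.
have d0 : 0 < d by rewrite lt0n.
rewrite -(stacked_factorsE A r (i d) d0); congr (stacked_factors _ _ (_ + _)).
by rewrite ffunE /=; case: (d) d0 => -[].
Qed.

End Bridge.

(** * Polynomial bounds in the input size *)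

Section Run.
Local Open Scope nat_scope.
Variables (F : finFieldType) (D : nat) (hD : 0 < D) (n : 'I_D -> nat).
Variables (T : tensor F n) (R : nat).
Hypothesis T_concise : concise T.

Local Notation I := (input_size F n R).
Local Notation N := (axis_dim hD n).
Local Notation Tf := (flat_tensor T).
(** The array lengths are products of two sizes, at most [I ^ 2], except the table of powers, which
    may need [3 * I ^ 2] cells. As [#|F| < 2 ^ I], the powers have about [3 * I ^ 3] bits. The
    constants 4 leave room for strict inequalities. *)
Local Notation L := (4 * I ^ 2).
Local Notation B := (4 * I ^ 3).
Local Notation s0 := (input_state T R).

Definition iterations := if N 0 <= R
  then #|F| ^ ((R - N 0) * offset N D + minn R (offset N D - N 1)) else 1.

Lemma iterations_gt0 : 0 < iterations.
Proof. by rewrite /iterations; case: ifP => // _; apply: card_expn_gt0. Qed.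

Lemma iterations_exponent :
  (iterations%:R <= Num.max 1 (#|F|%:R ^ exponent n hD R) :> rat)%R.
Proof.
rewrite /iterations; case: ifP => NR; last by rewrite le_max lexx.
rewrite le_max; apply/orP; right; rewrite /exponent subzn //.
rewrite !(sum_axis_dim_from hD) -PoszM -PoszD -exprnP -natrX ler_nat.
suff -> : \sum_(2 <= d < D) N d = offset N D - N 1 by [].
have [D1|D1] := ltnP 1 D; first by rewrite /offset [in RHS]big_ltn // addKn.
by rewrite /offset !big_geq // ltnW.
Qed.

Lemma sizes_le : [/\ D + R + \sum_(d < D) n d <= I, \prod_(d < D) n d <= I,
  bitlen #|F| <= I & 0 < I].
Proof.
have q0 : 0 < bitlen #|F| by [].
by rewrite /input_size; move: (\prod_(d < D) n d) (\sum_(d < D) n d) => p s; split; lia.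
Qed.

Lemma pow_le j k : j <= k -> I ^ j <= I ^ k.
Proof. by have [_ _ _ I0] := sizes_le; apply: leq_pexp2l. Qed.

Lemma L_gt0 : 0 < L.
Proof. by have [_ _ _ I0] := sizes_le; rewrite muln_gt0 expn_gt0 I0. Qed.

Lemma L_lt_B : L < 2 ^ B.
Proof. by apply: leq_ltn_trans (ltn_expl _ (isT : 1 < 2)); rewrite leq_mul2l pow_le. Qed.

Lemma I_le_B : I <= B.
Proof. by apply: leq_trans (pow_le (isT : 1 <= 3)) _; rewrite leq_pmull. Qed.

Lemma q_le_B : bitlen #|F| <= B.
Proof. by have [_ _ h _] := sizes_le; apply: leq_trans h I_le_B. Qed.

Lemma q_lt : #|F| < 2 ^ I.
Proof. by have [_ _ h I0] := sizes_le; rewrite -bitlen_leP. Qed.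

Lemma sq_le a b : a <= I -> b <= I -> a * b <= I ^ 2.
Proof. by move=> ha hb; rewrite expnS expn1; apply: leq_mul. Qed.

Lemma I_le_sq : I <= I ^ 2.
Proof. exact: pow_le (isT : 1 <= 2). Qed.

Lemma input_safe : safe 30 L B s0.
Proof.
have [h1 h2 h3 I0] := sizes_le; have Isq := I_le_sq.
have lt2 x : x <= I -> x < 2 ^ B.
  by move=> hx; apply: leq_ltn_trans L_lt_B; lia.
have lt2q : #|F| < 2 ^ B by apply: leq_trans q_lt _; rewrite leq_exp2l ?I_le_B.
split=> // [[|[|a]]|[|[|a]]|a i]; rewrite ?[size (nth _ _ a.+2)]/= ?nth_nil //.
- by rewrite -[X in X <= _]/((size [seq n d | d <- enum 'I_D]).+3) size_map size_enum_ord; lia.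
- by rewrite -[X in X <= _]/(size (tensor_seq T)) size_mkseq; lia.
case: a => [|a]; last first.
  have -> : nread s0 a.+1 i = 0 by rewrite /nread /= !nth_nil.
  exact: lt2.
case: i => [|[|[|i]]]; [by apply: (lt2 D); lia|by apply: (lt2 R); lia|exact: lt2q|].
rewrite -[nread _ _ _]/(nth 0 [seq n d | d <- enum 'I_D] i).
have [iD|Di] := ltnP i D; last first.
  by rewrite nth_default; [apply: (lt2 0)|rewrite size_map size_enum_ord].
rewrite (nth_map (Ordinal hD)) ?size_enum_ord //; apply: lt2.
set d := nth _ _ _; apply: leq_trans h1; apply: leq_trans (leq_addl _ _).
by rewrite (bigD1 d) //= leq_addr.
Qed.

Lemma no_cpd_rank (A : factors F n R) : is_cpd T A -> N 0 <= R.
Proof. by move=> cA; rewrite -[N 0](unfolding_cpd hD cA T_concise) rank_leq_col. Qed.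

Lemma wp_run : wpN 30 L B (iterations * tweight L Main) Main (correct_output T R) s0.
Proof.
have [h1 h2 h3 I0] := sizes_le; have Isq := I_le_sq.
have [LL LB qB] := And3 L_gt0 L_lt_B q_le_B.
have hs := input_safe; have ld := loaded_input hD T R; have [eD eR _ eN _] := ld.
have e3 : nread s0 0 3 = N 0 by apply: (eN 0).
have small : wp 30 L B Main (correct_output T R) s0 ->
    wpN 30 L B (iterations * tweight L Main) Main (correct_output T R) s0.
  by apply: wpN_le; rewrite leq_pmull // iterations_gt0.
have B1 : 1 < 2 ^ B by apply: leq_trans LB; rewrite ltnS.
have [n00|n0_gt0] := posnP (N 0).
  (* With n_0 = 0 the tensor has no entries, so the unwritten output already is a CPD. *)
  apply: small; apply: (wp_if LL LB qB) => //= [_|]; last by rewrite e3 n00.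
  apply: (wp_set LL LB qB) => //=; left; split; first by rewrite nread_nupd.
  apply/is_cpd_flat => i; have := ltn_ord (i (Ordinal hD)).
  by rewrite -[X in _ < X]/(N 0) n00.
have [n0R|Rn0] := leqP (N 0) R; last first.
  apply: small; apply: (wp_if LL LB qB) => //=; first by rewrite e3 leqNgt n0_gt0.
  move=> _; apply: (wp_if LL LB qB) => //=; last by rewrite eR e3 addn1 Rn0.
  move=> _; apply: (wp_skip qB) => //; right; split=> // -[A /no_cpd_rank].
  by rewrite leqNgt Rn0.
have [D1|D_gt1] := leqP D 1.
  have {}D1 : D = 1 by lia.
  have N01 : N 0 = 1 by have := concise_one_axis hD D1 T_concise; lia.
  apply: small; apply: (wp_if LL LB qB) => //=; first by rewrite e3 leqNgt n0_gt0.
  move=> _; apply: (wp_if LL LB qB) => //=; first by rewrite eR e3 addn1 ltnNge n0R.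
  move=> _; apply: (wp_if LL LB qB) => //= [_|]; last by rewrite eD => /negP[]; lia.
  (* The single entry of the tensor becomes the first column of A_0. Unwritten cells read as 0, so
     the other columns vanish. *)
  apply: (@wp_seq _ _ _ _ _ _ (fun s1 => forall r,
      fread s1 1 r = if r == 0 then Tf 0 else 0%R)).
    by apply: (wp_fwrite LL LB qB) => //= r; rewrite fread_fupd /=; case: eqP => // _;
      rewrite /fread /= nth_nil.
  move=> s1 hs1 ag1 f1; apply: (wp_set LL LB qB) => //=.
  left; split; first by rewrite nread_nupd.
  apply/is_cpd_flat => i.
  have c0 : mcoord i 0 = 0 by have := mcoord_lt hD i hD; rewrite N01; case: (mcoord i 0).
  have R0 : 0 < R by apply: leq_trans n0R.
  have only d : d = Ordinal hD by apply: val_inj => /=; have := ltn_ord d; lia.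
  have i0 : i (Ordinal hD) = 0 :> nat by rewrite -(mcoordE i (Ordinal hD)) /= c0.
  rewrite (flat_tensorE hD) c0 /undigits big_geq // ?addn0; last by lia.
  have prodE r : (\prod_(d < D) output_factors n R (nupd s1 1 0 1) d (i d) r)%R =
      if r == 0 :> nat then Tf 0 else 0%R.
    rewrite (bigD1 (Ordinal hD)) //= big1 => [|d]; last by rewrite {1}(only d) eqxx.
    by rewrite mulr1 mxE big_pred0 // fread_nupd f1 i0.
  rewrite (bigD1 (Ordinal R0)) //= prodE /= big1 ?addr0 // => r r0.
  by rewrite prodE ifF //; apply: contraNF r0 => /eqP h; apply/eqP/val_inj.
have N_gt0 := concise_axis_dim_gt0 T_concise n0_gt0.
have sumE : \sum_(d < D) n d = N 0 + offset N D.
  by rewrite -(big_ltn (F := N) hD) -(sum_axis_dim_from hD n 0); apply: eq_bigl.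
have n1S := n1_le N D_gt1.
rewrite sumE in h1; rewrite (prod_axis_dim hD) in h2.
have mI : stride D N 0 <= I by apply: leq_trans h2; rewrite leq_pmull.
have k2I : R + N 0 + N 1 <= I by apply: leq_trans h1; lia.
have E1I : (R - N 0) * offset N D <= I ^ 2 by apply: sq_le; lia.
have powL : (R - N 0) * offset N D + R + (offset N D - N 1) + 1 <= 3 * I ^ 2.
  by move: E1I; move: (_ * _) => e E1I; lia.
have powB : #|F| ^ ((R - N 0) * offset N D + R + (offset N D - N 1) + 1) < 2 ^ B.
  move: powL; move: ((R - N 0) * _ + _ + _ + 1) => e he.
  apply: (@leq_ltn_trans ((2 ^ I) ^ e)); first by case: (e) => // e'; rewrite leq_exp2r // ltnW ?q_lt.
  rewrite -expnM ltn_exp2l //; apply: (@leq_ltn_trans (I * (3 * I ^ 2))).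
    by rewrite leq_mul2l he orbT.
  by rewrite mulnCA -expnS ltn_mul2r expn_gt0 I0.
rewrite /iterations n0R.
apply: (wpN_call (wp_main LL LB qB D_gt1 N_gt0 n0R _ _ _ _ _ _ powB hs ld _)) => //.
- by lia.
- by apply: leq_trans (sq_le k2I k2I) _; rewrite leq_pmull.
- by apply: leq_trans (sq_le k2I mI) _; rewrite leq_pmull.
- by apply: (@leq_trans (I ^ 2)); [apply: sq_le; lia|rewrite leq_pmull].
- by apply: (@leq_trans (I ^ 2)); [apply: sq_le; lia|rewrite leq_pmull].
- by apply: leq_trans powL _; rewrite leq_mul2r orbT.
move=> s hs' _ [[fl go]|[fl no]]; [left|right]; split=> //.
  exact: (good_out_cpd N_gt0 go).
case=> A cA; apply: no; exists (A (Ordinal hD)), (stacked_factors hD A); split.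
  exact: cpd_outer_mx.
exact: unfolding_cpd cA T_concise.
Qed.

End Run.

Local Open Scope ring_scope.

Theorem theorem1 :
  exists (P : cmd) (c k : nat),
    forall (F : finFieldType) (D : nat) (hD : (0 < D)%N) (n : 'I_D -> nat)
           (T : tensor F n) (R : nat),
      concise T ->
      exists (s : state F) (t m : nat),
        exec P (input_state T R) s t m /\
        correct_output T R s /\
        (t%:R : rat) <= (c * input_size F n R ^ k)%N%:R
                        * Num.max 1 (#|F|%:R ^ exponent n hD R) /\
        (m <= c * input_size F n R ^ k)%N.
Proof.
have [C [k hC]] := tweight_poly Main.
(* Time: a weight of at most [C * (4 * I ^ 2) ^ k], times [B = 4 * I ^ 3]. Space:
   [60 * (1 + 16 * I ^ 5)], which is at most [1020 * I ^ 5], from 30 arrays of each kind, plus the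
   weight of one instruction times [B]. The degree 2k + 5 covers both. *)
exists Main, (C * 4 ^ k * 4 + (1020 + 4 * iweight Main))%N, (2 * k + 5)%N.
move=> F D hD n T R cT.
have [s [t [m [ex ht hm _ hc]]]] := wp_run hD R cT.
exists s, t, m; do 2![split=> //].
have [_ _ _ I0] := sizes_le F hD n R.
move: ht hm (iterations_exponent F hD n R).
move: (iterations F hD n R) I0; move: (input_size F n R) => I it I0 ht hm hit.
set w := iweight Main in hm *.
have hpow a b : (a <= b -> I ^ a <= I ^ b)%N by apply: leq_pexp2l.
have hw : (tweight (4 * I ^ 2) Main <= C * 4 ^ k * I ^ (2 * k))%N.
  have L0 : (0 < 4 * I ^ 2)%N by rewrite muln_gt0 expn_gt0 I0.
  by apply: leq_trans (hC _ L0) _; rewrite expnMn -expnM mulnA.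
split.
  have h : (t <= (C * 4 ^ k * 4 + (1020 + 4 * w)) * I ^ (2 * k + 5) * it)%N.
    apply: leq_trans ht _; rewrite -mulnA mulnC leq_mul2r; apply/orP; right.
    apply: leq_trans (leq_mul hw (leqnn _)) _.
    rewrite mulnACA -expnD; apply: leq_mul; first exact: leq_addr.
    by apply: hpow; rewrite leq_add2l.
  apply: (@le_trans _ _ (((C * 4 ^ k * 4 + (1020 + 4 * w)) * I ^ (2 * k + 5))%N%:R
     * it%:R)); first by rewrite -natrM ler_nat.
  by rewrite ler_wpM2l.
apply: leq_trans hm _; apply: (@leq_trans ((1020 + 4 * w) * I ^ 5)%N); last first.
  by apply: leq_mul; [apply: leq_addl | apply: hpow; rewrite leq_addl].
have e5 : (I ^ 2 * I ^ 3 = I ^ 5)%N by rewrite -expnD.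
rewrite /space_bound mulnACA e5; move: (hpow 3 5 isT) (hpow 0 5 isT).
rewrite expn0; move: (I ^ 3)%N (I ^ 5)%N => x y *; rewrite mulnDl; apply: leq_add; first by lia.
by rewrite mulnCA mulnA leq_mul2l; apply/orP; right.
Qed.
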